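(* Let $r>0$, $0<\theta<1$, let $\alpha$ be a learning function, and suppose $r>\theta\,\alpha(1)$. Let $\tilde k>0$. Then the balanced growth path system \begin{align*} &\gamma x\Phi'(x)=[1-\Phi(x)]\int_0^x\alpha(S(y))\Phi'(y)\,dy,\\ &(r-\gamma)v(x)+\gamma x v'(x)=\max_{s\in[0,1]}\Big\{(1-s)x+\alpha(s)\int_x^\infty[v(y)-v(x)]\Phi'(y)\,dy\Big\},\\ &S(x)=\arg\max_{s\in[0,1]}\Big\{(1-s)x+\alpha(s)\int_x^\infty[v(y)-v(x)]\Phi'(y)\,dy\Big\},\\ &\gamma=\theta\int_0^\infty\alpha(S(y))\Phi'(y)\,dy \end{align*} on $x\in\mathbb{R}^+$ has a non-trivial solution $(\Phi,v,S,\gamma)$ satisfying the Pareto-tail condition $$\lim_{x\to\infty}\frac{1-\Phi(x)}{x^{-1/\theta}}=k\qquad\text{with } k=\frac{\gamma}{\theta}\,\tilde k .$$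
   Context: A learning function is a monotone function $\alpha:[0,1]\to\mathbb{R}^+=[0,\infty)$ that is continuous on $[0,1]$, $C^\infty$ on $(0,1]$, with $\alpha(0)=0$, $\alpha'(0)=\infty$ (i.e. $\lim_{s\to0^+}\alpha'(s)=\infty$) and $\alpha''<0$. Unknowns: $\Phi:[0,\infty)\to[0,1]$ is a cumulative distribution function $\Phi(x)=\int_0^x\phi(y)\,dy$ of a density $\phi=\Phi'\ge 0$, with $\Phi(0)=0$ and $\lim_{x\to\infty}\Phi(x)=1$; $v:[0,\infty)\to\mathbb{R}$ is the value function (the integrals $\int_x^\infty[v(y)-v(x)]\Phi'(y)\,dy$ being finite); $S:[0,\infty)\to[0,1]$ is the pointwise maximiser; $\gamma$ is a real growth constant. Convention for the maximiser of $(1-s)x+\alpha(s)B$ over $s\in[0,1]$: it is $0$ if $B\le0$; it is $1$ if $B>0$ and $B\alpha'(1)\ge x$ (and also at $x=0$ when $B>0$); and it is the solution $s$ of $\alpha'(s)=x/B$ if $0<B\alpha'(1)<x$ (for $B>0$, $x>0$). The trivial (degenerate) solution is $\gamma=0$, $v(x)=x/r$, $S\equiv0$, $\Phi(x)=1$ for all $x>0$ (i.e. $\phi$ is a Dirac mass at $0$); ''non-trivial'' means different from this one. *)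

(* Defs.v *)
From HB Require Import structures.
From mathcomp Require Import all_boot all_order all_algebra.
From mathcomp Require Import all_classical all_reals all_analysis.

Set Implicit Arguments.
Unset Strict Implicit.
Unset Printing Implicit Defensive.

Import Order.TTheory GRing.Theory Num.Theory.
Import numFieldNormedType.Exports.

Local Open Scope classical_set_scope.
Local Open Scope ring_scope.

(* Functions on an interval D are represented by total functions R -> R whose
   values outside D are irrelevant.  Accordingly, derivatives are taken within
   D: they are the usual ones in the interior of D and one-sided ones at the
   endpoints of D that belong to D. *)
Definition derivable_on (R : realType) (D : set R) (f : R -> R) (x : R) : Prop :=
  cvg ((f y - f x) / (y - x) @[y --> within D x^']).

Definition derive_on (R : realType) (D : set R) (f : R -> R) (x : R) : R :=
  lim ((f y - f x) / (y - x) @[y --> within D x^']).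

Definition smooth_on (R : realType) (D : set R) (f : R -> R) : Prop :=
  forall (n : nat) (x : R), D x -> derivable_on D (iter n (derive_on D) f) x.

(* The derivative of a learning function, meaningful on ]0, 1]. *)
Definition lderiv (R : realType) (alpha : R -> R) : R -> R :=
  derive_on `]0, 1] alpha.

Record learning_function (R : realType) (alpha : R -> R) : Prop := {
  learning_ge0 : forall s : R, s \in `[0, 1] -> 0 <= alpha s ;
  learning_mono : {in `[0, 1] &, {homo alpha : s t / s <= t}} ;
  learning_cont : {within `[0, 1], continuous alpha} ;
  learning_smooth : smooth_on `]0, 1] alpha ;
  learning_at0 : alpha 0 = 0 ;
  learning_deriv0 : lderiv alpha s @[s --> 0^'+] --> +oo ;
  learning_concave :
    forall s : R, s \in `]0, 1] -> derive_on `]0, 1] (lderiv alpha) s < 0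
}.

Definition is_max_on (R : realType) (A : set R) (f : R -> R) (m : R) : Prop :=
  (exists2 s, A s & f s = m) /\ (forall s, A s -> f s <= m).

Definition is_argmax_on (R : realType) (A : set R) (f : R -> R) (s : R) : Prop :=
  A s /\ (forall t, A t -> f t <= f s).

Section BalancedGrowthPath.
Context {R : realType}.
Implicit Types (alpha Phi v S : R -> R) (r theta gamma x B s : R).

Local Notation leb := (@lebesgue_measure R).

(* Derivative of a function on R^+ = [0, +oo[ (right derivative at 0). *)
Definition deriv_pos (f : R -> R) : R -> R := derive_on `[0, +oo[ f.

Record is_cdf Phi : Prop := {
  cdf_range : forall x, 0 <= x -> 0 <= Phi x <= 1 ;
  cdf_at0 : Phi 0 = 0 ;
  cdf_derivable : forall x, 0 <= x -> derivable_on `[0, +oo[ Phi x ;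
  cdf_density_ge0 : forall x, 0 <= x -> 0 <= deriv_pos Phi x ;
  cdf_density_integrable : leb.-integrable `[0, +oo[ (EFin \o deriv_pos Phi) ;
  cdf_density : forall x, 0 <= x ->
    Phi x = Rintegral leb `[0, x] (deriv_pos Phi) ;
  cdf_lim : Phi x @[x --> +oo] --> (1 : R)
}.

Definition gain_integrand Phi v x : R -> R :=
  fun y => (v y - v x) * deriv_pos Phi y.

Definition gain Phi v x : R :=
  Rintegral leb `[x, +oo[ (gain_integrand Phi v x).

Definition payoff alpha x B s : R := (1 - s) * x + alpha s * B.

(* Selection rule for the maximiser of [payoff alpha x B].  It determines the
   maximiser also for x = B = 0, when every s in [0, 1] is one. *)
Definition maximiser_rule alpha x B s : Prop :=
  [/\ B <= 0 -> s = 0,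
      0 < B -> x <= B * lderiv alpha 1 \/ x = 0 -> s = 1
    & 0 < B -> 0 < x -> B * lderiv alpha 1 < x ->
        s \in `]0, 1] /\ lderiv alpha s = x / B].

Definition search_integrand alpha Phi S : R -> R :=
  fun y => alpha (S y) * deriv_pos Phi y.

Record bgp_solution r theta alpha Phi v S gamma : Prop := {
  bgp_cdf : is_cdf Phi ;
  bgp_v_derivable : forall x, 0 <= x -> derivable_on `[0, +oo[ v x ;
  bgp_gain_finite : forall x, 0 <= x ->
    leb.-integrable `[x, +oo[ (EFin \o gain_integrand Phi v x) ;
  bgp_search_finite :
    leb.-integrable `[0, +oo[ (EFin \o search_integrand alpha Phi S) ;
  bgp_Phi : forall x, 0 <= x ->
    gamma * x * deriv_pos Phi x =
    (1 - Phi x) * Rintegral leb `[0, x] (search_integrand alpha Phi S) ;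
  bgp_v : forall x, 0 <= x ->
    is_max_on `[0, 1] (payoff alpha x (gain Phi v x))
      ((r - gamma) * v x + gamma * x * deriv_pos v x) ;
  bgp_S : forall x, 0 <= x ->
    is_argmax_on `[0, 1] (payoff alpha x (gain Phi v x)) (S x) /\
    maximiser_rule alpha x (gain Phi v x) (S x) ;
  bgp_gamma :
    gamma = theta * Rintegral leb `[0, +oo[ (search_integrand alpha Phi S)
}.

Definition trivial_solution r Phi v S gamma : Prop :=
  [/\ gamma = 0,
      forall x, 0 <= x -> v x = x / r,
      forall x, 0 <= x -> S x = 0
    & forall x, 0 < x -> Phi x = 1].

Definition pareto_tail theta Phi (k : R) : Prop :=
  (1 - Phi x) / (x `^ (- theta^-1)) @[x --> +oo] --> k.

End BalancedGrowthPath.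

(* Main.v *)
Require Import Defs.
From mathcomp Require Import all_boot all_order all_algebra.
From mathcomp Require Import all_classical all_reals all_analysis.
From mathcomp Require Import measurable_realfun.
From mathcomp Require Import ring lra zify.
Import Order.TTheory GRing.Theory Num.Theory.
Import numFieldNormedType.Exports.
Local Open Scope classical_set_scope.
Local Open Scope ring_scope.
Set Implicit Arguments.
Unset Strict Implicit.
Unset Printing Implicit Defensive.

(* Take the quantile p = Phi(x) as independent variable and write
   F(p) = int_0^p alpha(S), w = v', b = B/x, where B is the gain integral, so
   that S is a function of b alone.  Differentiating the Hamilton-Jacobi-Bellman
   equation and using B' = - (1 - Phi) v', the system becomes
     F' = alpha(S),   w' = ((1 - S) - (r + (1 - p) alpha(S)) w) / ((1 - p) F),
     b' = - gamma (b / (1 - p) + w) / F,   (ln x)' = gamma / ((1 - p) F)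
   on ]0, 1[, with F(1) = gamma / theta, w(0) = 0 and b(1) = 0.  In this form it
   is cooperative in (F, - w, b) and decreasing in gamma.  A semi-implicit Euler
   scheme inherits this: for each initial value beta of b there is exactly one
   gamma with F(1) = gamma / theta, it depends continuously on beta, and the
   intermediate value theorem in beta yields b(1) = 0.  The bounds
   p gamma / theta <= F <= gamma / theta and
   theta (1 - p) w <= b <= C (1 - p) / p are uniform in the mesh, and all
   increments are bounded by monotone quantities, so a pointwise limit along an
   ultrafilter solves the differential system; the lower bound on w for p close
   to 1 keeps gamma positive.  Finally Phi is the inverse of p |-> x, whose
   scale is free and is fixed by the Pareto constant: (1 - p) x^(1/theta) is
   nondecreasing and bounded. *)

(** * Learning functions and the optimal share *)

(** Since the share depends only on the ratio of gain to size, x drops out of the equations for [F],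
    [w] and [b] and is recovered at the end by integration. The price is a two-point problem that is
    singular at both ends: [F] vanishes at p = 0 and 1 - p at p = 1. Shooting in the continuous
    system would start from singular data, so the grid begins one cell away from 0. Treating the
    decay terms implicitly keeps every step monotone however large the mesh is compared with (1 - p)
    F; comparison then holds up to the last node, and two nested one-dimensional intermediate value
    arguments replace a fixed point theorem. The remaining danger is that the discrete solutions
    collapse to the trivial one, with growth rate and [F] tending to 0. The upper bound on [b]
    contains neither the mesh nor the growth rate, so near p = 1 it forces the share below 1/2 in
    every discrete solution. The source of [w] is then at least 1/2, which gives in turn w > 0, b >
    0 and a strictly increasing [F] there. *)

Section DerivativeOn.
Context {R : realType}.
Implicit Types (D : set R) (f : R -> R) (x d : R).

Lemma quotient_is_derive f x d :
  (f y - f x) / (y - x) @[y --> x^'] --> d -> is_derive x (1 : R) f d.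
Proof.
move=> fd; apply/is_derive1_caratheodory.
exists (fun y => if y == x then d else (f y - f x) / (y - x)); split => [z||].
- by case: eqP => [->|/eqP zx]; rewrite ?subrr ?mulr0// divfK// subr_eq0.
- apply/continuous_withinNx; rewrite eqxx.
  apply: cvg_trans fd; apply: near_eq_cvg; near=> y.
  by rewrite ifF//; apply/negbTE; near: y; exact: nbhs_dnbhs_neq.
- by rewrite eqxx.
Unshelve. all: by end_near. Qed.

Lemma is_derive_quotient f x d :
  is_derive x (1 : R) f d -> (f y - f x) / (y - x) @[y --> x^'] --> d.
Proof.
move=> /is_derive1_caratheodory[g [fE cg <-]].
move/continuous_withinNx: cg; apply: cvg_trans; apply: near_eq_cvg; near=> y.
rewrite fE mulfK// subr_eq0; near: y; exact: nbhs_dnbhs_neq.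
Unshelve. all: by end_near. Qed.

(** In the interior of [D] the filters [within D x^'] and [x^'] coincide, so the relative derivative
    is the ordinary one and the usual calculus applies. *)
Lemma derivable_on_is_derive D f x : nbhs x D -> derivable_on D f x ->
  is_derive x (1 : R) f (derive_on D f x).
Proof.
move=> Dx; rewrite /derivable_on => /cvg_ex[l fl]; apply: quotient_is_derive.
have xD : x^' D by exact: nbhs_dnbhs.
have fl' : (f y - f x) / (y - x) @[y --> x^'] --> l.
  apply: cvg_trans fl => A /=; rewrite !near_simpl => fA.
  by apply: (@filterS2 _ _ _ _ _ _ _ xD fA) => y Dy; apply.
rewrite /derive_on; suff -> : within D x^' = x^' by have -> := cvg_lim _ fl'.
apply/predeqP => A; split; last exact: cvg_within.
by move=> fA; apply: (@filterS2 _ _ _ _ _ _ _ xD fA) => y Dy; apply.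
Qed.

(** Serves at the right endpoint 1 of the domain of a learning function, where only a one-sided
    difference quotient is available. *)
Lemma continuous_derivable_on_left f a x : a < x ->
  derivable_on `]a, x] f x -> f y @[y --> x^'-] --> f x.
Proof.
move=> ax /cvg_ex[l fl].
have fl' : (f y - f x) / (y - x) @[y --> x^'-] --> l.
  apply: cvg_trans fl => A /=; rewrite !near_simpl => fA.
  have {}fA : \forall y \near x^'-,
    y != x -> y \in `]a, x] -> A ((f y - f x) / (y - x)).
    by apply: cvg_within; exact: fA.
  near=> y.
  have yx : y < x by near: y; exact: nbhs_left_lt.
  have ay : a < y by near: y; exact: nbhs_left_gt.
  have : y != x -> y \in `]a, x] -> A ((f y - f x) / (y - x)) by near: y.
  by apply; rewrite ?lt_eqF// in_itv/= ay ltW.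
have yx0 : y - x @[y --> x^'-] --> x - x.
  by apply: cvgB; [exact: cvg_within|exact: cvg_cst].
have : f x + (f y - f x) / (y - x) * (y - x) @[y --> x^'-] --> f x + l * (x - x).
  by apply: cvgD; [exact: cvg_cst|exact: cvgM].
rewrite subrr mulr0 addr0; apply: cvg_trans; apply: near_eq_cvg; near=> y.
rewrite divfK ?subrKC// subr_eq0 lt_eqF//; near: y; exact: nbhs_left_lt.
Unshelve. all: by end_near. Qed.

End DerivativeOn.

Section LearningFunction.
Context {R : realType}.
Variable alpha : R -> R.
Implicit Types s t b c e : R.
Hypothesis H : learning_function alpha.
Local Notation A := (lderiv alpha).

Lemma nbhs_oc01 s : 0 < s < 1 -> nbhs s `]0, 1]%classic.
Proof.
move=> s01; apply: (@filterS _ _ _ `]0, 1[%classic).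
  by move=> t /=; rewrite !in_itv/= => /andP[-> /ltW].
by apply: near_in_itvoo; rewrite in_itv.
Qed.

Lemma is_derive_alpha s : 0 < s < 1 -> is_derive s (1 : R) alpha (A s).
Proof.
move=> s01; apply: derivable_on_is_derive; first exact: nbhs_oc01.
apply: (learning_smooth H (n := 0%N)); rewrite /= in_itv/=.
by case/andP: s01 => -> /ltW.
Qed.

Lemma is_derive_lderiv s : 0 < s < 1 ->
  is_derive s (1 : R) A (derive_on `]0, 1] A s).
Proof.
move=> s01; apply: derivable_on_is_derive; first exact: nbhs_oc01.
apply: (learning_smooth H (n := 1%N)); rewrite /= in_itv/=.
by case/andP: s01 => -> /ltW.
Qed.

Lemma lderiv_at_left1 : A t @[t --> 1^'-] --> A 1.
Proof.
apply: (@continuous_derivable_on_left _ _ 0) => //.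
by apply: (learning_smooth H (n := 1%N)); rewrite /= in_itv/= ltr01 lexx.
Qed.

Lemma continuous_lderiv a : 0 < a < 1 -> {within `[a, 1], continuous A}.
Proof.
move=> /andP[a0 a1]; apply/continuous_within_itvP => //; split.
- move=> x; rewrite in_itv/= => /andP[ax x1].
  apply: differentiable_continuous; apply/derivable1_diffP.
  by apply: ex_derive; apply: is_derive_lderiv; rewrite x1 (lt_trans a0 ax).
- apply: cvg_at_right_filter; apply: differentiable_continuous.
  apply/derivable1_diffP.
  by apply: ex_derive; apply: is_derive_lderiv; rewrite a1 a0.
- exact: lderiv_at_left1.
Qed.

Lemma lderiv_lt s t : 0 < s -> s < t -> t <= 1 -> A t < A s.
Proof.
move=> s0 st t1.
have s01 : 0 < s < 1 by rewrite s0 (lt_le_trans st t1).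
have [x||c] := @MVT R A (derive_on `]0, 1] A) s t st.
- rewrite in_itv/= => /andP[sx xt]; apply: is_derive_lderiv.
  by rewrite (lt_trans s0 sx) (lt_le_trans xt t1).
- apply: continuous_subspaceW (continuous_lderiv s01).
  exact: subset_itvl.
- rewrite in_itv/= => /andP[sc ct] E; rewrite -subr_lt0 E pmulr_llt0 ?subr_gt0//.
  apply: (learning_concave H).
  by rewrite in_itv/= (lt_trans s0 sc) (ltW (lt_le_trans ct t1)).
Qed.

Lemma lderiv_le s t : 0 < s -> s <= t -> t <= 1 -> A t <= A s.
Proof.
move=> s0; rewrite le_eqVlt => /predU1P[->//|st] t1.
exact/ltW/lderiv_lt.
Qed.

Lemma alpha_MVT s t : 0 <= s -> s < t -> t <= 1 ->
  exists2 c, s < c < t & alpha t - alpha s = A c * (t - s).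
Proof.
move=> s0 st t1.
have [x||c cst E] := @MVT R alpha A s t st.
- rewrite in_itv/= => /andP[sx xt]; apply: is_derive_alpha.
  by rewrite (le_lt_trans s0 sx) (lt_le_trans xt t1).
- apply: continuous_subspaceW (learning_cont H).
  by move=> x /=; rewrite !in_itv/= => /andP[/(le_trans s0)-> /le_trans->].
- by exists c.
Qed.

(** Monotonicity of [alpha] only yields some nonnegative slope between [s] and 1; strictness comes
    from the strict decrease of the derivative. At 1 itself the derivative may vanish. *)
Lemma lderiv_gt0 s : 0 < s < 1 -> 0 < A s.
Proof.
move=> /andP[s0 s1].
have [c /andP[sc c1] E] := alpha_MVT (ltW s0) s1 (lexx _).
apply: le_lt_trans (lderiv_lt s0 sc (ltW c1)).
have s10 : 0 < 1 - s by rewrite subr_gt0.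
rewrite -(pmulr_lge0 (A c) s10) -E subr_ge0; apply: (learning_mono H) => //; last exact: ltW.
  by rewrite in_itv/= !ltW.
by rewrite in_itv/= ler01 lexx.
Qed.

Lemma lderiv1_ge0 : 0 <= A 1.
Proof.
apply: (@ler_cvg_to _ _ _ _ (cst 0) A 0 (A 1) _ lderiv_at_left1).
  exact: cvg_cst.
near=> t; rewrite ltW// lderiv_gt0//; apply/andP; split; near: t.
  exact: nbhs_left_gt.
exact: nbhs_left_lt.
Unshelve. all: by end_near. Qed.

Lemma alpha_lt s t : 0 <= s -> s < t -> t <= 1 -> alpha s < alpha t.
Proof.
move=> s0 st t1; have [c /andP[sc ct] E] := alpha_MVT s0 st t1.
rewrite -subr_gt0 E mulr_gt0 ?subr_gt0// lderiv_gt0//.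
by rewrite (le_lt_trans s0 sc) (lt_le_trans ct t1).
Qed.

Lemma alpha_tangent s t : 0 < s <= 1 -> 0 <= t <= 1 ->
  alpha t <= alpha s + A s * (t - s).
Proof.
move=> /andP[s0 s1] /andP[t0 t1]; case: (ltgtP s t) => st; last first.
- by rewrite st subrr mulr0 addr0.
- have [c /andP[tc cs] E] := alpha_MVT t0 st s1.
  rewrite -opprB mulrN; rewrite lerBrDr -lerBrDl E.
  rewrite ler_pM2r ?subr_gt0//; apply: lderiv_le => //; last exact: ltW.
  exact: le_lt_trans tc.
- have [c /andP[sc ct] E] := alpha_MVT (ltW s0) st t1.
  rewrite -lerBlDl E ler_pM2r ?subr_gt0//; apply: lderiv_le => //.
    exact: ltW.
  exact/ltW/(lt_le_trans ct).
Qed.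

Lemma lderiv_surj b : 0 < b -> b * A 1 < 1 ->
  exists2 s, 0 < s < 1 & b * A s = 1.
Proof.
move=> b0 bA1; have b1 : 0 < b^-1 by rewrite invr_gt0.
(* The blow-up of the derivative at 0 supplies the left endpoint for the intermediate value
   theorem. *)
have [u u01 Au] : exists2 u, 0 < u < 1 & b^-1 <= A u.
  have /cvgryPge/(_ b^-1) Ab := learning_deriv0 H.
  have : \forall u \near 0^'+, 0 < u < 1 /\ b^-1 <= A u.
    near=> u; split; last by near: u.
    by apply/andP; split; near: u;
      [exact: nbhs_right_gt|exact: nbhs_right_lt].
  by move/filter_ex => [u [? ?]]; exists u.
have A1b : A 1 < b^-1 by rewrite -(ltr_pM2l b0) mulfV// gt_eqF.
case/andP: (u01) => u0 u1.
have [|c] := @IVT R A u 1 b^-1 (ltW u1) (continuous_lderiv u01).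
  by rewrite ge_min le_max Au (ltW A1b) orbT.
rewrite in_itv/= => /andP[uc c1] Ac.
exists c; last by rewrite Ac mulfV// gt_eqF.
rewrite (lt_le_trans u0 uc)/= lt_neqAle c1 andbT.
by apply/eqP => c1E; rewrite -Ac c1E ltxx in A1b.
Unshelve. all: by end_near. Qed.

(* The maximiser of (1 - s) x + alpha(s) B is [share (B / x)] when x > 0. *)
Definition share (b : R) : R :=
  if b <= 0 then 0 else if 1 <= b * A 1 then 1
  else xget 0 [set s | 0 < s < 1 /\ b * A s = 1].

Lemma shareP b : 0 < b -> b * A 1 < 1 ->
  0 < share b < 1 /\ b * A (share b) = 1.
Proof.
move=> b0 bA; rewrite /share leNgt b0/= leNgt bA/=.
have [s s01 As] := lderiv_surj b0 bA.
by case: xgetP => [x -> //|/(_ s)/=]; tauto.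
Qed.

Lemma share0 b : b <= 0 -> share b = 0.
Proof. by rewrite /share => ->. Qed.

Lemma share1 b : 0 < b -> 1 <= b * A 1 -> share b = 1.
Proof. by move=> b0 bA; rewrite /share leNgt b0/= bA. Qed.

Lemma share_bounds b : 0 <= share b <= 1.
Proof.
have [b0|b0] := leP b 0; first by rewrite share0// lexx ler01.
have [bA|bA] := leP 1 (b * A 1); first by rewrite share1// lexx ler01.
by have [/andP[/ltW-> /ltW->]] := shareP b0 bA.
Qed.

Lemma share_gt0 b : 0 < b -> 0 < share b.
Proof.
move=> b0; have [bA|bA] := leP 1 (b * A 1); first by rewrite share1.
by have [/andP[->]] := shareP b0 bA.
Qed.

(** As the derivative decreases, the points below the maximiser are those where the marginal return
    [b * A t] is at least the unit cost. Monotonicity and continuity of [share] follow from this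
    equivalence without its three defining cases. *)
Lemma le_shareP b t : 0 < t <= 1 -> (t <= share b) = (1 <= b * A t).
Proof.
move=> /andP[t0 t1].
have At0 : 0 <= A t by exact: (le_trans lderiv1_ge0 (lderiv_le t0 t1 (lexx _))).
have [b0|b0] := leP b 0.
  rewrite share0// leNgt t0/=; apply/esym/negbTE; rewrite -ltNge.
  exact: (le_lt_trans (mulr_le0_ge0 b0 At0)).
have [bA|bA] := leP 1 (b * A 1).
  rewrite share1// t1; apply/esym/(le_trans bA).
  by rewrite ler_pM2l// lderiv_le.
have [/andP[c0 c1] E] := shareP b0 bA.
rewrite -E ler_pM2l//; apply/idP/idP => [tc|].
  by apply: lderiv_le => //; exact: ltW.
apply: contraTT; rewrite -!ltNge => ct; exact: lderiv_lt.
Qed.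

Lemma share_gt0_le1 b : 0 < b -> 0 < share b <= 1.
Proof. by move=> b0; rewrite share_gt0//; case/andP: (share_bounds b). Qed.

Lemma share_ge1 b : 0 < b -> 1 <= b * A (share b).
Proof. by move=> b0; rewrite -le_shareP// share_gt0_le1. Qed.

Lemma share_homo : {homo share : b c / b <= c}.
Proof.
move=> b c bc; have [b0|b0] := leP b 0.
  by rewrite share0//; case/andP: (share_bounds c).
have cb := share_gt0_le1 b0.
rewrite le_shareP// (le_trans (share_ge1 b0))//.
case/andP: cb => c0 c1; rewrite ler_wpM2r//.
exact: (le_trans lderiv1_ge0 (lderiv_le c0 c1 (lexx _))).
Qed.

Lemma continuous_share : continuous share.
Proof.
move=> b; apply/cvgrPdist_lt => e e0.
(* By [le_shareP], lying strictly below a level [t] means [c * A t < 1], an open condition on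
   [c]. *)
have up : \forall c \near b, share c < share b + e.
  have [be|eb] := ltP 1 (share b + e).
    by near=> c; apply: le_lt_trans be; case/andP: (share_bounds c).
  have t01 : 0 < share b + e <= 1.
    by rewrite eb ltr_wpDl//; case/andP: (share_bounds b).
  have : b * A (share b + e) < 1.
    by rewrite ltNge -le_shareP// -ltNge ltrDl.
  have : c * A (share b + e) @[c --> b] --> b * A (share b + e).
    by apply: cvgMl; exact: cvg_id.
  move=> /cvgr_lt/[apply]; apply: filterS => c.
  by rewrite ltNge -le_shareP// -ltNge.
have lo : \forall c \near b, share b - e < share c.
  have [be|eb] := ltP (share b - e) 0.
    by near=> c; apply: (lt_le_trans be); case/andP: (share_bounds c).
  have cb0 : 0 < share b by rewrite (lt_le_trans e0)// -subr_ge0.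
  have cb1 : share b <= 1 by case/andP: (share_bounds b).
  (* Lowering by half of [e] keeps [t] positive and makes [1 < b * A t] strict, hence stable under
     small changes of [b]. *)
  pose t := share b - e / 2.
  have t01 : 0 < t <= 1 by rewrite /t; lra.
  have : 1 < b * A t.
    have b0 : 0 < b by rewrite ltNge; apply: contraL cb0 => /share0->; rewrite ltxx.
    apply: (le_lt_trans (share_ge1 b0)).
    rewrite ltr_pM2l//; apply: lderiv_lt => //; first by case/andP: t01.
    by rewrite /t; lra.
  have : c * A t @[c --> b] --> b * A t by apply: cvgMl; exact: cvg_id.
  move=> /cvgr_gt/[apply]; apply: filterS => c /ltW.
  by rewrite -le_shareP//; apply: lt_le_trans; rewrite /t; lra.
near=> c; rewrite ltr_distlC; apply/andP; split; near: c => //.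
Unshelve. all: by end_near. Qed.

(** For small [b] the source term [1 - share b] of the equation for [w] is thus at least 1/2; the
    positivity of the growth rate rests on this. *)
Lemma exists_share_le_half : exists2 b, 0 < b & share b <= 2^-1.
Proof.
have h01 : 0 < (2^-1 : R) < 1 by lra.
have A0 := lderiv_gt0 h01.
exists (A 2^-1)^-1; first by rewrite invr_gt0.
rewrite leNgt; apply/negP => hc.
have /share_gt0_le1/andP[c0 c1] : 0 < (A 2^-1)^-1 by rewrite invr_gt0.
have /share_ge1 : 0 < (A 2^-1)^-1 by rewrite invr_gt0.
rewrite ler_pdivlMl// mulr1 leNgt; apply/negP/negPn; apply: lderiv_lt => //; lra.
Qed.

Lemma share_cvg1 e : 0 < e -> exists2 M, 0 < M & forall b, M <= b -> 1 - e <= share b.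
Proof.
move=> e0; have [e1|e1] := leP 1 e.
  exists 1 => // b _; have := share_bounds b; lra.
have t01 : 0 < 1 - e < 1 by lra.
have A0 := lderiv_gt0 t01.
exists (A (1 - e))^-1; first by rewrite invr_gt0.
move=> b Mb; rewrite le_shareP; last by lra.
by rewrite -ler_pdivrMr// mul1r.
Qed.

(** The tangent of [alpha] at [share b] reduces the claim to the first-order condition: either
    [b * A (share b) = 1], or the share is 1, the slope is at least 1 and every competitor lies to
    the left. *)
Lemma share_max b t : 0 < b -> 0 <= t <= 1 ->
  (1 - t) + alpha t * b <= (1 - share b) + alpha (share b) * b.
Proof.
move=> b0 t01.
have cb := share_gt0_le1 b0.
have tg := alpha_tangent cb t01.
suff : b * A (share b) * (t - share b) <= t - share b.
  move: tg; rewrite -(ler_pM2l b0); lra.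
have [bA|bA] := leP 1 (b * A 1); last first.
  by have [_ ->] := shareP b0 bA; rewrite mul1r.
rewrite share1//; have : t - 1 <= 0 by lra.
by move: bA; set u := _ * _; nra.
Qed.

Lemma continuous_alpha_share : continuous (alpha \o share).
Proof.
move=> b; have cb : `[0, 1]%classic (share b) by rewrite /= in_itv/= share_bounds.
have ac : {within `[0, 1], continuous alpha} := learning_cont H.
(* [alpha] is continuous only relative to [0, 1], which suffices because [share] takes its values
   there. *)
have {}ac : alpha t @[t --> within `[0, 1]%classic (nbhs (share b))] -->
    alpha (share b) by rewrite (nbhs_subspace_in cb); exact: ac.
apply: (@cvg_comp _ _ _ share alpha) ac.
move=> U /= cU.
have {}cU : \forall c \near b, share c \in `[0, 1] -> U (share c).
  exact: (@continuous_share b _ cU).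
change (\forall c \near b, U (share c)); apply: filterS cU => c /= cU; apply: cU.
by rewrite in_itv/= share_bounds.
Qed.

Lemma alpha_share_homo : {homo alpha \o share : b c / b <= c}.
Proof.
move=> b c bc; apply: (learning_mono H); rewrite ?in_itv/= ?share_bounds//.
exact: share_homo.
Qed.

Lemma alpha_share_gt0 b : 0 < b -> 0 < alpha (share b).
Proof.
move=> b0; rewrite -(learning_at0 H); apply: alpha_lt => //.
  exact: share_gt0.
by case/andP: (share_bounds b).
Qed.

Lemma alpha_share_ge0 b : 0 <= alpha (share b).
Proof. by apply: (learning_ge0 H); rewrite in_itv/= share_bounds. Qed.

Lemma alpha_share_le b : alpha (share b) <= alpha 1.
Proof.
apply: (learning_mono H); rewrite ?in_itv/= ?share_bounds ?ler01 ?lexx//.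
by case/andP: (share_bounds b).
Qed.

Lemma maximiser_rule_share x B : 0 < x ->
  maximiser_rule alpha x B (share (B / x)).
Proof.
move=> x0; split.
- by move=> B0; rewrite share0// pmulr_lle0 ?invr_gt0.
- move=> B0 [xB|x00]; last by rewrite x00 ltxx in x0.
  rewrite share1 ?divr_gt0// mulrAC ler_pdivlMr// mul1r//.
- move=> B0 _ Bx.
  have Bx1 : B / x * A 1 < 1 by rewrite mulrAC ltr_pdivrMr// mul1r.
  have [c01 E] := shareP (divr_gt0 B0 x0) Bx1.
  split; first by rewrite in_itv/=; case/andP: c01 => -> /ltW.
  by rewrite -[RHS]mulr1 -E; field; rewrite !gt_eqF.
Qed.

Lemma payoff_share_max x B s : 0 < x -> 0 <= s <= 1 -> 0 < B ->
  payoff alpha x B s <= payoff alpha x B (share (B / x)).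
Proof.
move=> x0 s01 B0; have Bx : 0 < B / x by rewrite divr_gt0.
have := share_max Bx s01; rewrite -(ler_pM2r x0) /payoff.
have -> z : ((1 - z) + alpha z * (B / x)) * x = (1 - z) * x + alpha z * B.
  by field; rewrite gt_eqF.
have -> z : ((1 - z) + alpha z * (B / x)) * x = (1 - z) * x + alpha z * B.
  by field; rewrite gt_eqF.
by [].
Qed.

End LearningFunction.

(** * The discretised system *)

Section Increments.
Context {R : realFieldType}.
Implicit Types u : nat -> R.

Lemma increments_ge u (c : R) i j : (i <= j)%N ->
  (forall l, (i <= l < j)%N -> c <= u l.+1 - u l) ->
  c * (j - i)%:R <= u j - u i.
Proof.
move=> ij; rewrite -(subnKC ij); move: (j - i)%N => k {j ij}.
rewrite addKn; elim: k => [|k IH] cu; first by rewrite mulr0 addn0 subrr.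
rewrite addnS -natr1 mulrDr mulr1.
have -> : u (i + k).+1 - u i = (u (i + k)%N - u i) + (u (i + k).+1 - u (i + k)%N).
  by ring.
rewrite lerD ?cu ?IH ?leq_addr ?addnS ?leqnn// => l /andP[il lk].
by rewrite cu// il addnS ltnS ltnW.
Qed.

Lemma increments_le u (c : R) i j : (i <= j)%N ->
  (forall l, (i <= l < j)%N -> u l.+1 - u l <= c) ->
  u j - u i <= c * (j - i)%:R.
Proof.
move=> ij cu; rewrite -lerN2 -mulNr opprB addrC -{1}[u i]opprK.
apply: (@increments_ge (fun l => - u l)) => // l /cu.
by rewrite -lerN2; lra.
Qed.

Lemma nat_homo u i j : (i <= j)%N ->
  (forall l, (i <= l < j)%N -> u l <= u l.+1) -> u i <= u j.
Proof.
move=> ij H; rewrite -subr_ge0 -(mul0r (j - i)%:R).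
by apply: increments_ge => // l /H; rewrite subr_ge0.
Qed.

Lemma nat_antihomo u i j : (i <= j)%N ->
  (forall l, (i <= l < j)%N -> u l.+1 <= u l) -> u j <= u i.
Proof.
move=> ij H; rewrite -lerN2; apply: (@nat_homo (fun l => - u l)) => // l /H.
by rewrite lerN2.
Qed.

End Increments.

(** For the estimates anchored at the terminal condition p = 1. *)
Lemma backward_ind m (P : nat -> Prop) : P m ->
  (forall i, (i < m)%N -> P i.+1 -> P i) -> forall i, (i <= m)%N -> P i.
Proof.
move=> Pm H i im; rewrite -(subKn im).
have : (m - i <= m)%N by exact: leq_subr.
elim: (m - i)%N => [|k IH] km; first by rewrite subn0.
by apply: H; [lia|rewrite subnSK//; apply: IH; exact: ltnW].
Qed.

(** * Monotonicity of a single semi-implicit step *)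

Section SemiImplicitStep.
Context {R : realFieldType}.
Implicit Types k c q w : R.

(** The step is a weighted mean of [w] and the equilibrium [c / q]. A larger [k] moves it towards
    the equilibrium, which is an increase only if [w] starts below it; hence the hypothesis
    [q * w <= c]. *)
Lemma relaxation_step_homo k k' c c' q q' w w' :
  0 <= k -> k <= k' -> 0 <= q' -> q' <= q -> 0 <= c -> c <= c' ->
  0 <= w -> w <= w' -> q * w <= c ->
  (w + k * c) / (1 + k * q) <= (w' + k' * c') / (1 + k' * q').
Proof.
move=> k0 kk' q'0 q'q c0 cc' w0 ww' qw.
have k'0 := le_trans k0 kk'; have q0 := le_trans q'0 q'q.
have D1 : 0 < 1 + k * q by rewrite ltr_wpDr// mulr_ge0.
have D2 : 0 < 1 + k' * q by rewrite ltr_wpDr// mulr_ge0.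
have D3 : 0 < 1 + k' * q' by rewrite ltr_wpDr// mulr_ge0.
apply: (@le_trans _ _ ((w + k' * c) / (1 + k' * q))).
  rewrite ler_pdivrMr// mulrAC ler_pdivlMr// -subr_ge0.
  rewrite (_ : _ - _ = (k' - k) * (c - q * w)); last by ring.
  by rewrite mulr_ge0// subr_ge0.
apply: ler_pM.
- by rewrite addr_ge0// mulr_ge0.
- by rewrite invr_ge0 ltW.
- by rewrite lerD// ler_pM.
- by rewrite lef_pV2 ?posrE// lerD2l ler_wpM2l.
Qed.

(** The step is a weighted mean of [c >= 0] and [- v <= 0], and a larger [k] shifts the weight to
    the latter. *)
Lemma decay_step_homo k k' c c' v v' :
  0 <= k -> k <= k' -> 0 <= c' -> c' <= c -> 0 <= v -> v <= v' ->
  (c' - k' * v') / (1 + k') <= (c - k * v) / (1 + k).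
Proof.
move=> k0 kk' c'0 c'c v0 vv'; have k'0 := le_trans k0 kk'.
rewrite ler_pdivrMr ?ltr_wpDr// mulrAC ler_pdivlMr ?ltr_wpDr// -subr_ge0.
rewrite (_ : _ - _ = (c - c') * (1 + k) + (v' - v) * (k' * (1 + k))
  + (c + v) * (k' - k)); last by ring.
by rewrite !addr_ge0// !mulr_ge0// ?subr_ge0// ?addr_ge0// (le_trans c'0).
Qed.

End SemiImplicitStep.

Section Grid.
Context (R : realFieldType).
Variable m : nat.
Definition mesh : R := m.+1%:R^-1.
(** The index is shifted by one: node 0 lies one cell to the right of the singular point p = 0, and
    node [m] is p = 1. *)
Definition quantile (i : nat) : R := i.+1%:R * mesh.
Definition survival (i : nat) : R := (m%:R - i%:R) * mesh.
Local Notation d := mesh.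
Local Notation p := quantile.
Local Notation e := survival.

Lemma mesh_gt0 : 0 < d. Proof. by rewrite invr_gt0. Qed.

Lemma quantile_gt0 i : 0 < p i. Proof. by rewrite mulr_gt0// mesh_gt0. Qed.

Lemma quantileD_survival i : p i + e i = 1.
Proof.
rewrite /p /e -mulrDl -natr1.
have -> : i%:R + 1 + (m%:R - i%:R) = m.+1%:R :> R by rewrite -natr1; ring.
by rewrite /d mulfV.
Qed.

Lemma quantileS i : p i.+1 = p i + d.
Proof. by rewrite /p -[i.+2%:R]natr1; ring. Qed.

Lemma survivalS i : e i.+1 = e i - d.
Proof. by rewrite /e -natr1; ring. Qed.

Lemma survival_gt0 i : (i < m)%N -> 0 < e i.
Proof. by move=> im; rewrite mulr_gt0// ?mesh_gt0// subr_gt0 ltr_nat. Qed.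

Lemma survival_ge0 i : (i <= m)%N -> 0 <= e i.
Proof.
by move=> im; rewrite mulr_ge0 ?(ltW mesh_gt0)// subr_ge0 ler_nat.
Qed.

Lemma survival_le i j : (i <= j)%N -> e j <= e i.
Proof. by move=> ij; rewrite ler_wpM2r ?(ltW mesh_gt0)// lerB// ler_nat. Qed.

End Grid.

(** What survives the passage to the limit. Increments are compared between arbitrary nodes, with
    each coefficient frozen at one of the two ends; such two-sided bounds pass to pointwise limits
    and then squeeze the difference quotients. [L] stands for ln x, and [dsol_w_half] is the lower
    bound on [w] that contains neither the growth rate nor the mesh size as a constant. *)
Record discrete_solution (R : realType) (sel act : R -> R) (al1 r theta : R)
    (m : nat) (g : R) (F w b L : nat -> R) : Prop := {
  dsol_growth : 0 < g <= theta * al1 ;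
  dsol_F_ge i : (i <= m)%N -> quantile R m i * (g / theta) <= F i ;
  dsol_F_le i : (i <= m)%N -> F i <= al1 * quantile R m i ;
  dsol_F_end i : (i <= m)%N ->
    0 <= g / theta - F i <= al1 * survival R m i ;
  dsol_F_incr i j : (i <= j < m)%N ->
    act (b j) * ((j - i)%:R * mesh R m) <= F j - F i
      <= act (b i) * ((j - i)%:R * mesh R m) ;
  dsol_w_ge0 i : (i <= m)%N -> 0 <= w i ;
  dsol_w_le i : (i <= m)%N -> r * w i <= 1 - sel (b i) ;
  dsol_w_half i j : sel (b i) <= 2^-1 -> (i <= j < m)%N ->
    (j - i)%:R * mesh R m <= 4 * (r + al1) * w j ;
  dsol_w_incr i j : (i <= j < m)%N ->
    ((1 - sel (b i)) / (survival R m i * F j)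
      - (r + act (b i) * survival R m i) * w j / (survival R m j * F i))
      * ((j - i)%:R * mesh R m) <= w j - w i <=
    ((1 - sel (b j)) / (survival R m j * F i)
      - (r + act (b j) * survival R m j) * w i / (survival R m i * F j))
      * ((j - i)%:R * mesh R m) ;
  dsol_b_ge i : (i <= m)%N -> theta * (survival R m i * w i) <= b i ;
  dsol_b_le i : (i <= m)%N ->
    b i <= theta / ((1 - theta) * r) * (survival R m i / quantile R m i) ;
  dsol_b_incr i j : (i <= j < m)%N ->
    g * (b j / (survival R m i * F j) + w i / F j) * ((j - i)%:R * mesh R m)
      <= b i - b j <=
    g * (b i / (survival R m j * F i) + w j / F i) * ((j - i)%:R * mesh R m) ;
  dsol_L_incr i j : (i <= j < m)%N ->
    g / (survival R m i * F j) * ((j - i)%:R * mesh R m) <= L j - L i <=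
    g / (survival R m j * F i) * ((j - i)%:R * mesh R m)
}.

(** * The semi-implicit scheme and its two shooting parameters *)

Section Scheme.
Context {R : realType}.
Variables (sel act : R -> R) (al1 r theta : R).
Hypotheses (sel_ge0 : forall b, 0 <= sel b) (sel_le1 : forall b, sel b <= 1).
Hypotheses (sel_homo : {homo sel : b c / b <= c}) (sel_cont : continuous sel).
Hypothesis sel0 : forall b, b <= 0 -> sel b = 0.
Hypotheses (act_ge0 : forall b, 0 <= act b) (act_le : forall b, act b <= al1).
Hypotheses (act_homo : {homo act : b c / b <= c}) (act_cont : continuous act).
Hypothesis act0 : forall b, b <= 0 -> act b = 0.
Hypotheses (al1_gt0 : 0 < al1) (r_gt0 : 0 < r).
Hypotheses (theta_gt0 : 0 < theta) (theta_lt1 : theta < 1).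
Variable m : nat.

Local Notation d := (mesh R m).
Local Notation p := (quantile R m).
Local Notation e := (survival R m).
Let d_gt0 : 0 < d := mesh_gt0 R m.

(* Semi-implicit Euler scheme in the quantile variable p, for
   F' = act b,  w' = ((1 - sel b) - (r + (1 - p) act b) w) / ((1 - p) F),
   b' = - g (b / (1 - p) + w) / F;
   b is cut off at 0, so that the scheme stays monotone in g. *)
Fixpoint scheme (g beta : R) (i : nat) : R * R * R :=
  if i is j.+1 then
    let: (F, w, b) := scheme g beta j in
    let k := d / (e j * F) in
    (F + d * act b,
     (w + k * (1 - sel b)) / (1 + k * (r + act b * e j)),
     (Num.max b 0 - g * k * (e j * w)) / (1 + g * k))
  else (al1 * d, 0, beta).

Definition schF g beta i := (scheme g beta i).1.1.
Definition schw g beta i := (scheme g beta i).1.2.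
Definition schb g beta i := (scheme g beta i).2.
(** Up to the factor [g] this is the increment of ln x over one cell. *)
Definition schk g beta i := d / (e i * schF g beta i).
Definition schrho g beta i := r + act (schb g beta i) * e i.

Section Trajectory.
Variables (g beta : R).
Hypothesis g_ge0 : 0 <= g.
Local Notation F := (schF g beta).
Local Notation w := (schw g beta).
Local Notation b := (schb g beta).
Local Notation k := (schk g beta).
Local Notation rho := (schrho g beta).

Lemma schemeF i : F i.+1 = F i + d * act (b i).
Proof. by rewrite /schF /schb /=; case: scheme => -[]. Qed.

Lemma schemew i : w i.+1 = (w i + k i * (1 - sel (b i))) / (1 + k i * rho i).
Proof. by rewrite /schw /schk /schrho /schF /schb /=; case: scheme => -[]. Qed.

Lemma schemeb i :
  b i.+1 = (Num.max (b i) 0 - g * k i * (e i * w i)) / (1 + g * k i).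
Proof. by rewrite /schw /schk /schrho /schF /schb /=; case: scheme => -[]. Qed.

Lemma schemeF_gt0 i : 0 < F i.
Proof.
elim: i => [|i IH]; first by rewrite /schF /= mulr_gt0.
by rewrite schemeF ltr_wpDr// mulr_ge0 ?(ltW d_gt0).
Qed.

Lemma schemeF_le i j : (i <= j)%N -> F i <= F j.
Proof.
move=> ij; apply: nat_homo => // l _; rewrite schemeF lerDl.
by rewrite mulr_ge0 ?(ltW d_gt0).
Qed.

Lemma schk_gt0 i : (i < m)%N -> 0 < k i.
Proof. by move=> im; rewrite divr_gt0// mulr_gt0 ?survival_gt0 ?schemeF_gt0. Qed.

Lemma schrho_gt0 i : (i <= m)%N -> 0 < rho i.
Proof. by move=> im; rewrite ltr_wpDr// mulr_ge0 ?survival_ge0. Qed.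

Lemma schemew_den_gt0 i : (i < m)%N -> 0 < 1 + k i * rho i.
Proof. by move=> im; rewrite ltr_wpDr// mulr_ge0 ?(ltW (schk_gt0 im)) ?(ltW (schrho_gt0 (ltnW im))). Qed.

Lemma schemeb_den_gt0 i : (i < m)%N -> 0 < 1 + g * k i.
Proof. by move=> im; rewrite ltr_wpDr// mulr_ge0 ?(ltW (schk_gt0 im)). Qed.

Lemma schemew_ge0 i : (i <= m)%N -> 0 <= w i.
Proof.
elim: i => [|i IH] im; first by rewrite /schw /=.
rewrite schemew divr_ge0 ?(ltW (schemew_den_gt0 im))// addr_ge0 ?IH ?(ltnW im)//.
by rewrite mulr_ge0 ?(ltW (schk_gt0 im))// subr_ge0.
Qed.

(** The cut-off is needed in the bound: a negative [b i] may be followed by a larger, still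
    nonpositive value. [sel] and [act] do not notice, since both vanish on nonpositive arguments. *)
Lemma schemeb_le_max i : (i < m)%N -> b i.+1 <= Num.max (b i) 0.
Proof.
move=> im; rewrite schemeb ler_pdivrMr ?schemeb_den_gt0//.
have := schemew_ge0 (ltnW im); have := survival_gt0 R im; have := schk_gt0 im.
have : 0 <= Num.max (b i) 0 by rewrite le_max lexx orbT.
move: (Num.max _ _) (k i) (e i) (w i) => M x y z M0 x0 y0 z0.
have : 0 <= g * x * (y * z) by rewrite !mulr_ge0 ?(ltW x0) ?(ltW y0).
have : 0 <= M * (g * x) by rewrite !mulr_ge0 ?(ltW x0) ?(ltW y0).
lra.
Qed.

Lemma sel_max c : sel (Num.max c 0) = sel c.
Proof. by case: (leP c 0) => // c0; rewrite !sel0. Qed.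

Lemma act_max c : act (Num.max c 0) = act c.
Proof. by case: (leP c 0) => // c0; rewrite !act0. Qed.

Lemma scheme_sel_le i : (i < m)%N -> sel (b i.+1) <= sel (b i).
Proof. by move=> im; rewrite -[leRHS]sel_max sel_homo// schemeb_le_max. Qed.

Lemma scheme_act_le i : (i < m)%N -> act (b i.+1) <= act (b i).
Proof. by move=> im; rewrite -[leRHS]act_max act_homo// schemeb_le_max. Qed.

Lemma schemew_step i : (i < m)%N ->
  w i.+1 - w i = k i * ((1 - sel (b i)) - rho i * w i.+1).
Proof.
move=> im; have := schemew_den_gt0 im; rewrite lt0r => /andP[nz _].
have : w i.+1 * (1 + k i * rho i) = w i + k i * (1 - sel (b i)).
  by rewrite schemew divfK.
lra.
Qed.

(** A step towards an equilibrium from below does not overshoot it, and the equilibrium itself only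
    rises, because [sel b], [act b] and 1 - p all decrease along the grid. This is the side
    condition of [relaxation_step_homo]. *)
Lemma schemew_equilibrium i : (i <= m)%N -> rho i * w i <= 1 - sel (b i).
Proof.
elim: i => [|i IH] im; first by rewrite /schw /= mulr0 subr_ge0.
have {}IH := IH (ltnW im).
have h1 : rho i * w i.+1 <= 1 - sel (b i).
  rewrite schemew mulrA ler_pdivrMr ?schemew_den_gt0//.
  move: IH (ltW (schk_gt0 im)) (ltW (schrho_gt0 (ltnW im))).
  move: (k i) (rho i) (1 - _) (w i) => x y z t; nra.
apply: le_trans (_ : _ <= rho i * w i.+1) _.
  rewrite ler_wpM2r ?schemew_ge0// lerD2l ler_pM ?act_ge0 ?survival_ge0//.
    exact: scheme_act_le.
  exact: survival_le.
by apply: (le_trans h1); rewrite lerB// scheme_sel_le.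
Qed.

Lemma schemew_le_S i : (i < m)%N -> w i <= w i.+1.
Proof.
move=> im; rewrite schemew ler_pdivlMr ?schemew_den_gt0//.
move: (schemew_equilibrium (ltnW im)) (ltW (schk_gt0 im)).
move: (k i) (rho i) (1 - _) (w i) => x y z t; nra.
Qed.

Lemma schemew_le i : (i <= m)%N -> r * w i <= 1 - sel (b i).
Proof.
move=> im; apply: le_trans (schemew_equilibrium im).
by rewrite ler_wpM2r ?schemew_ge0// lerDl mulr_ge0 ?survival_ge0.
Qed.

End Trajectory.

(** All feedbacks have the same sign: a larger [g] lowers [b] and with it the growth of [F]; a
    smaller [F] lengthens the steps [schk], which raises [w] and pushes [b] further down. *)
Lemma scheme_antitone g g' beta i : 0 <= g -> g <= g' -> (i <= m)%N ->
  [/\ schF g' beta i <= schF g beta i, schw g beta i <= schw g' beta i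
    & schb g' beta i <= schb g beta i].
Proof.
move=> g0 gg'; have g'0 := le_trans g0 gg'.
elim: i => [|i IH] im; first by split.
have [Fi wi bi] := IH (ltnW im).
have ei := survival_gt0 R im; have F'0 := schemeF_gt0 g' beta i.
have k0 := schk_gt0 g beta im; have k'0 := schk_gt0 g' beta im.
have kk' : schk g beta i <= schk g' beta i.
  have F0 := schemeF_gt0 g beta i.
  by rewrite ler_pM2l ?d_gt0// lef_pV2 ?posrE ?(mulr_gt0 ei F'0) ?(mulr_gt0 ei F0)// ler_pM2l.
have rho'0 := schrho_gt0 g' beta (ltnW im).
have rhorho' : schrho g' beta i <= schrho g beta i.
  by rewrite lerD2l ler_pM2r// act_homo.
have w0 := schemew_ge0 g beta (ltnW im).
have eq0 := schemew_equilibrium beta g0 (ltnW im).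
split.
- by rewrite !schemeF lerD// ler_pM2l ?d_gt0// act_homo.
- have ss : sel (schb g' beta i) <= sel (schb g beta i) by rewrite sel_homo.
  rewrite !schemew; apply: relaxation_step_homo => //; first exact: ltW.
  + exact: ltW.
  + by rewrite subr_ge0.
  + by rewrite lerB.
- rewrite !schemeb; apply: decay_step_homo.
  + by rewrite mulr_ge0// ltW.
  + by rewrite ler_pM// ltW.
  + by rewrite le_max lexx orbT.
  + by rewrite ge_max !le_max bi lexx orbT.
  + by rewrite mulr_ge0// ltW.
  + by rewrite ler_pM2l.
Qed.

(** The parameter space is abstract so as to cover [g] varying at fixed [beta], [beta] at fixed [g],
    and [g] being a continuous function of [beta]. *)
Lemma scheme_continuous (T : topologicalType) (g beta : T -> R) (t : T) i :
  (i <= m)%N -> 0 <= g t -> {for t, continuous g} -> {for t, continuous beta} ->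
  [/\ {for t, continuous (fun u => schF (g u) (beta u) i)},
      {for t, continuous (fun u => schw (g u) (beta u) i)}
    & {for t, continuous (fun u => schb (g u) (beta u) i)}].
Proof.
move=> + g0 cg cbeta; elim: i => [|i IH] im.
  by split; [exact: cvg_cst|exact: cvg_cst|exact: cbeta].
have [cF cw cb] := IH (ltnW im).
have ei := survival_gt0 R im.
have ck : {for t, continuous (fun u => schk (g u) (beta u) i)}.
  apply: cvgM; first exact: cvg_cst.
  apply: cvgV; first by rewrite gt_eqF// mulr_gt0// schemeF_gt0.
  by apply: cvgMr => //; exact: cF.
have ca : {for t, continuous (fun u => act (schb (g u) (beta u) i))}.
  by apply: continuous_comp; [exact: cb|exact: act_cont].
have cs : {for t, continuous (fun u => sel (schb (g u) (beta u) i))}.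
  by apply: continuous_comp; [exact: cb|exact: sel_cont].
have crho : {for t, continuous (fun u => schrho (g u) (beta u) i)}.
  by apply: cvgD; [exact: cvg_cst|apply: cvgM; [exact: ca|exact: cvg_cst]].
have cm : {for t, continuous (fun u => Num.max (schb (g u) (beta u) i) 0)}.
  by apply: continuous_max => //; exact: cst_continuous.
split.
- under [X in {for _, continuous X}]funext => u do rewrite schemeF.
  apply: cvgD; first exact: cF.
  by apply: cvgM; [exact: cvg_cst|exact: ca].
- under [X in {for _, continuous X}]funext => u do rewrite schemew.
  apply: cvgM.
    apply: cvgD; first exact: cw.
    by apply: cvgM; [exact: ck|apply: cvgB; [exact: cvg_cst|exact: cs]].
  apply: cvgV; first by rewrite gt_eqF// schemew_den_gt0.
  by apply: cvgD; [exact: cvg_cst|apply: cvgM; [exact: ck|exact: crho]].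
- under [X in {for _, continuous X}]funext => u do rewrite schemeb.
  apply: cvgM.
    apply: cvgB; first exact: cm.
    apply: cvgM; first by apply: cvgM; [exact: cg|exact: ck].
    by apply: cvgM; [exact: cvg_cst|exact: cw].
  apply: cvgV; first by rewrite gt_eqF// schemeb_den_gt0.
  by apply: cvgD; [exact: cvg_cst|apply: cvgM; [exact: cg|exact: ck]].
Qed.

Lemma schemeF_le_quantile g beta i : schF g beta i <= al1 * p i.
Proof.
elim: i => [|i IH]; first by rewrite /schF /= /quantile mul1r.
by rewrite schemeF quantileS mulrDr lerD// mulrC ler_pM2r// act_le.
Qed.

Lemma survival_last : e m = 0. Proof. by rewrite /survival subrr mul0r. Qed.

Lemma quantile_last : p m = 1.
Proof. by rewrite -(quantileD_survival R m m) survival_last addr0. Qed.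

Lemma growth_exists beta :
  exists g, 0 <= g <= theta * al1 /\ schF g beta m = g / theta.
Proof.
pose f g := schF g beta m - g / theta.
have ta0 : 0 <= theta * al1 by rewrite mulr_ge0// ltW.
have [|||g] := @IVT R f 0 (theta * al1) 0.
- exact: ta0.
- apply: continuous_in_subspaceT => g; rewrite inE/= in_itv/= => /andP[g0 _].
  have [cF _ _] := @scheme_continuous R id (fun=> beta) g m (leqnn _) g0
    (fun=> id) (@cst_continuous _ _ _ _).
  apply: cvgB; first exact: cF.
  by apply: cvgM; [exact: cvg_id|exact: cvg_cst].
- rewrite ge_min le_max /f mul0r subr0 (ltW (schemeF_gt0 _ _ _)) /= andbT.
  apply/orP; right; rewrite subr_le0 mulrAC divff ?gt_eqF// mul1r.
  by rewrite (le_trans (schemeF_le_quantile _ _ _))// quantile_last mulr1.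
- rewrite in_itv/= => gi /eqP; rewrite subr_eq0 => /eqP; by exists g.
Qed.

Lemma scheme_act_antitone g beta i j : 0 <= g -> (i <= j <= m)%N ->
  act (schb g beta j) <= act (schb g beta i).
Proof.
move=> g0 /andP[ij jm].
apply: (nat_antihomo (u := fun l => act (schb g beta l))) => // l /andP[_ lj].
by apply: scheme_act_le => //; exact: leq_trans jm.
Qed.

Lemma scheme_sel_antitone g beta i j : 0 <= g -> (i <= j <= m)%N ->
  sel (schb g beta j) <= sel (schb g beta i).
Proof.
move=> g0 /andP[ij jm].
apply: (nat_antihomo (u := fun l => sel (schb g beta l))) => // l /andP[_ lj].
by apply: scheme_sel_le => //; exact: leq_trans jm.
Qed.

Lemma schemeF_increment g beta i j : 0 <= g -> (i <= j <= m)%N ->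
  act (schb g beta j) * ((j - i)%:R * d) <= schF g beta j - schF g beta i
    <= act (schb g beta i) * ((j - i)%:R * d).
Proof.
move=> g0 /andP[ij jm]; have E c : c * ((j - i)%:R * d) = c * d * (j - i)%:R by ring.
rewrite !E increments_ge ?increments_le// => l /andP[il lj];
  rewrite schemeF addrAC subrr add0r [d * _]mulrC ler_pM2r// scheme_act_antitone//.
  by rewrite il (leq_trans (ltnW lj)).
by rewrite jm ltnW.
Qed.

(** [act b] decreases along the grid, so its last value is at most the mean slope of [F]. The
    initial value [al1 * d] plays the role of a first cell of maximal slope. *)
Lemma quantile_act_le g beta i : 0 <= g -> (i <= m)%N ->
  act (schb g beta i) * p i <= schF g beta i.
Proof.
move=> g0 im; have := schemeF_increment beta g0 (_ : 0 <= i <= m)%N.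
move=> /(_ im)/andP[+ _]; rewrite subn0 {2}/schF/=.
rewrite /quantile -natr1 mulrDl mul1r mulrDr => h.
have : act (schb g beta i) * d <= al1 * d by rewrite ler_pM2r.
lra.
Qed.

Lemma survivalE i : (i <= m)%N -> (m - i)%:R * d = e i.
Proof. by move=> im; rewrite natrB. Qed.

(** A chord inequality: [F] is concave since its slope [act b] decreases, and it would start from 0
    at p = 0. *)
Lemma schemeF_ge g beta i : 0 <= g -> (i <= m)%N ->
  p i * schF g beta m <= schF g beta i.
Proof.
move=> g0 im; have := schemeF_increment beta g0 (_ : i <= m <= m)%N.
rewrite im leqnn survivalE// => /(_ isT)/andP[_].
have := quantile_act_le beta g0 im; have := quantileD_survival R m i.
have := quantile_gt0 R m i; have := survival_ge0 R im.
move: (schF _ _ _) (schF _ _ _) (act _) (p i) (e i) => x y a q u u0 q0 qu h1 h2.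
have h3 : (x - y) * q <= a * u * q by rewrite ler_pM2r.
have h4 : a * q * u <= y * u by rewrite ler_wpM2r.
have -> : y = y * (q + u) by rewrite qu mulr1.
lra.
Qed.

(** The lower bound on [F] is proportional to [g], so [g] cancels and the estimate of [b] becomes
    independent of the growth rate. *)
Lemma growth_step_le g beta i : 0 <= g -> (i < m)%N ->
  schF g beta m = g / theta ->
  g * schk g beta i <= theta * d / (e i * p i).
Proof.
move=> g0 im E; have := schemeF_ge beta g0 (ltnW im); rewrite E.
have ei := survival_gt0 R im; have pi := quantile_gt0 R m i.
have := schemeF_gt0 g beta i; rewrite /schk.
move: (schF _ _ _) (e i) (p i) d d_gt0 ei pi => x u q t t0 u0 q0 x0 h.
rewrite -subr_ge0.
have -> : theta * t / (u * q) - g * (t / (u * x))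
    = theta * t / (u * q * x) * (x - q * (g / theta)).
  by field; rewrite !gt_eqF.
by rewrite mulr_ge0// ?subr_ge0// divr_ge0 ?mulr_ge0// ltW.
Qed.

(* (1 - p) / p is, up to a constant, a supersolution of the equation for b. *)
Lemma schemeb_le g beta i : 0 <= g -> schF g beta m = g / theta ->
  schb g beta m <= 0 -> (i <= m)%N ->
  Num.max (schb g beta i) 0 <= theta / ((1 - theta) * r) * (e i / p i).
Proof.
move=> g0 E bm; move: i; apply: backward_ind.
  by rewrite survival_last mul0r mulr0 ge_max bm lexx.
move=> i im IH.
have ei := survival_gt0 R im; have pi := quantile_gt0 R m i.
have K0 : 0 <= g * schk g beta i by rewrite mulr_ge0// ltW// schk_gt0.
have := growth_step_le g0 im E.
have w0 := schemew_ge0 g beta (ltnW im).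
have rw : r * schw g beta i <= 1.
  by apply: (le_trans (schemew_le beta g0 (ltnW im))); rewrite lerBlDr lerDl.
have bE : schb g beta i.+1 * (1 + g * schk g beta i)
    = Num.max (schb g beta i) 0 - g * schk g beta i * (e i * schw g beta i).
  by rewrite schemeb divfK// gt_eqF// schemeb_den_gt0.
have bb : schb g beta i.+1 * (1 + g * schk g beta i)
    <= Num.max (schb g beta i.+1) 0 * (1 + g * schk g beta i).
  by rewrite ler_wpM2r ?addr_ge0// le_max lexx.
have M0 : 0 <= Num.max (schb g beta i.+1) 0 by rewrite le_max lexx orbT.
move: bb IH M0; rewrite {}bE survivalS quantileS.
move: (Num.max _ 0) (Num.max _ 0) K0 w0 rw => y x.
move: (g * _) (schw _ _ _) => K w K0 w0 rw h IH y0 KK.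
have d0 := d_gt0; have qd1 : p i + d <= 1.
  by rewrite -(quantileD_survival R m i.+1) quantileS lerDl survival_ge0.
have := quantileD_survival R m i.
move: (p i) (e i) d d0 qd1 pi ei h IH KK => q u t d0 qd1 pi ei h IH KK qu.
have qd0 : 0 < q + t by rewrite addr_gt0.
set C := theta / _ in IH *.
have t10 : 0 < (1 - theta) * r by rewrite mulr_gt0// subr_gt0.
have C0 : 0 < C by rewrite divr_gt0.
have CE : C * (1 - theta) * r = theta by rewrite -mulrA divfK// gt_eqF.
clearbody C.
have h1 : x <= y + K * (y + u * w) by lra.
apply: (le_trans h1).
have h2 : y + u * w <= C * ((u - t) / (q + t)) + u / r.
  by rewrite lerD// ler_pM2l// -[r^-1]mul1r ler_pdivlMr// mulrC.
have h20 : 0 <= y + u * w by rewrite addr_ge0// mulr_ge0// ltW.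
have h3 : K * (y + u * w) <= theta * t / (u * q) * (C * ((u - t) / (q + t)) + u / r).
  exact: ler_pM.
apply: (le_trans (lerD IH h3)).
rewrite -subr_ge0.
have -> : C * (u / q) - (C * ((u - t) / (q + t))
      + theta * t / (u * q) * (C * ((u - t) / (q + t)) + u / r))
   = t * (C * u * (q + u) * r - theta * (C * (u - t) * r + u * (q + t)))
      / (u * q * (q + t) * r).
  by field; rewrite !gt_eqF.
apply: divr_ge0; last by rewrite !mulr_ge0// ltW.
rewrite mulr_ge0 ?(ltW d0)// qu mulr1.
(* Here the value of [C] is decided: [C * (1 - theta) * r = theta] turns the bracket into
   [theta * (1 - (q + t))], nonnegative because the next node [q + t] is at most 1. *)
have -> : C * u * r - theta * (C * (u - t) * r + u * (q + t))
  = u * (C * (1 - theta) * r - theta * (q + t)) + theta * C * t * r by ring.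
rewrite CE addr_ge0// ?mulr_ge0 ?(ltW ei) ?(ltW C0) ?(ltW d0) ?(ltW r_gt0) ?(ltW theta_gt0)//.
by rewrite subr_ge0 ler_piMr// ltW.
Qed.

(** Double shooting: the inner parameter [g] matches the end value of [F], the outer parameter
    [beta] the end value of [b]. *)
Lemma scheme_solution : exists g beta,
  [/\ 0 < g, g <= theta * al1, 0 <= beta, schF g beta m = g / theta
    & schb g beta m = 0].
Proof.
have [G GP] := choice growth_exists.
have G0 beta : 0 <= G beta by case: (GP beta) => /andP[].
have GE beta : schF (G beta) beta m = G beta / theta by case: (GP beta).
(* At fixed [u] the gap [schF g u m - g / theta] is strictly decreasing in [g], and at fixed [g] it
   is continuous in [u]. Its signs at [G beta - eps] and [G beta + eps] therefore persist for [u]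
   near [beta] and trap [G u]. *)
have cG : continuous G.
  move=> beta; apply/cvgrPdist_lt => eps eps0.
  have cgap g : 0 <= g -> schF g u m - g / theta @[u --> beta] -->
      schF g beta m - g / theta.
    move=> g0; apply: cvgB; last exact: cvg_cst.
    have [cF _ _] := @scheme_continuous R (fun=> g) id beta m (leqnn _) g0
      (@cst_continuous _ _ _ _) (fun=> id).
    exact: cF.
  have up : \forall u \near beta, G u < G beta + eps.
    have Ge0 : 0 <= G beta + eps by rewrite addr_ge0// ltW.
    have : schF (G beta + eps) beta m - (G beta + eps) / theta < 0.
      have [|+ _ _] := scheme_antitone beta (G0 beta) (_ : _ <= G beta + eps) (leqnn m).
        by rewrite lerDl ltW.
      rewrite subr_lt0 => /le_lt_trans; apply.
      by rewrite GE ltr_pM2r ?invr_gt0// ltrDl.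
    move/cvgr_lt: (cgap _ Ge0) => /[apply]; apply: filterS => u.
    rewrite subr_lt0 => h; rewrite ltNge; apply/negP => Gu.
    have [+ _ _] := scheme_antitone u Ge0 Gu (leqnn m).
    rewrite GE => /le_lt_trans/(_ h).
    by rewrite ltr_pM2r ?invr_gt0// ltNge Gu.
  have lo : \forall u \near beta, G beta - eps < G u.
    have [Ge|Ge] := ltP (G beta - eps) 0.
      by near=> u; exact: lt_le_trans Ge _.
    have : 0 < schF (G beta - eps) beta m - (G beta - eps) / theta.
      have [|+ _ _] := scheme_antitone beta Ge (_ : _ <= G beta) (leqnn m).
        by rewrite lerBlDr lerDl ltW.
      rewrite subr_gt0; apply: lt_le_trans.
      by rewrite GE ltr_pM2r ?invr_gt0// ltrBlDr ltrDl.
    move/cvgr_gt: (cgap _ Ge) => /[apply]; apply: filterS => u.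
    rewrite subr_gt0 => h; rewrite ltNge; apply/negP => Gu.
    have [+ _ _] := scheme_antitone u (G0 u) Gu (leqnn m).
    rewrite GE => /(lt_le_trans h).
    by rewrite ltr_pM2r ?invr_gt0// ltNge Gu.
  near=> u; rewrite ltr_distlC; apply/andP; split; near: u => //.
pose f beta := schb (G beta) beta m.
(* One more than the bound that [schemeb_le] would impose on the initial value if the end value were
   nonpositive; so from [top] the end value is positive, while from 0 the sequence never becomes
   positive. *)
pose top := theta / ((1 - theta) * r) * (e 0 / p 0) + 1.
have top0 : 0 <= top.
  rewrite addr_ge0// mulr_ge0//.
    by rewrite divr_ge0 ?(ltW theta_gt0)// mulr_ge0 ?(ltW r_gt0)// subr_ge0 ltW.
  by rewrite divr_ge0 ?survival_ge0// ltW// quantile_gt0.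
have [|||beta] := @IVT R f 0 top 0.
- exact: top0.
- apply: continuous_in_subspaceT => beta _.
  by have [] := @scheme_continuous R G id beta m (leqnn _) (G0 _) (cG _) (fun=> id).
- rewrite ge_min le_max; apply/andP; split; apply/orP; [left|right].
    have : forall i, (i <= m)%N -> schb (G 0) 0 i <= 0.
      elim=> [|i IH] im; first by rewrite /schb /=.
      apply: (le_trans (schemeb_le_max _ (G0 0) im)).
      by rewrite ge_max lexx IH// ltnW.
    exact.
  rewrite leNgt; apply/negP => ftop.
  have := schemeb_le (G0 top) (GE top) (ltW ftop) (leq0n m).
  rewrite {1}/schb /= (max_idPl top0) /top; lra.
- rewrite in_itv/= => /andP[beta0 _] fb; exists (G beta), beta; split=> //.
    rewrite lt0r G0 andbT; apply/eqP => E; have := GE beta.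
    by rewrite {2}E mul0r => E0; have := schemeF_gt0 (G beta) beta m; rewrite E0 ltxx.
  by case: (GP beta) => /andP[].
Unshelve. all: by end_near. Qed.

(** * A priori bounds for the discrete solution *)

Section Solution.
Variables g beta : R.
Hypotheses (g_gt0 : 0 < g) (beta_ge0 : 0 <= beta).
Hypotheses (schFm : schF g beta m = g / theta) (schbm : schb g beta m = 0).
Let g_ge0 := ltW g_gt0.
Local Notation F := (schF g beta).
Local Notation w := (schw g beta).
Local Notation b := (schb g beta).
Local Notation k := (schk g beta).
Local Notation rho := (schrho g beta).

(** Once negative, [b] would remain negative and could not end at 0. Along the solution the cut-off
    is therefore never active. *)
Lemma schemeb_ge0 i : (i <= m)%N -> 0 <= b i.
Proof.
(* From a nonnegative start, only the term with [w] can make [b] negative, so [w] was already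
   positive one node earlier, and it does not decrease. *)
have w_gt0 j : (j <= m)%N -> b j < 0 -> 0 < w j.
  case: j => [_|j jm]; first by rewrite /schb /= ltNge beta_ge0.
  move=> bj; apply: lt_le_trans (schemew_le_S beta g_ge0 jm).
  rewrite lt0r schemew_ge0 ?(ltnW jm)// andbT; apply/eqP => wj; move: bj.
  rewrite schemeb wj !mulr0 subr0 ltNge divr_ge0//; last first.
    by rewrite ltW// schemeb_den_gt0.
  by rewrite le_max lexx orbT.
move: i; apply: backward_ind; first by rewrite schbm.
move=> i im; apply: contraTT; rewrite -!ltNge => bi.
rewrite schemeb (max_idPr (ltW bi)) sub0r pmulr_llt0 ?invr_gt0 ?schemeb_den_gt0//.
by rewrite oppr_lt0 mulr_gt0// mulr_gt0 ?schk_gt0 ?w_gt0 ?survival_gt0// ltnW.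
Qed.

Lemma schemeb_step i : (i < m)%N -> b i - b i.+1 = g * k i * (b i.+1 + e i * w i).
Proof.
move=> im; have D := schemeb_den_gt0 beta g_ge0 im.
have : b i.+1 * (1 + g * k i) = b i - g * k i * (e i * w i).
  by rewrite schemeb divfK ?gt_eqF// (max_idPl (schemeb_ge0 (ltnW im))).
lra.
Qed.

Lemma schemeb_le_S i : (i < m)%N -> b i.+1 <= b i.
Proof.
move=> im; rewrite -subr_ge0 schemeb_step// mulr_ge0//.
  by rewrite mulr_ge0// ltW// schk_gt0.
by rewrite addr_ge0 ?schemeb_ge0// mulr_ge0 ?survival_ge0 ?schemew_ge0// ltnW.
Qed.

Lemma schemeF_le_last i : (i <= m)%N -> F i <= g / theta.
Proof. by move=> im; rewrite -schFm schemeF_le. Qed.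

(** As [F <= g / theta], each remaining cell takes at least [theta * d * w] off [b]; since [w] does
    not decrease and [b] ends at 0, the cells before p = 1 add up to the claim. *)
Lemma schemeb_ge i : (i <= m)%N -> theta * (e i * w i) <= b i.
Proof.
move: i; apply: backward_ind.
  by rewrite survival_last mul0r mulr0 schemeb_ge0.
move=> i im IH; have ei := survival_gt0 R im.
have ww := schemew_le_S beta g_ge0 im.
have := schemeb_step im; have := schemeb_ge0 im; have := schemew_ge0 g beta (ltnW im).
have KK : theta * d / e i <= g * k i.
  rewrite /schk; have := schemeF_le_last (ltnW im); have := schemeF_gt0 g beta i.
  move: (F i) (e i) ei d d_gt0 => x u u0 t t0 x0 xg.
  rewrite -subr_ge0 (_ : _ - _ = theta * t / (u * x) * (g / theta - x)).
    by rewrite mulr_ge0 ?subr_ge0// divr_ge0 ?mulr_ge0// ltW.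
  by field; rewrite !gt_eqF.
have KE : theta * d <= g * k i * e i.
  by rewrite -ler_pdivrMr.
have K0 : 0 <= g * k i by rewrite mulr_ge0// ltW// schk_gt0.
have e1 : 0 <= e i.+1 by exact: survival_ge0.
have IH' : theta * (e i.+1 * w i) <= b i.+1.
  apply: le_trans IH; rewrite ler_pM2l//; exact: ler_wpM2l.
move: IH'; rewrite survivalS; move: (b i) (b i.+1) (w i) (e i) d K0 KE => x y z u t K0 KE.
move: (g * _) K0 KE => K K0 KE h z0 y0 h'.
have h1 : theta * t * z <= K * u * z by exact: ler_wpM2r.
have h2 : 0 <= K * y by exact: mulr_ge0.
lra.
Qed.

(** Beyond node [i] the source of [w] is at least 1/2. Either the damping [(r + al1) * w j] has
    reached 1/4, which suffices as grid distances are at most 1, or it absorbs at most half of the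
    source and [w] gains at least [d / (4 * al1)] per cell. *)
Lemma schemew_ge_half i j : sel (b i) <= 2^-1 -> (i <= j <= m)%N ->
  (j - i)%:R * d <= 4 * (r + al1) * w j.
Proof.
move=> si /andP[ij jm]; have w0 := schemew_ge0 g beta jm.
have ra0 : 0 < r + al1 by rewrite addr_gt0.
have jd1 : (j - i)%:R * d <= 1.
  rewrite ler_pdivrMr// mul1r ler_nat.
  by apply: leq_trans (leq_subr _ _) _; exact: leqW.
have [wj|wj] := leP (4^-1) ((r + al1) * w j).
  by apply: (le_trans jd1); lra.
have : 4^-1 * al1^-1 * d * (j - i)%:R <= w j - w i.
  apply: increments_ge => // l /andP[il lj].
  have lm := leq_trans lj jm.
  have el := survival_gt0 R lm.
  have Fl := schemeF_gt0 g beta l.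
  rewrite schemew_step//.
  have wl : w l.+1 <= w j.
    apply: nat_homo => // n /andP[_ nj]; apply: schemew_le_S => //.
    exact: leq_trans nj jm.
  have sl : sel (b l) <= 2^-1.
    by apply: le_trans si; apply: scheme_sel_antitone => //; rewrite il (ltnW lm).
  have rl : rho l * w l.+1 <= 4^-1.
    apply: le_trans (ltW wj); apply: ler_pM => //.
    - by rewrite ltW// schrho_gt0// ltnW.
    - exact: schemew_ge0.
    - rewrite lerD2l -[leRHS]mulr1; apply: ler_pM => //; first exact: ltW.
      rewrite -(quantileD_survival R m l) lerDr ltW//; exact: quantile_gt0.
  have kl : al1^-1 * d <= k l.
    rewrite mulrC ler_pM2l// lef_pV2 ?posrE ?(mulr_gt0 el Fl)//.
    rewrite -[leRHS]mul1r ler_pM// ?(ltW el) ?(ltW Fl)//.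
      by rewrite -(quantileD_survival R m l) lerDr ltW//; exact: quantile_gt0.
    apply: (le_trans (schemeF_le_quantile _ _ _)).
    rewrite -[leRHS]mulr1 ler_pM2l//.
    by rewrite -(quantileD_survival R m l) lerDl ltW.
  rewrite -mulrA mulrC; apply: ler_pM => //; last by lra.
  by rewrite mulr_ge0 ?invr_ge0 ?(ltW al1_gt0) ?(ltW d_gt0).
have := schemew_ge0 g beta (leq_trans ij jm).
move=> wi0 h; have {}h : 4^-1 * al1^-1 * ((j - i)%:R * d) <= w j by lra.
have : (j - i)%:R * d <= 4 * al1 * w j.
  move: h; rewrite -mulrA ler_pdivrMl// ler_pdivrMl//; lra.
have : 0 <= r * w j by rewrite mulr_ge0// ltW.
lra.
Qed.

Let L i := \sum_(l < i) g * k l.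

Lemma scheme_discrete_solution : g <= theta * al1 ->
  discrete_solution sel act al1 r theta m g F w b L.
Proof.
move=> gle.
have mul c x : c * (x%:R * d) = c * d * x%:R by ring.
have bounds i l j : (i <= l < j)%N -> (j < m)%N ->
    (0 < e j) * (0 < F i) * (e j <= e l.+1) * (e j <= e l) * (e l <= e i)
    * (F i <= F l) * (F l <= F j) * (l < m)%N.
  move=> /andP[il lj] jm; do !split.
  - exact: survival_gt0.
  - exact: schemeF_gt0.
  - exact: survival_le.
  - exact/survival_le/ltnW.
  - exact: survival_le.
  - exact: schemeF_le.
  - exact/schemeF_le/ltnW.
  - exact: ltn_trans jm.
(* 1 - p decreases while [F] increases, so the extreme values of the product (1 - p) F over a range
   of nodes are bounded by mixing the two end indices. *)
have inv_eF i l j : (i <= l < j)%N -> (j < m)%N ->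
    0 <= (e i * F j)^-1 /\ (e i * F j)^-1 <= (e l * F l)^-1 <= (e j * F i)^-1.
  move=> ilj jm; have H := bounds i l j ilj jm.
  have [il lj] := andP ilj; have lm : (l < m)%N := ltn_trans lj jm.
  have el : 0 < e l by exact: survival_gt0.
  have ei : 0 < e i by apply: survival_gt0; exact: leq_ltn_trans lm.
  have ej : 0 < e j by exact: survival_gt0.
  have Fl := schemeF_gt0 g beta l; have Fj := schemeF_gt0 g beta j.
  have Fi := schemeF_gt0 g beta i.
  rewrite invr_ge0 (ltW (mulr_gt0 ei Fj)); split=> //.
  rewrite !lef_pV2 ?posrE ?(mulr_gt0 ei Fj) ?(mulr_gt0 el Fl) ?(mulr_gt0 ej Fi)//.
  by apply/andP; split; apply: ler_pM; rewrite ?H//; exact: ltW.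
have wmono i j : (i <= j <= m)%N -> w i <= w j.
  move=> /andP[ij jm]; apply: nat_homo => // n /andP[_ nj].
  by apply: schemew_le_S => //; exact: leq_trans nj jm.
have bmono i j : (i <= j <= m)%N -> b j <= b i.
  move=> /andP[ij jm]; apply: nat_antihomo => // n /andP[_ nj].
  by apply: schemeb_le_S; exact: leq_trans nj jm.
split.
- by rewrite g_gt0.
- by move=> i im; rewrite -schFm schemeF_ge.
- by move=> i _; exact: schemeF_le_quantile.
- move=> i im; rewrite subr_ge0 schemeF_le_last//= -schFm.
  have := schemeF_increment beta g_ge0 (_ : i <= m <= m)%N.
  rewrite im leqnn survivalE// => /(_ isT)/andP[_ /le_trans]; apply.
  by rewrite ler_wpM2r ?survival_ge0.
- by move=> i j /andP[ij jm]; apply: schemeF_increment => //; rewrite ij ltnW.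
- by move=> i; exact: schemew_ge0.
- by move=> i im; exact: schemew_le.
- by move=> i j si /andP[ij jm]; apply: schemew_ge_half => //; rewrite ij ltnW.
- move=> i j /andP[ij jm]; rewrite !mul.
  have half l : (i <= l < j)%N -> let X := (e l * F l)^-1 in
      w l.+1 - w l = d * ((1 - sel (b l)) * X - (r + act (b l) * e l) * w l.+1 * X).
    move=> ilj; rewrite schemew_step ?(bounds _ _ _ ilj jm)// /schk /schrho /=; ring.
  have key l : (i <= l < j)%N -> [/\ 0 <= 1 - sel (b i), 1 - sel (b i) <= 1 - sel (b l) &
     1 - sel (b l) <= 1 - sel (b j)] /\ [/\ 0 <= r + act (b j) * e j,
     r + act (b j) * e j <= r + act (b l) * e l &
     r + act (b l) * e l <= r + act (b i) * e i].
    move=> ilj; have H := bounds i l j ilj jm.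
    have lm : (l < m)%N by rewrite H.
    have [il lj] := andP ilj.
    have ej : 0 < e j by rewrite H.
    have el : 0 < e l by exact: survival_gt0.
    split; split.
    + by rewrite subr_ge0.
    + by rewrite lerB// scheme_sel_antitone// il ltnW.
    + by rewrite lerB// scheme_sel_antitone// (ltnW lj) ltnW.
    + apply: addr_ge0; first exact: ltW.
      by apply: mulr_ge0 => //; exact: ltW.
    + rewrite lerD2l; apply: ler_pM; rewrite ?H//; first exact: ltW.
      by rewrite scheme_act_antitone// (ltnW lj) ltnW.
    + rewrite lerD2l; apply: ler_pM; rewrite ?H//; first exact: ltW.
      by rewrite scheme_act_antitone// il ltnW.
  apply/andP; split.
  + apply: increments_ge => // l ilj; rewrite (half l ilj) mulrC ler_pM2l//.
    have [il lj] := andP ilj; have lm : (l < m)%N := ltn_trans lj jm.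
    have [X0 /andP[X1 X2]] := inv_eF i l j ilj jm.
    have [[k1 k2 k3] [k4 k5 k6]] := key l ilj.
    have w0 := schemew_ge0 g beta lm.
    apply: lerB; first exact: ler_pM.
    apply: ler_pM => //.
    * by rewrite mulr_ge0// (le_trans k4 k5).
    * exact: le_trans X1.
    * apply: ler_pM => //; first exact: (le_trans k4 k5).
      by apply: wmono; rewrite lj ltnW.
  + apply: increments_le => // l ilj; rewrite (half l ilj) mulrC ler_pM2r//.
    have [il lj] := andP ilj; have lm : (l < m)%N := ltn_trans lj jm.
    have [X0 /andP[X1 X2]] := inv_eF i l j ilj jm.
    have [[k1 k2 k3] [k4 k5 k6]] := key l ilj.
    have w0 : 0 <= w i by apply: schemew_ge0; exact: leq_trans (ltnW lm).
    apply: lerB.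
      by apply: ler_pM => //; [exact: le_trans k2|exact: le_trans X1].
    apply: ler_pM => //; first exact: mulr_ge0.
    apply: ler_pM => //.
    by apply: wmono; rewrite leqW.
- by move=> i; exact: schemeb_ge.
- move=> i im; have := schemeb_le g_ge0 schFm _ im; rewrite schbm => /(_ (lexx _)).
  by rewrite (max_idPl (schemeb_ge0 im)).
- move=> i j /andP[ij jm]; rewrite !mul.
  have half l : (i <= l < j)%N ->
      - b l.+1 - - b l = g * (b l.+1 / (e l * F l) + w l / F l) * d.
    move=> ilj; have H := bounds i l j ilj jm.
    have el : 0 < e l by apply: survival_gt0; rewrite H.
    rewrite opprK addrC schemeb_step ?H// /schk.
    by field; rewrite !gt_eqF// schemeF_gt0.
  have -> : b i - b j = - b j - - b i by rewrite opprK addrC.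
  have fact l : (i <= l < j)%N ->
     [/\ 0 <= b j, b j <= b l.+1, b l.+1 <= b i & 0 <= w i] /\
     [/\ w i <= w l, w l <= w j, 0 <= (F j)^-1, (F j)^-1 <= (F l)^-1 &
         (F l)^-1 <= (F i)^-1].
    move=> ilj; have H := bounds i l j ilj jm.
    have [il lj] := andP ilj; have lm : (l < m)%N := ltn_trans lj jm.
    split; split.
    + exact/schemeb_ge0/ltnW.
    + by apply: bmono; rewrite lj ltnW.
    + by apply: bmono; rewrite leqW.
    + by apply: schemew_ge0; exact: leq_trans (ltnW lm).
    + by apply: wmono; rewrite il ltnW.
    + by apply: wmono; rewrite (ltnW lj) ltnW.
    + by rewrite invr_ge0 ltW// schemeF_gt0.
    + by rewrite lef_pV2 ?posrE ?schemeF_gt0// H.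
    + by rewrite lef_pV2 ?posrE ?schemeF_gt0// H.
  apply/andP; split.
  + apply: (@increments_ge _ (fun l => - b l)) => // l ilj.
    have [X0 /andP[X1 X2]] := inv_eF i l j ilj jm.
    have [[f1 f2 f3 f4] [f5 f6 f7 f8 f9]] := fact l ilj.
    rewrite (half l ilj) ler_pM2r// ler_pM2l// lerD// ler_pM//.
  + apply: (@increments_le _ (fun l => - b l)) => // l ilj.
    have [X0 /andP[X1 X2]] := inv_eF i l j ilj jm.
    have [[f1 f2 f3 f4] [f5 f6 f7 f8 f9]] := fact l ilj.
    rewrite (half l ilj) ler_pM2r// ler_pM2l// lerD// ler_pM//.
    * exact: le_trans f2.
    * exact: le_trans X1.
    * exact: le_trans f5.
    * exact: le_trans f8.
- move=> i j /andP[ij jm]; rewrite !mul.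
  have LS l : L l.+1 - L l = g * ((e l * F l)^-1 * d).
    by rewrite /L big_ord_recr/= addrAC subrr add0r /schk [d / _]mulrC.
  apply/andP; split.
  + apply: (@increments_ge _ L) => // l ilj.
    rewrite LS -[_ / _ * d]mulrA ler_pM2l// ler_pM2r//.
    by have [_ /andP[]] := inv_eF i l j ilj jm.
  + apply: (@increments_le _ L) => // l ilj.
    rewrite LS -[_ / _ * d]mulrA ler_pM2l// ler_pM2r//.
    by have [_ /andP[]] := inv_eF i l j ilj jm.
Qed.

End Solution.

Lemma exists_discrete_solution : exists g F w b L,
  discrete_solution sel act al1 r theta m g F w b L.
Proof.
have [g [beta [g0 gle beta0 E bm]]] := scheme_solution.
by do 5!eexists; exact: (scheme_discrete_solution g0 beta0 E bm gle).
Qed.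

End Scheme.

(** * Limit of vanishing mesh *)

Section UltraLimit.
Context {R : realType}.

(** Compactness gives a cluster point, and for an ultrafilter every cluster point is a limit. A
    single ultrafilter thus serves all quantiles at once, with no extraction of subsequences. *)
Lemma ultra_bounded_cvg (T : Type) (U : set_system T) (u : T -> R) (a b : R) :
  UltraFilter U -> (\forall t \near U, a <= u t <= b) ->
  cvg (u t @[t --> U]).
Proof.
move=> UU ub; apply/cvg_ex.
have [l [_ ul]] : `[a, b]%classic `&` cluster (u t @[t --> U]) !=set0.
  apply: segment_compact; apply: filterS ub => t /=.
  by rewrite in_itv.
exists l => V Vl.
have [//|UV] := in_ultra_setVsetC (u @^-1` V) UU.
by have [x []] := ul (~` V) V UV Vl.
Qed.

Lemma cvg_le_lim (T : Type) (U : set_system T) (f g : T -> R) (a b : R) :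
  ProperFilter U -> f t @[t --> U] --> a -> g t @[t --> U] --> b ->
  (\forall t \near U, f t <= g t) -> a <= b.
Proof.
move=> FU fa gb fg.
have gfab : g t - f t @[t --> U] --> b - a by exact: cvgB.
rewrite -subr_ge0 leNgt; apply/negP => ba.
have : \forall t \near U, False.
  move/cvgr_lt: gfab => /(_ _ ba); apply: filterS2 fg => t ft.
  by rewrite ltNge subr_ge0 ft.
by move/filter_ex => [].
Qed.

End UltraLimit.

(** * Continuity and derivatives from two-sided difference bounds *)

Section DifferenceBounds.
Context {R : realType}.
Implicit Types (f : R -> R) (lo hi : R -> R -> R).

Lemma local_lipschitz_continuous f (a b K q : R) : a < q < b ->
  (forall x y, a < x -> x < y -> y < b -> `|f y - f x| <= K * (y - x)) ->
  {for q, continuous f}.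
Proof.
move=> /andP[aq qb] fK; apply/cvgrPdist_le => e e0.
have K1 : 0 < `|K| + 1 by rewrite ltr_wpDl.
near=> y.
have ay : a < y by near: y; exact: lt_nbhsr.
have yb : y < b by near: y; exact: lt_nbhsl.
have qy : `|q - y| < e / (`|K| + 1).
  near: y; have := @cvg_id _ (nbhs q) => /cvgrPdist_lt; apply.
  by rewrite divr_gt0.
have h : `|f q - f y| <= K * `|q - y|.
  have [yq|qy'|->] := ltgtP y q; last by rewrite !subrr !normr0 mulr0.
  - by rewrite (ger0_norm (x := q - y)) ?subr_ge0 ?(ltW yq)// fK.
  - by rewrite distrC [`|q - y|]distrC (ger0_norm (x := y - q)) ?subr_ge0 ?(ltW qy')// fK.
apply: (le_trans h); apply: (@le_trans _ _ ((`|K| + 1) * `|q - y|)).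
  by rewrite ler_wpM2r// (le_trans (ler_norm K))// lerDl.
by rewrite -ler_pdivlMl// mulrC ltW.
Unshelve. all: by end_near. Qed.

(** [lo] and [hi] take the left end of the interval first, so [q] occurs as left end and as right
    end; hence four limits. *)
Lemma squeeze_is_derive f lo hi (a b q d : R) : a < q < b ->
  (forall x y, a < x -> x < y -> y < b ->
    lo x y * (y - x) <= f y - f x <= hi x y * (y - x)) ->
  lo q y @[y --> q] --> d -> hi q y @[y --> q] --> d ->
  lo y q @[y --> q] --> d -> hi y q @[y --> q] --> d ->
  is_derive q (1 : R) f d.
Proof.
move=> /andP[aq qb] fb lo1 hi1 lo2 hi2; apply: quotient_is_derive.
apply/cvgrPdist_lt => e e0; near=> y.
have ay : a < y by near: y; apply: nbhs_dnbhs; exact: lt_nbhsr.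
have yb : y < b by near: y; apply: nbhs_dnbhs; exact: lt_nbhsl.
have l1 : `|d - lo q y| < e.
  by near: y; apply: nbhs_dnbhs; move/cvgrPdist_lt : lo1; exact.
have l2 : `|d - hi q y| < e.
  by near: y; apply: nbhs_dnbhs; move/cvgrPdist_lt : hi1; exact.
have l3 : `|d - lo y q| < e.
  by near: y; apply: nbhs_dnbhs; move/cvgrPdist_lt : lo2; exact.
have l4 : `|d - hi y q| < e.
  by near: y; apply: nbhs_dnbhs; move/cvgrPdist_lt : hi2; exact.
have yq : y != q by near: y; exact: nbhs_dnbhs_neq.
move: l1 l2 l3 l4; rewrite !ltr_distlC => /andP[l1 l1'] /andP[l2 l2'] /andP[l3 l3'] /andP[l4 l4'].
case: (ltgtP y q) yq => // [yq|qy] _.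
  have := fb _ _ ay yq qb; have yq0 : 0 < q - y by rewrite subr_gt0.
  move=> /andP[h1 h2]; rewrite -mulrNN -invrN !opprB.
  by rewrite (lt_le_trans l3) ?ler_pdivlMr// (le_lt_trans _ l4')// ler_pdivrMr.
have := fb _ _ aq qy yb; have yq0 : 0 < y - q by rewrite subr_gt0.
move=> /andP[h1 h2].
by rewrite (lt_le_trans l1) ?ler_pdivlMr// (le_lt_trans _ l2')// ler_pdivrMr.
Unshelve. all: by end_near. Qed.

End DifferenceBounds.

Section GridLimit.
Context {R : realType}.

(** The factor is [m] and not [m.+1]: for x < 1 the index then stays strictly below [m], where
    [survival] is positive. *)
Definition grid_index (m : nat) (x : R) : nat := Num.truncn (x * m%:R).

Lemma grid_index_lt m x : (0 < m)%N -> 0 < x < 1 -> (grid_index m x < m)%N.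
Proof.
move=> m0 /andP[x0 x1].
have /truncn_itv/andP[h _] : 0 <= x * m%:R by rewrite mulr_ge0// ltW.
rewrite -(ltr_nat R); apply: (le_lt_trans h).
by rewrite gtr_pMl// ltr0n.
Qed.

Lemma grid_index_le m x y : x <= y -> (grid_index m x <= grid_index m y)%N.
Proof. by move=> xy; apply: le_truncn; rewrite ler_wpM2r. Qed.

Lemma quantile_grid_index x : 0 < x < 1 ->
  quantile R m (grid_index m x) @[m --> \oo] --> x.
Proof.
move=> /andP[x0 x1].
apply: (@squeeze_cvgr _ _ _ _ (fun m => x - harmonic m) (fun m => x + harmonic m)).
- near=> m; have d0 := mesh_gt0 R m.
  have /truncn_itv : 0 <= x * m%:R by rewrite mulr_ge0// ltW.
  rewrite /quantile -/(grid_index m x) -[(grid_index m x).+1%:R]natr1.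
  have E : x = (x * m%:R + x) * mesh R m.
    by rewrite /mesh -[m.+1%:R]natr1; field; rewrite natr1.
  rewrite -[harmonic m]/(mesh R m).
  move: (grid_index m x)%:R (mesh R m) d0 E => i d d0 E /andP[h1 h2].
  have h3 : (x * m%:R + x - 1) * d <= (i + 1) * d by rewrite ler_pM2r//; lra.
  have h4 : (i + 1) * d <= (x * m%:R + x + 1) * d by rewrite ler_pM2r//; lra.
  lra.
- by rewrite -[X in _ --> X]subr0; apply: cvgB; [exact: cvg_cst|exact: cvg_harmonic].
- by rewrite -[X in _ --> X]addr0; apply: cvgD; [exact: cvg_cst|exact: cvg_harmonic].
Unshelve. all: by end_near. Qed.

Lemma survival_grid_index x : 0 < x < 1 ->
  survival R m (grid_index m x) @[m --> \oo] --> 1 - x.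
Proof.
move=> x01; have -> : (fun m => survival R m (grid_index m x))
    = (fun m => 1 - quantile R m (grid_index m x)).
  by apply/funext => m; rewrite -(quantileD_survival R m (grid_index m x)); ring.
by apply: cvgB; [exact: cvg_cst|exact: quantile_grid_index].
Qed.

Lemma gap_grid_index x y : 0 < x -> x < y -> y < 1 ->
  (grid_index m y - grid_index m x)%:R * mesh R m @[m --> \oo] --> y - x.
Proof.
move=> x0 xy y1; have -> : (fun m => (grid_index m y - grid_index m x)%:R * mesh R m)
    = (fun m => quantile R m (grid_index m y) - quantile R m (grid_index m x)).
  apply/funext => m; rewrite natrB ?grid_index_le ?(ltW xy)// /quantile.
  by rewrite -!natr1; ring.
by apply: cvgB; apply: quantile_grid_index; lra.
Qed.

End GridLimit.

(* F, w, b and L = ln x (up to a constant) as functions of the quantile. *)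
Record profile (R : realType) (sel act : R -> R) (al1 r theta g : R)
    (F w b L : R -> R) : Prop := {
  prof_growth : 0 < g <= theta * al1 ;
  prof_F_ge (x : R) : 0 < x < 1 -> x * (g / theta) <= F x ;
  prof_F_le (x : R) : 0 < x < 1 -> F x <= al1 * x ;
  prof_F_end (x : R) : 0 < x < 1 -> 0 <= g / theta - F x <= al1 * (1 - x) ;
  prof_w_ge0 (x : R) : 0 < x < 1 -> 0 <= w x ;
  prof_w_le (x : R) : 0 < x < 1 -> r * w x <= 1 - sel (b x) ;
  prof_b_gt0 (x : R) : 0 < x < 1 -> 0 < b x ;
  prof_b_le (x : R) : 0 < x < 1 ->
    b x <= theta / ((1 - theta) * r) * ((1 - x) / x) ;
  prof_dF (x : R) : 0 < x < 1 -> is_derive x (1 : R) F (act (b x)) ;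
  prof_dw (x : R) : 0 < x < 1 -> is_derive x (1 : R) w
    ((1 - sel (b x)) / ((1 - x) * F x)
      - (r + act (b x) * (1 - x)) * w x / ((1 - x) * F x)) ;
  prof_db (x : R) : 0 < x < 1 -> is_derive x (1 : R) b
    (- (g * (b x / ((1 - x) * F x) + w x / F x))) ;
  prof_dL (x : R) : 0 < x < 1 -> is_derive x (1 : R) L (g / ((1 - x) * F x))
}.

(** * The ultrafilter limit solves the differential system *)

Section Limit.
Context {R : realType}.
Variables (sel act : R -> R) (al1 r theta : R).
Hypotheses (sel_ge0 : forall b, 0 <= sel b) (sel_le1 : forall b, sel b <= 1).
Hypotheses (sel_homo : {homo sel : b c / b <= c}) (sel_cont : continuous sel).
Hypothesis sel_half : exists2 b, 0 < b & sel b <= 2^-1.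
Hypotheses (act_ge0 : forall b, 0 <= act b) (act_le : forall b, act b <= al1).
Hypotheses (act_gt0 : forall b, 0 < b -> 0 < act b) (act_cont : continuous act).
Hypotheses (al1_gt0 : 0 < al1) (r_gt0 : 0 < r).
Hypotheses (theta_gt0 : 0 < theta) (theta_lt1 : theta < 1).
Variables (g : nat -> R) (F w b L : nat -> nat -> R).
Hypothesis sol :
  forall m, discrete_solution sel act al1 r theta m (g m) (F m) (w m) (b m) (L m).
Variable U : set_system nat.
Hypotheses (UU : UltraFilter U) (ooU : \oo `<=` U).

Local Notation I := grid_index.
Implicit Types x y : R.
Let C := theta / ((1 - theta) * r).

Let cvgU (f : nat -> R) (l : R) : f m @[m --> \oo] --> l -> f m @[m --> U] --> l.
Proof. by move=> fl V /fl; exact: ooU. Qed.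

Let nearI x : 0 < x < 1 -> \forall m \near U, (I m x < m)%N.
Proof.
move=> x01; apply: ooU; near=> m; apply: grid_index_lt => //.
by near: m; exact: nbhs_infty_gt.
Unshelve. all: by end_near. Qed.

Let cvg_p x : 0 < x < 1 -> quantile R m (I m x) @[m --> U] --> x.
Proof. by move=> x01; apply: cvgU; exact: quantile_grid_index. Qed.

Let cvg_e x : 0 < x < 1 -> survival R m (I m x) @[m --> U] --> 1 - x.
Proof. by move=> x01; apply: cvgU; exact: survival_grid_index. Qed.

Let cvg_gap x y : 0 < x -> x < y -> y < 1 ->
  (I m y - I m x)%:R * mesh R m @[m --> U] --> y - x.
Proof. by move=> x0 xy y1; apply: cvgU; exact: gap_grid_index. Qed.

Let gl : R := lim (g m @[m --> U]).
Let Fl x : R := lim (F m (I m x) @[m --> U]).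
Let wl x : R := lim (w m (I m x) @[m --> U]).
Let bl x : R := lim (b m (I m x) @[m --> U]).
(** Only increments of [L] are controlled, so its value at 1/2 is subtracted; the lost constant is
    the free scale of x. *)
Let Ll x : R := lim (L m (I m x) - L m (I m (2^-1 : R)) @[m --> U]).

Let cvg_g : g m @[m --> U] --> gl.
Proof.
apply: (@ultra_bounded_cvg _ _ _ _ 0 (theta * al1)) => //.
by near=> m; have [/andP[/ltW-> ->]] := sol m.
Unshelve. all: by end_near. Qed.

Let cvg_F x : 0 < x < 1 -> F m (I m x) @[m --> U] --> Fl x.
Proof.
move=> x01; apply: (@ultra_bounded_cvg _ _ _ _ 0 al1) => //.
have := nearI x01; apply: filterS => m /ltnW im.
have [/andP[g0 _] Fge Fle _ _ _ _ _ _ _ _ _ _] := sol m.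
rewrite (le_trans _ (Fge _ im))/=; last first.
  by rewrite mulr_ge0 ?divr_ge0 ?ltW// quantile_gt0.
apply: (le_trans (Fle _ im)); rewrite -[leRHS]mulr1 ler_pM2l//.
by rewrite -(quantileD_survival R m (I m x)) lerDl survival_ge0.
Qed.

Let cvg_w x : 0 < x < 1 -> w m (I m x) @[m --> U] --> wl x.
Proof.
move=> x01; apply: (@ultra_bounded_cvg _ _ _ _ 0 r^-1) => //.
have := nearI x01; apply: filterS => m /ltnW im.
have [_ _ _ _ _ w0 wle _ _ _ _ _ _] := sol m.
rewrite w0//= -[leRHS]mulr1 ler_pdivlMl//.
by apply: (le_trans (wle _ im)); rewrite lerBlDr lerDl.
Qed.

Let cvg_C x : 0 < x < 1 ->
  C * (survival R m (I m x) / quantile R m (I m x)) @[m --> U] --> C * ((1 - x) / x).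
Proof.
move=> x01; apply: cvgMr; apply: cvgM; first exact: cvg_e.
by apply: cvgV; [case/andP: x01 => /lt0r_neq0|exact: cvg_p].
Qed.

Let cvg_b x : 0 < x < 1 -> b m (I m x) @[m --> U] --> bl x.
Proof.
move=> x01; apply: (@ultra_bounded_cvg _ _ _ _ 0 (C * ((1 - x) / x) + 1)) => //.
have := nearI x01; have := cvg_C x01.
move=> /cvgr_le/(_ (C * ((1 - x) / x) + 1)); rewrite ltrDl ltr01 => /(_ isT).
apply: filterS2 => m h /ltnW im.
have [_ _ _ _ _ w0 _ _ _ bge ble _ _] := sol m.
rewrite (le_trans (ble _ im) h) andbT; apply: le_trans (bge _ im).
by apply: mulr_ge0; [exact: ltW|apply: mulr_ge0; [exact: survival_ge0|exact: w0]].
Qed.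

Let cvg_selb x : 0 < x < 1 -> sel (b m (I m x)) @[m --> U] --> sel (bl x).
Proof. by move=> x01; apply: cvg_comp (cvg_b x01) _; exact: sel_cont. Qed.

Let cvg_actb x : 0 < x < 1 -> act (b m (I m x)) @[m --> U] --> act (bl x).
Proof. by move=> x01; apply: cvg_comp (cvg_b x01) _; exact: act_cont. Qed.

Lemma limit_growth_le : 0 <= gl <= theta * al1.
Proof.
apply/andP; split.
  apply: (cvg_le_lim _ (cvg_cst 0) cvg_g); near=> m.
  by have [/andP[/ltW]] := sol m.
apply: (cvg_le_lim _ cvg_g (cvg_cst _)); near=> m.
by have [/andP[_]] := sol m.
Unshelve. all: by end_near. Qed.

Lemma limit_F_ge x : 0 < x < 1 -> x * (gl / theta) <= Fl x.
Proof.
move=> x01; apply: (cvg_le_lim _ _ (cvg_F x01)).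
  apply: cvgM; first exact: (cvg_p x01).
  by apply: cvgM; [exact: cvg_g|exact: cvg_cst].
have := nearI x01; apply: filterS => m /ltnW im.
by have [_ Fge _ _ _ _ _ _ _ _ _ _ _] := sol m; exact: Fge.
Qed.

Lemma limit_F_le x : 0 < x < 1 -> Fl x <= al1 * x.
Proof.
move=> x01; apply: (cvg_le_lim _ (cvg_F x01)).
  by apply: cvgMr; exact: (cvg_p x01).
have := nearI x01; apply: filterS => m /ltnW im.
by have [_ _ Fle _ _ _ _ _ _ _ _ _ _] := sol m; exact: Fle.
Qed.

Lemma limit_F_end x : 0 < x < 1 -> 0 <= gl / theta - Fl x <= al1 * (1 - x).
Proof.
move=> x01; have cv : g m / theta - F m (I m x) @[m --> U] --> gl / theta - Fl x.
  apply: cvgB; last exact: cvg_F.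
  by apply: cvgM; [exact: cvg_g|exact: cvg_cst].
apply/andP; split; [apply: (cvg_le_lim _ (cvg_cst 0) cv)|apply: (cvg_le_lim _ cv)].
- have := nearI x01; apply: filterS => m /ltnW im.
  by have [_ _ _ + _ _ _ _ _ _ _ _ _] := sol m => /(_ _ im)/andP[].
- by apply: cvgMr; exact: (cvg_e x01).
- have := nearI x01; apply: filterS => m /ltnW im.
  by have [_ _ _ + _ _ _ _ _ _ _ _ _] := sol m => /(_ _ im)/andP[].
Qed.

Lemma limit_w_ge0 x : 0 < x < 1 -> 0 <= wl x.
Proof.
move=> x01; apply: (cvg_le_lim _ (cvg_cst 0) (cvg_w x01)).
have := nearI x01; apply: filterS => m /ltnW im.
by have [_ _ _ _ _ w0 _ _ _ _ _ _ _] := sol m; exact: w0.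
Qed.

Lemma limit_w_le x : 0 < x < 1 -> r * wl x <= 1 - sel (bl x).
Proof.
move=> x01; apply: (@cvg_le_lim _ _ U (fun m => r * w m (I m x))
  (fun m => 1 - sel (b m (I m x)))).
- by apply: cvgMr; exact: (cvg_w x01).
- by apply: cvgB; [exact: cvg_cst|exact: cvg_selb].
have := nearI x01; apply: filterS => m /ltnW im.
by have [_ _ _ _ _ _ wle _ _ _ _ _ _] := sol m; exact: wle.
Qed.

Lemma limit_b_le x : 0 < x < 1 -> bl x <= C * ((1 - x) / x).
Proof.
move=> x01; apply: (cvg_le_lim _ (cvg_b x01) (cvg_C x01)).
have := nearI x01; apply: filterS => m /ltnW im.
by have [_ _ _ _ _ _ _ _ _ _ ble _ _] := sol m; exact: ble.
Qed.

Lemma limit_b_ge x : 0 < x < 1 -> theta * ((1 - x) * wl x) <= bl x.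
Proof.
move=> x01; apply: (cvg_le_lim _ _ (cvg_b x01)).
  by apply: cvgMr; apply: cvgM; [exact: (cvg_e x01)|exact: (cvg_w x01)].
have := nearI x01; apply: filterS => m /ltnW im.
by have [_ _ _ _ _ _ _ _ _ bge _ _ _] := sol m; exact: bge.
Qed.

Let nearIJ x y : 0 < x -> x < y -> y < 1 ->
  \forall m \near U, (I m x <= I m y < m)%N.
Proof.
move=> x0 xy y1; have : 0 < y < 1 by rewrite y1 (lt_trans x0 xy).
by move/nearI; apply: filterS => m ->; rewrite grid_index_le// ltW.
Qed.

Lemma limit_F_incr x y : 0 < x -> x < y -> y < 1 ->
  act (bl y) * (y - x) <= Fl y - Fl x <= act (bl x) * (y - x).
Proof.
move=> x0 xy y1.
have x01 : 0 < x < 1 by rewrite x0 (lt_trans xy y1).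
have y01 : 0 < y < 1 by rewrite y1 (lt_trans x0 xy).
have cv : F m (I m y) - F m (I m x) @[m --> U] --> Fl y - Fl x.
  by apply: cvgB; [exact: (cvg_F y01)|exact: (cvg_F x01)].
apply/andP; split; [apply: (cvg_le_lim _ _ cv)|apply: (cvg_le_lim _ cv)].
- by apply: cvgM; [exact: (cvg_actb y01)|exact: cvg_gap].
- have := nearIJ x0 xy y1; apply: filterS => m ij.
  by have [_ _ _ _ + _ _ _ _ _ _ _ _] := sol m => /(_ _ _ ij)/andP[].
- by apply: cvgM; [exact: (cvg_actb x01)|exact: cvg_gap].
- have := nearIJ x0 xy y1; apply: filterS => m ij.
  by have [_ _ _ _ + _ _ _ _ _ _ _ _] := sol m => /(_ _ _ ij)/andP[].
Qed.

(** The bound [C * (1 - x) / x] forces [b] below the threshold of [sel_half] once x is close to 1,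
    whatever the growth rates are; from there on [dsol_w_half] applies. *)
Lemma limit_w_gt0 : exists2 x0, 0 < x0 < 1 &
  forall y, x0 < y < 1 -> 0 < wl y.
Proof.
have [b1 b10 sb1] := sel_half.
have C0 : 0 < C by rewrite divr_gt0// mulr_gt0// subr_gt0.
have Cb : 0 < C + b1 by rewrite addr_gt0.
(* The midpoint of 1 and [C / (C + b1)], the latter being the point where the bound on [b] equals
   [b1]. *)
pose x := (2 * C + b1) / (2 * (C + b1)).
have x01 : 0 < x < 1.
  apply/andP; split; first by apply: divr_gt0; lra.
  by rewrite ltr_pdivrMr; lra.
have Cx : C * ((1 - x) / x) < b1.
  have -> : C * ((1 - x) / x) = C * b1 / (2 * C + b1).
    by rewrite /x; field; apply/andP; split; apply/lt0r_neq0; lra.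
  rewrite ltr_pdivrMr; last by lra.
  have : 0 < C * b1 by exact: mulr_gt0.
  have : 0 < b1 * b1 by exact: mulr_gt0.
  lra.
exists x => // y /andP[xy y1].
have y01 : 0 < y < 1 by rewrite y1 andbT (lt_trans _ xy)//; case/andP: x01.
have h : y - x <= 4 * (r + al1) * wl y.
  apply: (cvg_le_lim _ (cvg_gap _ xy y1)).
  - by case/andP: x01.
  - by apply: cvgMr; exact: (cvg_w y01).
  - have x0 : 0 < x by case/andP: x01.
    have := cvg_C x01 => /cvgr_le/(_ _ Cx) nC.
    near=> m.
    have ij : (I m x <= I m y < m)%N by near: m; exact: nearIJ.
    have im : (I m x <= m)%N by case/andP: ij => /leq_ltn_trans h /h /ltnW.
    have [_ _ _ _ _ _ _ half _ _ ble _ _] := sol m; apply: half => //.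
    apply: le_trans sb1; apply: sel_homo; apply: (le_trans (ble _ im)).
    by near: m.
have : 0 < 4 * (r + al1) * wl y by apply: lt_le_trans h; rewrite subr_gt0.
by rewrite pmulr_rgt0// mulr_gt0// addr_gt0.
Unshelve. all: by end_near. Qed.

(** Excludes the degenerate limit: [w > 0] near 1 gives [b > 0], hence a positive slope of [F], and
    [gl / theta] dominates [F]. It has to precede every division by the limit of [F]. *)
Lemma limit_growth_gt0 : 0 < gl.
Proof.
have [x /andP[x0 x1] wx] := limit_w_gt0.
pose y := (x + 1) / 2; pose z := (y + 1) / 2.
have xy : x < y by rewrite /y; lra.
have yz : y < z by rewrite /z /y; lra.
have z1 : z < 1 by rewrite /z /y; lra.
have y0 : 0 < y := lt_trans x0 xy.
have z01 : 0 < z < 1 by rewrite (lt_trans y0 yz).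
have bz : 0 < bl z.
  apply: lt_le_trans (limit_b_ge z01).
  rewrite !mulr_gt0 ?subr_gt0// wx// z1 (lt_trans xy)//.
have y01 : 0 < y < 1 by rewrite y0 (lt_trans yz z1).
have /andP[h _] := limit_F_incr y0 yz z1.
have Fy : 0 <= Fl y.
  apply: le_trans (limit_F_ge y01); rewrite mulr_ge0 ?(ltW y0)// divr_ge0 ?(ltW theta_gt0)//.
  by case/andP: limit_growth_le.
have /andP[h' _] := limit_F_end z01.
have : 0 < act (bl z) * (z - y) by rewrite mulr_gt0 ?act_gt0 ?subr_gt0.
have : gl / theta * theta = gl by rewrite divfK ?gt_eqF.
move=> <- hh; rewrite mulr_gt0//; lra.
Qed.

Lemma limit_F_gt0 x : 0 < x < 1 -> 0 < Fl x.
Proof.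
move=> x01; apply: lt_le_trans (limit_F_ge x01).
by case/andP: x01 => x0 _; rewrite mulr_gt0// divr_gt0// limit_growth_gt0.
Qed.

Let cvg_F_inv x : 0 < x < 1 -> (F m (I m x))^-1 @[m --> U] --> (Fl x)^-1.
Proof.
by move=> x01; apply: cvgV; [rewrite gt_eqF// limit_F_gt0|exact: cvg_F].
Qed.

Let cvg_eF_inv x y : 0 < x < 1 -> 0 < y < 1 ->
  (survival R m (I m x) * F m (I m y))^-1 @[m --> U] --> ((1 - x) * Fl y)^-1.
Proof.
move=> x01 y01; apply: cvgV; last by apply: cvgM; [exact: cvg_e|exact: cvg_F].
rewrite gt_eqF// mulr_gt0 ?limit_F_gt0// subr_gt0.
by case/andP: x01.
Qed.

Let cvg_rho x : 0 < x < 1 -> r + act (b m (I m x)) * survival R m (I m x) @[m --> U]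
  --> r + act (bl x) * (1 - x).
Proof.
move=> x01; apply: cvgD; first exact: cvg_cst.
by apply: cvgM; [exact: (cvg_actb x01)|exact: cvg_e].
Qed.

Lemma limit_w_incr x y : 0 < x -> x < y -> y < 1 ->
  ((1 - sel (bl x)) / ((1 - x) * Fl y)
    - (r + act (bl x) * (1 - x)) * wl y / ((1 - y) * Fl x)) * (y - x)
  <= wl y - wl x <=
  ((1 - sel (bl y)) / ((1 - y) * Fl x)
    - (r + act (bl y) * (1 - y)) * wl x / ((1 - x) * Fl y)) * (y - x).
Proof.
move=> x0 xy y1.
have x01 : 0 < x < 1 by rewrite x0 (lt_trans xy y1).
have y01 : 0 < y < 1 by rewrite y1 (lt_trans x0 xy).
have cv : w m (I m y) - w m (I m x) @[m --> U] --> wl y - wl x.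
  by apply: cvgB; [exact: (cvg_w y01)|exact: (cvg_w x01)].
apply/andP; split; [apply: (cvg_le_lim _ _ cv)|apply: (cvg_le_lim _ cv)].
- apply: cvgM; last exact: cvg_gap.
  apply: cvgB.
    apply: cvgM; last exact: (cvg_eF_inv x01 y01).
    by apply: cvgB; [exact: cvg_cst|exact: (cvg_selb x01)].
  apply: cvgM; last exact: (cvg_eF_inv y01 x01).
  by apply: cvgM; [exact: (cvg_rho x01)|exact: (cvg_w y01)].
- have := nearIJ x0 xy y1; apply: filterS => m ij.
  by have [_ _ _ _ _ _ _ _ + _ _ _ _] := sol m => /(_ _ _ ij)/andP[].
- apply: cvgM; last exact: cvg_gap.
  apply: cvgB.
    apply: cvgM; last exact: (cvg_eF_inv y01 x01).
    by apply: cvgB; [exact: cvg_cst|exact: (cvg_selb y01)].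
  apply: cvgM; last exact: (cvg_eF_inv x01 y01).
  by apply: cvgM; [exact: (cvg_rho y01)|exact: (cvg_w x01)].
- have := nearIJ x0 xy y1; apply: filterS => m ij.
  by have [_ _ _ _ _ _ _ _ + _ _ _ _] := sol m => /(_ _ _ ij)/andP[].
Qed.

Lemma limit_b_incr x y : 0 < x -> x < y -> y < 1 ->
  gl * (bl y / ((1 - x) * Fl y) + wl x / Fl y) * (y - x)
  <= bl x - bl y <=
  gl * (bl x / ((1 - y) * Fl x) + wl y / Fl x) * (y - x).
Proof.
move=> x0 xy y1.
have x01 : 0 < x < 1 by rewrite x0 (lt_trans xy y1).
have y01 : 0 < y < 1 by rewrite y1 (lt_trans x0 xy).
have cv : b m (I m x) - b m (I m y) @[m --> U] --> bl x - bl y.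
  by apply: cvgB; [exact: (cvg_b x01)|exact: (cvg_b y01)].
apply/andP; split; [apply: (cvg_le_lim _ _ cv)|apply: (cvg_le_lim _ cv)].
- apply: cvgM; last exact: cvg_gap.
  apply: cvgM; first exact: cvg_g.
  apply: cvgD.
    by apply: cvgM; [exact: (cvg_b y01)|exact: (cvg_eF_inv x01 y01)].
  by apply: cvgM; [exact: (cvg_w x01)|exact: (cvg_F_inv y01)].
- have := nearIJ x0 xy y1; apply: filterS => m ij.
  by have [_ _ _ _ _ _ _ _ _ _ _ + _] := sol m => /(_ _ _ ij)/andP[].
- apply: cvgM; last exact: cvg_gap.
  apply: cvgM; first exact: cvg_g.
  apply: cvgD.
    by apply: cvgM; [exact: (cvg_b x01)|exact: (cvg_eF_inv y01 x01)].
  by apply: cvgM; [exact: (cvg_w y01)|exact: (cvg_F_inv x01)].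
- have := nearIJ x0 xy y1; apply: filterS => m ij.
  by have [_ _ _ _ _ _ _ _ _ _ _ + _] := sol m => /(_ _ _ ij)/andP[].
Qed.

Let cvg_L_bound x y : 0 < x < 1 -> 0 < y < 1 ->
  g m / (survival R m (I m x) * F m (I m y)) @[m --> U] --> gl / ((1 - x) * Fl y).
Proof. by move=> x01 y01; apply: cvgM; [exact: cvg_g|exact: cvg_eF_inv]. Qed.

Let L_bounded x y : 0 < x -> x < y -> y < 1 ->
  exists K, \forall m \near U, 0 <= L m (I m y) - L m (I m x) <= K.
Proof.
move=> x0 xy y1.
have x01 : 0 < x < 1 by rewrite x0 (lt_trans xy y1).
have y01 : 0 < y < 1 by rewrite y1 (lt_trans x0 xy).
exists (gl / ((1 - y) * Fl x) * (y - x) + 1).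
have cv : g m / (survival R m (I m y) * F m (I m x))
      * ((I m y - I m x)%:R * mesh R m) @[m --> U]
    --> gl / ((1 - y) * Fl x) * (y - x).
  by apply: cvgM; [exact: cvg_L_bound|exact: cvg_gap].
move/cvgr_le: cv => /(_ _ (ltr_pwDr ltr01 (lexx _))) hi.
near=> m.
have ij : (I m x <= I m y < m)%N by near: m; exact: nearIJ.
have [/andP[g0 _] Fge _ _ _ _ _ _ _ _ _ _ Li] := sol m.
have /andP[l1 l2] := Li _ _ ij.
have im : (I m x < m)%N by case/andP: ij => /leq_ltn_trans h /h.
have Fy : 0 <= F m (I m y).
  apply: le_trans (Fge _ _); last by case/andP: ij => _ /ltnW.
  by rewrite mulr_ge0 ?divr_ge0 ?(ltW g0) ?(ltW theta_gt0)// ltW// quantile_gt0.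
apply/andP; split; last by apply: (le_trans l2); near: m.
apply: le_trans l1; rewrite mulr_ge0//; last by rewrite mulr_ge0// ltW// mesh_gt0.
by apply: divr_ge0; [exact: ltW|rewrite mulr_ge0// survival_ge0// ltnW].
Unshelve. all: by end_near. Qed.

Let cvg_L x : 0 < x < 1 -> L m (I m x) - L m (I m (2^-1 : R)) @[m --> U] --> Ll x.
Proof.
move=> /andP[x0 x1].
have h0 : (0 : R) < 2^-1 by rewrite invr_gt0.
have h1 : (2^-1 : R) < 1 by rewrite invf_lt1// ltr1n.
have [K LK] : exists K, \forall m \near U,
    - K <= L m (I m x) - L m (I m (2^-1 : R)) <= K.
  have [xh|xh|->] := ltgtP x 2^-1.
  - have [K LK] := L_bounded x0 xh h1; exists K; apply: filterS LK => m.
    by rewrite -[X in - K <= X <= _]opprB lerN2 => /andP[l1 l2]; rewrite l2/=; lra.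
  - have [K LK] := L_bounded h0 xh x1; exists K; apply: filterS LK => m.
    by move=> /andP[l1 l2]; rewrite l2 andbT; lra.
  - by exists 0; near=> m; rewrite subrr oppr0 lexx.
exact: (@ultra_bounded_cvg _ _ _ _ (- K) K).
Unshelve. all: by end_near. Qed.

Lemma limit_L_incr x y : 0 < x -> x < y -> y < 1 ->
  gl / ((1 - x) * Fl y) * (y - x) <= Ll y - Ll x <= gl / ((1 - y) * Fl x) * (y - x).
Proof.
move=> x0 xy y1.
have x01 : 0 < x < 1 by rewrite x0 (lt_trans xy y1).
have y01 : 0 < y < 1 by rewrite y1 (lt_trans x0 xy).
have cv : L m (I m y) - L m (I m x) @[m --> U] --> Ll y - Ll x.
  have -> : (fun m => L m (I m y) - L m (I m x))
      = (fun m => (L m (I m y) - L m (I m (2^-1 : R)))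
                  - (L m (I m x) - L m (I m (2^-1 : R)))).
    by apply/funext => m; ring.
  by apply: cvgB; [exact: (cvg_L y01)|exact: (cvg_L x01)].
apply/andP; split; [apply: (cvg_le_lim _ _ cv)|apply: (cvg_le_lim _ cv)].
- by apply: cvgM; [exact: cvg_L_bound|exact: cvg_gap].
- have := nearIJ x0 xy y1; apply: filterS => m ij.
  by have [_ _ _ _ _ _ _ _ _ _ _ _ +] := sol m => /(_ _ _ ij)/andP[].
- by apply: cvgM; [exact: cvg_L_bound|exact: cvg_gap].
- have := nearIJ x0 xy y1; apply: filterS => m ij.
  by have [_ _ _ _ _ _ _ _ _ _ _ _ +] := sol m => /(_ _ _ ij)/andP[].
Qed.

(** Positivity holds near 1 through the lower bound by [w], and spreads to the left because [b] is
    nonincreasing. *)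
Lemma limit_b_gt0 x : 0 < x < 1 -> 0 < bl x.
Proof.
move=> /andP[x0 x1]; have [z /andP[z0 z1] wz] := limit_w_gt0.
pose y := (Num.max x z + 1) / 2.
have xm : x <= Num.max x z by rewrite le_max lexx.
have zm : z <= Num.max x z by rewrite le_max lexx orbT.
have m1 : Num.max x z < 1 by rewrite gt_max x1 z1.
have xy : x < y by rewrite /y; lra.
have zy : z < y by rewrite /y; lra.
have y1 : y < 1 by rewrite /y; lra.
have y01 : 0 < y < 1 by rewrite y1 (lt_trans x0 xy).
have x01 : 0 < x < 1 by rewrite x0 x1.
have wy : 0 < wl y by rewrite wz// zy.
have by0 : 0 < bl y.
  apply: lt_le_trans (limit_b_ge y01).
  by apply: mulr_gt0 => //; apply: mulr_gt0 => //; rewrite subr_gt0.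
have /andP[h _] := limit_b_incr x0 xy y1.
apply: (lt_le_trans by0); rewrite -subr_ge0; apply: le_trans h.
have Fy := limit_F_gt0 y01; have wx := limit_w_ge0 x01.
apply: mulr_ge0; last by rewrite subr_ge0 ltW.
apply: mulr_ge0; first exact/ltW/limit_growth_gt0.
apply: addr_ge0; last by apply: divr_ge0 => //; exact: ltW.
apply: divr_ge0; first exact: ltW.
by apply: mulr_ge0; [rewrite subr_ge0 ltW|exact: ltW].
Qed.

(** The window from q / 2 to (1 + q) / 2 avoids both singular points, so a single constant bounds
    the coefficients in it. *)
Let eF_inv_le q x y : 0 < q < 1 -> q / 2 < x -> x < (1 + q) / 2 ->
    q / 2 < y -> y < (1 + q) / 2 ->
  0 <= ((1 - x) * Fl y)^-1 <= (((1 - q) / 2) * (q / 2 * (gl / theta)))^-1.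
Proof.
move=> /andP[q0 q1] qx xq qy yq; have g0 := limit_growth_gt0.
have y01 : 0 < y < 1 by apply/andP; split; lra.
have Fy := limit_F_gt0 y01; have x1 : 0 < 1 - x by lra.
have gt0 : 0 < gl / theta by exact: divr_gt0.
have D0 : 0 < ((1 - q) / 2) * (q / 2 * (gl / theta)).
  by do !apply: mulr_gt0 => //; lra.
rewrite invr_ge0 (ltW (mulr_gt0 x1 Fy))/=.
rewrite lef_pV2 ?posrE ?(mulr_gt0 x1 Fy)//.
apply: ler_pM; [lra| |lra|].
  by apply: mulr_ge0; [lra|exact: ltW].
apply: le_trans (limit_F_ge y01); rewrite ler_wpM2r ?(ltW gt0)//; exact: ltW.
Qed.

Let F_inv_le q y : 0 < q < 1 -> q / 2 < y -> y < (1 + q) / 2 ->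
  0 <= (Fl y)^-1 <= (((1 - q) / 2) * (q / 2 * (gl / theta)))^-1.
Proof.
move=> q01 qy yq; have [q0 q1] := andP q01.
have y01 : 0 < y < 1 by apply/andP; split; lra.
have Fy := limit_F_gt0 y01; have y1 : 0 < 1 - y by lra.
have /andP[_ h] := eF_inv_le q01 qy yq qy yq.
rewrite invr_ge0 (ltW Fy)/=; apply: le_trans h.
by rewrite lef_pV2 ?posrE ?(mulr_gt0 y1 Fy)// ger_pMl//; lra.
Qed.

(** Limits taken point by point carry no regularity. Continuity is recovered from the increment
    bounds, and only then can these be squeezed to derivatives. *)
Lemma limit_F_continuous q : 0 < q < 1 -> {for q, continuous Fl}.
Proof.
move=> q01; apply: (@local_lipschitz_continuous _ _ 0 1 al1) => // x y x0 xy y1.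
have /andP[h1 h2] := limit_F_incr x0 xy y1.
have yx : 0 <= y - x by rewrite subr_ge0 ltW.
rewrite ger0_norm; first by apply: (le_trans h2); rewrite ler_wpM2r.
by apply: le_trans h1; rewrite mulr_ge0.
Qed.

Lemma limit_w_continuous q : 0 < q < 1 -> {for q, continuous wl}.
Proof.
move=> q01; have [q0 q1] := andP q01.
pose D := (((1 - q) / 2) * (q / 2 * (gl / theta)))^-1.
have D0 : 0 <= D.
  have [] := andP (@eF_inv_le q q q q01 _ _ _ _); try lra.
  exact: le_trans.
apply: (@local_lipschitz_continuous _ _ (q / 2) ((1 + q) / 2)
  ((1 + (r + al1) / r) * D)); first by apply/andP; split; lra.
move=> x y qx xy yq; have xq := lt_trans xy yq; have qy := lt_trans qx xy.
have x01 : 0 < x < 1 by apply/andP; split; lra.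
have y01 : 0 < y < 1 by apply/andP; split; lra.
have /andP[x0 x1] := x01; have /andP[y0 y1] := y01.
have yx : 0 <= y - x by rewrite subr_ge0 ltW.
have /andP[h1 h2] := limit_w_incr x0 xy y1.
have wle z : 0 < z < 1 -> 0 <= wl z <= r^-1.
  move=> z01; rewrite limit_w_ge0//= -[leRHS]mulr1 ler_pdivlMl//.
  by apply: (le_trans (limit_w_le z01)); rewrite lerBlDr lerDl.
have rho z : 0 < z < 1 -> 0 <= r + act (bl z) * (1 - z) <= r + al1.
  move=> /andP[z0 z1]; have z1' : 0 <= 1 - z by lra.
  apply/andP; split; first by rewrite addr_ge0// ?mulr_ge0// ltW.
  by rewrite lerD2l -[leRHS]mulr1 ler_pM//; lra.
have s01 z : 0 <= 1 - sel (bl z) <= 1 by rewrite subr_ge0 sel_le1 lerBlDr lerDl sel_ge0.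
have /andP[i1 i1'] : 0 <= ((1 - y) * Fl x)^-1 <= D by exact: eF_inv_le.
have /andP[i2 i2'] : 0 <= ((1 - x) * Fl y)^-1 <= D by exact: eF_inv_le.
have /andP[wx wx'] := wle _ x01; have /andP[wy wy'] := wle _ y01.
have /andP[rx rx'] := rho _ x01; have /andP[ry ry'] := rho _ y01.
have /andP[sx sx'] := s01 x; have /andP[sy sy'] := s01 y.
have rr0 : 0 <= (r + al1) / r by apply: divr_ge0; [apply: addr_ge0|]; exact: ltW.
have KE : (1 + (r + al1) / r) * D = D + (r + al1) / r * D by rewrite mulrDl mul1r.
rewrite ler_norml; apply/andP; split.
  apply: le_trans h1; rewrite -mulNr ler_wpM2r//.
  have : 0 <= (1 - sel (bl x)) / ((1 - x) * Fl y) by exact: mulr_ge0.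
  have : (r + act (bl x) * (1 - x)) * wl y / ((1 - y) * Fl x) <= (r + al1) / r * D.
    by apply: ler_pM => //; [exact: mulr_ge0|exact: ler_pM].
  rewrite KE; lra.
apply: (le_trans h2); rewrite ler_wpM2r//.
have : 0 <= (r + act (bl y) * (1 - y)) * wl x / ((1 - x) * Fl y).
  by apply: mulr_ge0 => //; exact: mulr_ge0.
have : (1 - sel (bl y)) / ((1 - y) * Fl x) <= 1 * D by exact: ler_pM.
have : 0 <= (r + al1) / r * D by exact: mulr_ge0.
rewrite KE; lra.
Qed.

Lemma limit_b_continuous q : 0 < q < 1 -> {for q, continuous bl}.
Proof.
move=> q01; have [q0 q1] := andP q01; have g0 := limit_growth_gt0.
pose D := (((1 - q) / 2) * (q / 2 * (gl / theta)))^-1.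
have D0 : 0 <= D.
  have [] := andP (@eF_inv_le q q q q01 _ _ _ _); try lra.
  exact: le_trans.
have C0 : 0 < C by rewrite divr_gt0// mulr_gt0// subr_gt0.
apply: (@local_lipschitz_continuous _ _ (q / 2) ((1 + q) / 2)
  (gl * (C * (q / 2)^-1 * D + r^-1 * D))); first by apply/andP; split; lra.
move=> x y qx xy yq; have xq := lt_trans xy yq; have qy := lt_trans qx xy.
have x01 : 0 < x < 1 by apply/andP; split; lra.
have y01 : 0 < y < 1 by apply/andP; split; lra.
have /andP[x0 x1] := x01; have /andP[y0 y1] := y01.
have yx : 0 <= y - x by rewrite subr_ge0 ltW.
have /andP[h1 h2] := limit_b_incr x0 xy y1.
have wle z : 0 < z < 1 -> 0 <= wl z <= r^-1.
  move=> z01; rewrite limit_w_ge0//= -[leRHS]mulr1 ler_pdivlMl//.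
  by apply: (le_trans (limit_w_le z01)); rewrite lerBlDr lerDl.
have /andP[i1 i1'] : 0 <= ((1 - y) * Fl x)^-1 <= D by exact: eF_inv_le.
have /andP[i2 i2'] : 0 <= ((1 - x) * Fl y)^-1 <= D by exact: eF_inv_le.
have /andP[i3 i3'] : 0 <= (Fl x)^-1 <= D by exact: F_inv_le.
have /andP[i4 i4'] : 0 <= (Fl y)^-1 <= D by exact: F_inv_le.
have /andP[wx wx'] := wle _ x01; have /andP[wy wy'] := wle _ y01.
have bx := ltW (limit_b_gt0 x01); have by0 := ltW (limit_b_gt0 y01).
have bx' : bl x <= C * (q / 2)^-1.
  apply: (le_trans (limit_b_le x01)); rewrite ler_pM2l//.
  have x1' : 0 <= 1 - x by lra.
  have x1'' : 1 - x <= 1 by lra.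
  rewrite -[leRHS]mul1r; apply: ler_pM => //; first by rewrite invr_ge0 ltW.
  by rewrite lef_pV2 ?posrE ?divr_gt0// ltW.
rewrite distrC ger0_norm.
  apply: (le_trans h2); rewrite ler_wpM2r// ler_pM2l//.
  by apply: lerD; apply: ler_pM.
apply: le_trans h1; apply: mulr_ge0 => //; apply: mulr_ge0; first exact: ltW.
by apply: addr_ge0; apply: mulr_ge0.
Qed.

Lemma limit_dF (q : R) : 0 < q < 1 -> is_derive q (1 : R) Fl (act (bl q)).
Proof.
move=> q01; have cb := limit_b_continuous q01.
have ca : act (bl y) @[y --> q] --> act (bl q).
  by apply: (continuous_comp cb); exact: act_cont.
by apply: (@squeeze_is_derive _ Fl (fun x y => act (bl y))
  (fun x y => act (bl x)) 0 1) => // [x y||]; [exact: limit_F_incr|..];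
  exact: cvg_cst.
Qed.

Section LimitAt.
Variable q : R.
Hypothesis q01 : 0 < q < 1.
Let cF : Fl y @[y --> q] --> Fl q := limit_F_continuous q01.
Let cw : wl y @[y --> q] --> wl q := limit_w_continuous q01.
Let cb : bl y @[y --> q] --> bl q := limit_b_continuous q01.

Let ca : act (bl y) @[y --> q] --> act (bl q).
Proof. by apply: (continuous_comp cb); exact: act_cont. Qed.

Let cs : 1 - sel (bl y) @[y --> q] --> 1 - sel (bl q).
Proof.
by apply: cvgB; [exact: cvg_cst|apply: (continuous_comp cb); exact: sel_cont].
Qed.

Let c1 : 1 - y @[y --> q] --> 1 - q.
Proof. by apply: cvgB; [exact: cvg_cst|exact: cvg_id]. Qed.

Let crho : r + act (bl y) * (1 - y) @[y --> q] --> r + act (bl q) * (1 - q).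
Proof. by apply: cvgD; [exact: cvg_cst|exact: cvgM]. Qed.

Let q1_gt0 : 0 < 1 - q. Proof. by rewrite subr_gt0; case/andP: q01. Qed.
Let Fq_gt0 : 0 < Fl q := limit_F_gt0 q01.

Let cFV : (Fl y)^-1 @[y --> q] --> (Fl q)^-1.
Proof. by apply: cvgV => //; rewrite gt_eqF. Qed.

Let cFl : ((1 - q) * Fl y)^-1 @[y --> q] --> ((1 - q) * Fl q)^-1.
Proof.
by apply: cvgV; [rewrite gt_eqF ?mulr_gt0|apply: cvgM => //; exact: cvg_cst].
Qed.

Let cFr : ((1 - y) * Fl q)^-1 @[y --> q] --> ((1 - q) * Fl q)^-1.
Proof.
by apply: cvgV; [rewrite gt_eqF ?mulr_gt0|apply: cvgM => //; exact: cvg_cst].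
Qed.

Let itv01 : 0 < q < 1 := q01.

Lemma limit_dw : is_derive q (1 : R) wl
  ((1 - sel (bl q)) / ((1 - q) * Fl q)
    - (r + act (bl q) * (1 - q)) * wl q / ((1 - q) * Fl q)).
Proof.
apply: (squeeze_is_derive itv01 limit_w_incr).
- apply: cvgB; first by apply: cvgM; [exact: cvg_cst|exact: cFl].
  by apply: cvgM; [apply: cvgM; [exact: cvg_cst|exact: cw]|exact: cFr].
- apply: cvgB; first by apply: cvgM; [exact: cs|exact: cFr].
  by apply: cvgM; [apply: cvgM; [exact: crho|exact: cvg_cst]|exact: cFl].
- apply: cvgB; first by apply: cvgM; [exact: cs|exact: cFr].
  by apply: cvgM; [apply: cvgM; [exact: crho|exact: cvg_cst]|exact: cFl].
- apply: cvgB; first by apply: cvgM; [exact: cvg_cst|exact: cFl].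
  by apply: cvgM; [apply: cvgM; [exact: cvg_cst|exact: cw]|exact: cFr].
Qed.

Lemma limit_db : is_derive q (1 : R) bl
  (- (gl * (bl q / ((1 - q) * Fl q) + wl q / Fl q))).
Proof.
apply: (@squeeze_is_derive _ bl
    (fun x y => - (gl * (bl x / ((1 - y) * Fl x) + wl y / Fl x)))
    (fun x y => - (gl * (bl y / ((1 - x) * Fl y) + wl x / Fl y))) 0 1).
- exact: q01.
- move=> x y x0 xy y1; have /andP[h1 h2] := limit_b_incr x0 xy y1.
  by rewrite !mulNr -[bl y - bl x]opprB !lerN2 h1 h2.
- apply: cvgN; apply: cvgMr; apply: cvgD.
    by apply: cvgM; [exact: cvg_cst|exact: cFr].
  by apply: cvgM; [exact: cw|exact: cvg_cst].
- apply: cvgN; apply: cvgMr; apply: cvgD.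
    by apply: cvgM; [exact: cb|exact: cFl].
  by apply: cvgM; [exact: cvg_cst|exact: cFV].
- apply: cvgN; apply: cvgMr; apply: cvgD.
    by apply: cvgM; [exact: cb|exact: cFl].
  by apply: cvgM; [exact: cvg_cst|exact: cFV].
- apply: cvgN; apply: cvgMr; apply: cvgD.
    by apply: cvgM; [exact: cvg_cst|exact: cFr].
  by apply: cvgM; [exact: cw|exact: cvg_cst].
Qed.

Lemma limit_dL : is_derive q (1 : R) Ll (gl / ((1 - q) * Fl q)).
Proof.
by apply: (squeeze_is_derive itv01 limit_L_incr); apply: cvgMr.
Qed.

End LimitAt.

Lemma limit_profile : profile sel act al1 r theta gl Fl wl bl Ll.
Proof.
split; first by rewrite limit_growth_gt0; case/andP: limit_growth_le.
- exact: limit_F_ge.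
- exact: limit_F_le.
- exact: limit_F_end.
- exact: limit_w_ge0.
- exact: limit_w_le.
- exact: limit_b_gt0.
- exact: limit_b_le.
- exact: limit_dF.
- exact: limit_dw.
- exact: limit_db.
- exact: limit_dL.
Qed.

End Limit.

Lemma exists_profile (R : realType) (sel act : R -> R) (al1 r theta : R) :
  (forall b, 0 <= sel b) -> (forall b, sel b <= 1) ->
  {homo sel : b c / b <= c} -> continuous sel ->
  (forall b, b <= 0 -> sel b = 0) -> (exists2 b, 0 < b & sel b <= 2^-1) ->
  (forall b, 0 <= act b) -> (forall b, act b <= al1) ->
  {homo act : b c / b <= c} -> continuous act ->
  (forall b, b <= 0 -> act b = 0) -> (forall b, 0 < b -> 0 < act b) ->
  0 < al1 -> 0 < r -> 0 < theta -> theta < 1 ->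
  exists g F w b L, profile sel act al1 r theta g F w b L.
Proof.
move=> s0 s1 sh sc sz half a0 a1 ah ac az apos al1p r0 t0 t1.
have S := exists_discrete_solution s0 s1 sh sc sz a0 a1 ah ac az al1p r0 t0 t1.
have [g G] := choice S; have [F FF] := choice G; have [w W] := choice FF.
have [b B] := choice W; have [L sol] := choice B.
have [U [UU ooU]] := @ultraFilterLemma nat \oo _.
by do 5!eexists; exact: (limit_profile s0 s1 sh sc half a0 a1 apos ac al1p r0 t0 t1 sol UU ooU).
Qed.

(** * Size distribution *)

Section PointwiseDerivatives.
Context {R : realType}.
Implicit Types (f g : R -> R) (x a b c : R).

Lemma is_derive_addf f g x a b : is_derive x (1 : R) f a ->
  is_derive x (1 : R) g b -> is_derive x (1 : R) (fun z => f z + g z) (a + b).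
Proof. by move=> fa gb; exact: is_deriveD. Qed.

Lemma is_derive_subf f g x a b : is_derive x (1 : R) f a ->
  is_derive x (1 : R) g b -> is_derive x (1 : R) (fun z => f z - g z) (a - b).
Proof. by move=> fa gb; exact: is_deriveB. Qed.

Lemma is_derive_mulf f g x a b : is_derive x (1 : R) f a ->
  is_derive x (1 : R) g b ->
  is_derive x (1 : R) (fun z => f z * g z) (a * g x + f x * b).
Proof.
move=> fa gb; apply: is_derive_eq; rewrite /GRing.scale/=; ring.
Qed.

Lemma is_derive_compf f g x a b : is_derive (g x) (1 : R) f a ->
  is_derive x (1 : R) g b -> is_derive x (1 : R) (fun z => f (g z)) (a * b).
Proof. by move=> fa gb; exact: is_derive1_comp. Qed.

Lemma is_derive_cstf x c : is_derive x (1 : R) (fun=> c) 0.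
Proof. exact: is_derive_cst. Qed.

Lemma is_derive_idf x : is_derive x (1 : R) (fun z => z) 1.
Proof. exact: is_derive_id. Qed.

Lemma is_derive_continuous f x a : is_derive x (1 : R) f a ->
  {for x, continuous f}.
Proof.
by move=> [df _]; apply: differentiable_continuous; exact/derivable1_diffP.
Qed.

Lemma mean_value f (df : R -> R) a b x y :
  (forall z, a < z < b -> is_derive z (1 : R) f (df z)) ->
  a < x -> x <= y -> y < b ->
  exists2 c, x <= c <= y & f y - f x = df c * (y - x).
Proof.
move=> fdf ax xy yb.
have [z||c] := @MVT_segment R f df x y xy.
- rewrite in_itv/= => /andP[xz zy]; apply: fdf.
  by rewrite (lt_trans ax xz) (lt_trans zy yb).
- apply: continuous_in_subspaceT => z; rewrite inE/= in_itv/= => /andP[xz zy].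
  apply: (@is_derive_continuous _ _ (df z)); apply: fdf.
  by rewrite (lt_le_trans ax xz) (le_lt_trans zy yb).
- by rewrite in_itv/= => xcy E; exists c.
Qed.

Lemma is_derive_ge0_homo f (df : R -> R) a b x y :
  (forall z, a < z < b -> is_derive z (1 : R) f (df z)) ->
  (forall z, a < z < b -> 0 <= df z) ->
  a < x -> x <= y -> y < b -> f x <= f y.
Proof.
move=> fdf df0 ax xy yb; have [c /andP[xc cy] E] := mean_value fdf ax xy yb.
rewrite -subr_ge0 E mulr_ge0 ?subr_ge0// df0//.
by rewrite (lt_le_trans ax xc) (le_lt_trans cy yb).
Qed.

Lemma powRN_cvg_pinfty a : 0 < a -> x `^ (- a) @[x --> +oo] --> (0 : R).
Proof.
move=> a0; apply/cvgrPdist_lt => e e0; near=> x.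
have x0 : 0 < x by near: x; exact: nbhs_pinfty_gt.
rewrite sub0r normrN ger0_norm ?powR_ge0// /powR gt_eqF//.
rewrite -[ltRHS]lnK ?posrE// ltr_expR mulNr ltrNl -ltr_pdivrMl//.
rewrite -(expRK (_ * _)) ltr_ln ?posrE ?expR_gt0//.
Unshelve. all: by end_near. Qed.

(* Extending every function by a constant to ]-oo, 0] turns the one-sided
   derivatives of [deriv_pos] at 0 into ordinary ones. *)
Lemma is_derive_glue f (df : R -> R) c :
  (forall x, x <= 0 -> f x = c) ->
  (forall x, 0 < x -> is_derive x (1 : R) f (df x)) ->
  f x @[x --> 0^'+] --> c -> df x @[x --> 0^'+] --> (0 : R) ->
  is_derive (0 : R) (1 : R) f 0.
Proof.
move=> f0 fdf fc df0; apply: quotient_is_derive; apply/cvgrPdist_lt => e e0.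
have [d d0 dfd] : exists2 d, 0 < d & forall x, 0 < x < d -> `|df x| < e.
  move/cvgrPdist_lt: df0 => /(_ e e0)[d /= d0 dfd]; exists d => // x /andP[x0 xd].
  have := dfd x; rewrite /= !sub0r !normrN gtr0_norm// => h; exact: h.
near=> y; have yd : `|y| < d.
  near: y; apply: nbhs_dnbhs.
  have := @cvg_id _ (nbhs (0 : R)) => /cvgrPdist_lt/(_ d d0).
  by apply: filterS => z; rewrite sub0r normrN.
have y0 : y != 0 by near: y; exact: nbhs_dnbhs_neq.
rewrite sub0r normrN subr0 (f0 0 (lexx _)).
case: (ltgtP y 0) y0 => // [yn|yp] _; first by rewrite f0 ?ltW// subrr mul0r normr0.
have [z||z] := @MVT R f df 0 y yp.
- by rewrite in_itv/= => /andP[z0 _]; exact: fdf.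
- apply/continuous_within_itvP => //; split.
  + move=> z; rewrite in_itv/= => /andP[z0 _].
    exact: (is_derive_continuous (fdf z z0)).
  + by rewrite (f0 0 (lexx _)).
  + apply: cvg_at_left_filter; exact: (is_derive_continuous (fdf y yp)).
- rewrite in_itv/= (f0 0 (lexx _)) subr0 => /andP[z0 zy] ->.
  rewrite mulfK ?gt_eqF// dfd// z0 (lt_trans zy)//.
  by rewrite (le_lt_trans _ yd)// ler_norm.
Unshelve. all: by end_near. Qed.

(** The relative filter is coarser than [x^'+], hence proper, so the relative limit is unique and
    equals the ordinary derivative. *)
Lemma deriv_pos_is_derive f x a : 0 <= x -> is_derive x (1 : R) f a ->
  derivable_on `[0, +oo[ f x /\ deriv_pos f x = a.
Proof.
move=> x0 /is_derive_quotient fa.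
have PF : ProperFilter (within `[0, +oo[%classic x^').
  have : x^'+ `=>` within `[0, +oo[%classic x^'.
    move=> A xA; have {}xA : \forall y \near x, y != x -> y \in `[0, +oo[ -> A y by [].
    rewrite /at_right /within/=; apply: filterS xA => y yA xy; apply: yA.
      by rewrite gt_eqF.
    by rewrite in_itv/= andbT (le_trans x0)// ltW.
  by move=> sub; apply: Build_ProperFilter => /sub /filter_ex[].
have fa' : (f y - f x) / (y - x) @[y --> within `[0, +oo[%classic x^'] --> a.
  apply: cvg_trans fa => A /=; rewrite !near_simpl => fA.
  by apply: cvg_within; exact: fA.
split; first by apply/cvg_ex; exists a.
exact: cvg_lim.
Qed.

End PointwiseDerivatives.

(** * Inversion of the quantile function and the Pareto tail *)

Section QuantileInverse.
Context {R : realType}.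
Variables (sel act : R -> R) (al1 r theta g : R) (F w b L : R -> R).
Hypotheses (al1_gt0 : 0 < al1) (theta_gt0 : 0 < theta) (theta_lt1 : theta < 1).
Implicit Types p q s t x z : R.
Hypothesis prof : profile sel act al1 r theta g F w b L.

Let g_gt0 : 0 < g. Proof. by case/andP: (prof_growth prof). Qed.

Let F_gt0 p : 0 < p < 1 -> 0 < F p.
Proof.
move=> p01; apply: lt_le_trans (prof_F_ge prof p01).
by case/andP: p01 => p0 _; rewrite mulr_gt0// divr_gt0.
Qed.

Let dln1B p : 0 < p < 1 -> is_derive p (1 : R) (fun z => ln (1 - z)) (- (1 - p)^-1).
Proof.
move=> /andP[p0 p1]; apply: (@is_derive_eq _ _ _ _ _ _ _ ((1 - p)^-1 * (0 - 1))).
  have p1' : 0 < 1 - p by rewrite subr_gt0.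
  exact: (@is_derive_compf R (@ln R) (fun z => 1 - z) p _ _ (is_derive1_ln p1')
    (is_derive_subf (is_derive_cstf p 1) (is_derive_idf p))).
by rewrite sub0r mulrN1.
Qed.

(** The logarithm of (1 - p) x^(1/theta), with [L p] as ln x. *)
Let psi p := ln (1 - p) + L p * theta^-1.

(** With the exponent 1/theta the numerator vanishes at p = 1, where [F] tends to [g / theta]; this
    cancels the singular factor 1 - p. *)
Lemma tail_exponent_derive p : 0 < p < 1 ->
  is_derive p (1 : R) psi ((g / theta - F p) / ((1 - p) * F p)).
Proof.
move=> p01; have [p0 p1] := andP p01; have Fp := F_gt0 p01.
have := is_derive_addf (dln1B p01)
  (is_derive_mulf (prof_dL prof p01) (is_derive_cstf p theta^-1)).
move/is_derive_eq; apply.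
by field; rewrite !gt_eqF// subr_gt0.
Qed.

Lemma tail_exponent_homo p q : 0 < p -> p <= q -> q < 1 -> psi p <= psi q.
Proof.
apply: (is_derive_ge0_homo tail_exponent_derive) => z z01.
have /andP[h _] := prof_F_end prof z01; have Fz := F_gt0 z01.
apply: divr_ge0 => //; apply: mulr_ge0; last exact: ltW.
by rewrite subr_ge0 ltW//; case/andP: z01.
Qed.

Let h01 : 0 < (2^-1 : R) < 1. Proof. by rewrite invr_gt0 ltr0n invf_lt1// ltr1n. Qed.

(** Beyond 1/2 the numerator of the derivative is at most [al1 * (1 - c)] and [F c] is at least half
    of [g / theta]; the constant is the resulting bound on the slope. *)
Lemma tail_exponent_bounded p : 0 < p < 1 ->
  psi p <= psi 2^-1 + 2 * theta * al1 / g.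
Proof.
move=> /andP[p0 p1]; have [h0 h1] := andP h01.
have K0 : 0 <= 2 * theta * al1 / g.
  by rewrite divr_ge0 ?(ltW g_gt0)// !mulr_ge0 ?(ltW theta_gt0) ?(ltW al1_gt0).
have [ph|hp] := leP p 2^-1.
  by apply: (le_trans (tail_exponent_homo p0 ph h1)); rewrite lerDl.
have [c /andP[hc cp] E] := mean_value tail_exponent_derive h0 (ltW hp) p1.
have c0 : 0 < c := lt_le_trans h0 hc; have c1 : c < 1 := le_lt_trans cp p1.
have c01 : 0 < c < 1 by rewrite c0.
rewrite addrC -lerBlDr E -[leRHS]mulr1; have Fc := F_gt0 c01.
have /andP[e0 e1] := prof_F_end prof c01.
apply: ler_pM => //.
- by apply: divr_ge0 => //; apply: mulr_ge0; [rewrite subr_ge0 ltW|exact: ltW].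
- by rewrite subr_ge0 ltW.
- have := prof_F_ge prof c01; rewrite ler_pdivrMr ?mulr_gt0 ?subr_gt0// => h.
  apply: (le_trans e1); have : 2^-1 * (g / theta) <= F c.
    by apply: le_trans h; rewrite ler_pM2r// divr_gt0.
  rewrite -subr_ge0 => h2.
  rewrite -subr_ge0 (_ : _ - _ = 2 * theta * al1 / g * (1 - c) * (F c - 2^-1 * (g / theta))).
    by apply: mulr_ge0 => //; apply: mulr_ge0 => //; rewrite subr_ge0 ltW.
  by field; rewrite !gt_eqF.
- by lra.
Qed.

Lemma log_size_homo p q : 0 < p -> p < q -> q < 1 -> L p < L q.
Proof.
move=> p0 pq q1.
have [c /andP[pc cq] E] := mean_value (prof_dL prof) p0 (ltW pq) q1.
have c01 : 0 < c < 1 by rewrite (lt_le_trans p0 pc) (le_lt_trans cq q1).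
rewrite -subr_gt0 E mulr_gt0 ?subr_gt0// divr_gt0// mulr_gt0 ?F_gt0// subr_gt0.
by case/andP: c01.
Qed.

(** [L] is unbounded at both ends: near 1 because [psi] is nondecreasing while ln (1 - p) tends to
    minus infinity, near 0 because [F p <= al1 * p] makes [L - (g / al1) ln] nondecreasing. *)
Lemma log_size_surj t : exists p, 0 < p < 1 /\ L p = t.
Proof.
have [h0 h1] := andP h01.
have [q q01 qt] : exists2 q, 2^-1 <= q < 1 & t <= L q.
  pose q := Num.max 2^-1 (1 - expR (psi 2^-1 - t / theta)).
  have q1 : q < 1 by rewrite gt_max h1 ltrBlDr ltrDl expR_gt0.
  have hq : 2^-1 <= q by rewrite le_max lexx.
  exists q; first by rewrite hq q1.
  have := tail_exponent_homo h0 hq q1.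
  have lq : ln (1 - q) <= psi 2^-1 - t / theta.
    rewrite -[leRHS]expRK ler_ln ?posrE ?expR_gt0 ?subr_gt0//.
    by rewrite lerBlDr addrC -lerBlDr /q le_max lexx orbT.
  rewrite {2}/psi => h.
  have : t * theta^-1 <= L q * theta^-1 by lra.
  by rewrite ler_pM2r// invr_gt0.
have [p p01 pt] : exists2 p, 0 < p <= 2^-1 & L p <= t.
  pose om z := L z - (g / al1) * ln z.
  have dom (z : R) : 0 < z < 1 -> is_derive z (1 : R) om
      (g / ((1 - z) * F z) - (0 * ln z + (g / al1) * z^-1)).
    move=> z01; have z0 : 0 < z by case/andP: z01.
    exact: (is_derive_subf (prof_dL prof z01)
      (is_derive_mulf (is_derive_cstf z (g / al1)) (is_derive1_ln z0))).
  have hom z : 0 < z < 1 -> 0 <= g / ((1 - z) * F z) - (0 * ln z + (g / al1) * z^-1).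
    move=> z01; have [z0 z1] := andP z01; have Fz := F_gt0 z01.
    rewrite mul0r add0r subr_ge0 -mulrA -invfM ler_pM2l//.
    have z1' : 0 < 1 - z by rewrite subr_gt0.
    rewrite lef_pV2 ?posrE ?mulr_gt0//.
    rewrite -[leRHS]mul1r; apply: ler_pM; [exact: ltW|exact: ltW|lra|].
    exact: (prof_F_le prof z01).
  pose p := Num.min 2^-1 (expR ((t - om 2^-1) / (g / al1))).
  have p0 : 0 < p by rewrite lt_min h0 expR_gt0.
  have ph : p <= 2^-1 by rewrite ge_min lexx.
  exists p; first by rewrite p0.
  have := is_derive_ge0_homo dom hom p0 ph h1.
  have ga0 : 0 < g / al1 by rewrite divr_gt0.
  have lp : (g / al1) * ln p <= t - om 2^-1.
    rewrite -ler_pdivlMl// mulrC -[leRHS]expRK ler_ln ?posrE ?expR_gt0//.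
    by rewrite ge_min lexx orbT.
  rewrite {1}/om; lra.
have [q0 q1] := andP q01; have [p0 ph] := andP p01.
have pq : p <= q := le_trans ph q0.
have [||z] := @IVT R L p q t pq.
- apply: continuous_in_subspaceT => z; rewrite inE/= in_itv/= => /andP[pz zq].
  apply: (is_derive_continuous (prof_dL prof (x := z) _)).
  by rewrite (lt_le_trans p0 pz) (le_lt_trans zq q1).
- by rewrite ge_min pt le_max qt orbT.
- rewrite in_itv/= => /andP[pz zq] Lz; exists z; split=> //.
  by rewrite (lt_le_trans p0 pz) (le_lt_trans zq q1).
Qed.

(** Near 0, p is at most a constant times x^(1/theta). As 1/theta > 1, the distribution function
    will be o(x) at 0. *)
Lemma head_exponent_le p : 0 < p -> p <= 2^-1 ->
  ln p <= L p * theta^-1 + (ln 2^-1 - psi 2^-1).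
Proof.
move=> p0 ph; have [_ h1] := andP h01.
pose chi z := ln z - psi z.
have dchi (z : R) : 0 < z < 1 -> is_derive z (1 : R) chi
    (z^-1 - (g / theta - F z) / ((1 - z) * F z)).
  move=> z01; have z0 : 0 < z by case/andP: z01.
  exact: (is_derive_subf (is_derive1_ln z0) (tail_exponent_derive z01)).
have hchi z : 0 < z < 1 -> 0 <= z^-1 - (g / theta - F z) / ((1 - z) * F z).
  move=> z01; have [z0 z1] := andP z01; have Fz := F_gt0 z01.
  have z1' : 0 < 1 - z by rewrite subr_gt0.
  rewrite (_ : _ - _ = (F z - z * (g / theta)) / (z * (1 - z) * F z)).
    apply: divr_ge0; first by rewrite subr_ge0; exact: (prof_F_ge prof z01).
    by rewrite !mulr_ge0// ltW.
  by field; rewrite !gt_eqF.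
have := is_derive_ge0_homo dchi hchi p0 ph h1.
have lp : ln (1 - p) <= 0.
  rewrite -ln1 ler_ln ?posrE ?subr_gt0 ?(le_lt_trans ph h1)// lerBlDr lerDl ltW//.
rewrite /chi {1}/psi; lra.
Qed.

Lemma exists_size_distribution (k : R) : 0 < k -> exists Phi : R -> R,
  [/\ forall x, x <= 0 -> Phi x = 0,
      forall x, 0 < x -> 0 < Phi x < 1,
      forall x, 0 < x -> is_derive x (1 : R) Phi
        ((1 - Phi x) * F (Phi x) / (g * x)),
      Phi x / x @[x --> 0^'+] --> (0 : R)
    & (1 - Phi x) / x `^ (- theta^-1) @[x --> +oo] --> k].
Proof.
move=> k0; have [h0 h1] := andP h01.
pose A := [set psi p | p in [set p | 0 < p < 1]].
have ubA : has_ubound A.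
  exists (psi 2^-1 + 2 * theta * al1 / g) => _ [p p01 <-].
  exact: tail_exponent_bounded.
have supA : has_sup A by split=> //; exists (psi 2^-1), 2^-1.
(* [sup A] is the limit of the nondecreasing [psi] at 1. Shifting ln x by [c] multiplies the limit
   of the tail ratio by exp (c / theta), and this [c] makes it [k]. *)
pose c := theta * (ln k - sup A).
have [P PE] := choice log_size_surj.
have P01 t : 0 < P t < 1 by case: (PE t).
have LP t : L (P t) = t by case: (PE t).
have PL p : 0 < p < 1 -> P (L p) = p.
  move=> /andP[p0 p1]; have /andP[q0 q1] := P01 (L p).
  have := LP (L p); case: (ltgtP (P (L p)) p) => // pq.
    by have := log_size_homo q0 pq p1; rewrite lt_neqAle => /andP[/eqP].
  by have := log_size_homo p0 pq q1; rewrite lt_neqAle => /andP[/eqP h _ /esym].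
have dP (t : R) : is_derive t (1 : R) P ((1 - P t) * F (P t) / g).
  rewrite -{1}(LP t); set p := P t; have p01 : 0 < p < 1 := P01 t.
  have np : \forall z \near p, 0 < z < 1.
    apply: filterS (near_in_itvoo (_ : p \in `]0, 1[)); last by rewrite in_itv.
    by move=> z; rewrite in_itv.
  rewrite (_ : _ / g = (g / ((1 - p) * F p))^-1).
    apply: is_derive_inverse.
    - by apply: filterS np => z; exact: PL.
    - by apply: filterS np => z z01; exact: (is_derive_continuous (prof_dL prof z01)).
    - exact: (prof_dL prof p01).
    - rewrite gt_eqF// divr_gt0// mulr_gt0 ?F_gt0// subr_gt0.
      by case/andP: p01.
  by rewrite invf_div.
have Phomo s t : s <= t -> P s <= P t.
  rewrite leNgt => /negP st; rewrite leNgt; apply/negP => ts; apply: st.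
  rewrite -(LP s) -(LP t).
  by apply: log_size_homo => //; [case/andP: (P01 t)|case/andP: (P01 s)].
pose Phi x := if x <= 0 then 0 else P (ln x - c).
have PhiE x : 0 < x -> Phi x = P (ln x - c) by move=> x0; rewrite /Phi leNgt x0.
exists Phi; split.
- by move=> x x0; rewrite /Phi x0.
- by move=> x x0; rewrite PhiE.
- move=> x x0; rewrite PhiE//.
  apply: (@near_eq_is_derive _ _ _ (fun x => P (ln x - c))).
  + have := lt_nbhsr x0; apply: filterS => z z0.
    by rewrite PhiE.
  + have := @is_derive_compf R P (fun z => ln z - c) x _ _ (dP _)
      (is_derive_subf (is_derive1_ln x0) (is_derive_cstf x c)).
    move/is_derive_eq; apply; rewrite subr0.
    by field; rewrite !gt_eqF.
(* The constant of [head_exponent_le] after the shift, so that [Phi x <= K * x^(1/theta)] near 0. *)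
- pose K := expR (ln 2^-1 - psi 2^-1 - c / theta).
  apply: (@squeeze_cvgr _ _ _ _ (fun=> 0) (fun x => K * x `^ (theta^-1 - 1))).
  + near=> x.
    have x0 : 0 < x by near: x; exact: nbhs_right_gt.
    have xs : x < expR (L 2^-1 + c).
      by near: x; apply: nbhs_right_lt; exact: expR_gt0.
    have xl : ln x - c <= L 2^-1.
      by rewrite lerBlDr -[leRHS]expRK ler_ln ?posrE ?expR_gt0// ltW.
    have ph : P (ln x - c) <= 2^-1 by rewrite -[leRHS]PL//; exact: Phomo.
    have /andP[p0 p1] := P01 (ln x - c).
    rewrite PhiE// divr_ge0 ?(ltW p0) ?(ltW x0)//=.
    rewrite ler_pdivrMr// -mulrA -{3}[x]powRr1 ?(ltW x0)// -powRD ?subrK; last first.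
      by apply/implyP => _; rewrite gt_eqF.
    rewrite -[leLHS]lnK ?posrE// /powR gt_eqF// /K -expRD ler_expR.
    have := head_exponent_le p0 ph; rewrite LP => h.
    by apply: (le_trans h); rewrite mulrBl mulrC; lra.
  + exact: cvg_cst.
  + rewrite -[X in _ --> X](mulr0 K); apply: cvgMr; apply: powR_cvg0.
    by rewrite subr_gt0 invf_gt1.
- have kE : k = expR (sup A + c / theta).
    by rewrite /c mulrAC mulfV ?gt_eqF// mul1r addrC subrK lnK.
  have tE x : 0 < x ->
      (1 - Phi x) / x `^ (- theta^-1) = expR (psi (P (ln x - c)) + c / theta).
    move=> x0; have /andP[p0 p1] := P01 (ln x - c).
    rewrite PhiE// -powRN opprK /psi LP -[X in X * _]lnK ?posrE ?subr_gt0//.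
    rewrite /powR gt_eqF// -expRD; congr (expR _).
    by rewrite mulrBl; ring.
  rewrite kE; apply: (@cvg_trans _ (expR (psi (P (ln x - c)) + c / theta) @[x --> +oo])).
    apply: near_eq_cvg; near=> x; rewrite tE//; near: x; exact: nbhs_pinfty_gt.
  suff cc : psi (P (ln x - c)) @[x --> +oo] --> sup A.
    apply: (@cvg_comp _ _ _ (fun x => psi (P (ln x - c)) + c / theta) expR);
      last exact: continuous_expR.
    by apply: cvgD; [exact: cc|exact: cvg_cst].
  apply/cvgrPdist_lt => e e0.
  have [_ [p /= p01 <-] pe] := sup_adherent e0 supA.
  near=> x.
  have x0 : 0 < x by near: x; exact: nbhs_pinfty_gt.
  have xp : expR (L p + c) < x by near: x; apply: nbhs_pinfty_gt; exact: num_real.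
  have pP : p <= P (ln x - c).
    rewrite -[leLHS]PL//; apply: Phomo.
    by rewrite lerBrDr -[leLHS]expRK ler_ln ?posrE ?expR_gt0// ltW.
  have /andP[q0 q1] := P01 (ln x - c).
  have : psi p <= psi (P (ln x - c)).
    by apply: tail_exponent_homo => //; case/andP: p01.
  have : psi (P (ln x - c)) <= sup A.
    by apply: ub_le_sup => //; exists (P (ln x - c)) => //=; exact: P01.
  by move=> s1 s2; rewrite ger0_norm ?subr_ge0//; lra.
Unshelve. all: by end_near. Qed.

End QuantileInverse.

(** * Value function and verification *)

Section Extension.
Context {R : realType}.
Implicit Types (f g h d : R -> R) (x y z c : R).

Lemma cvg_nbhs_dnbhs f x c : f z @[z --> x] --> c -> f z @[z --> x^'] --> c.
Proof. by move=> fc A Ac; apply: nbhs_dnbhs; exact: fc. Qed.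

Lemma near_pos_eq h c x : 0 < x ->
  \forall z \near x, h z = (if z <= 0 then c else h z).
Proof. by move=> x0; have := lt_nbhsr x0; apply: filterS => z; rewrite leNgt => ->. Qed.

Lemma near_neg_eq h c x : x < 0 ->
  \forall z \near x, c = (if z <= 0 then c else h z).
Proof. by move=> x0; have := lt_nbhsl x0; apply: filterS => z /ltW ->. Qed.

Lemma continuous_extend h c : (forall x, 0 < x -> {for x, continuous h}) ->
  h x @[x --> 0^'+] --> c -> continuous (fun z => if z <= 0 then c else h z).
Proof.
move=> ch hc x; have [x0|x0|->] := ltgtP x 0.
- rewrite /continuous_at (ltW x0).
  by apply: cvg_near_cst; have := near_neg_eq h c x0; apply: filterS => z <-.
- rewrite /continuous_at leNgt x0/=.
  apply: (@cvg_trans _ (h z @[z --> x])); last exact: ch.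
  by apply: near_eq_cvg; exact: near_pos_eq.
- apply/left_right_continuousP; rewrite /= lexx; split.
  + apply: cvg_near_cst; near=> z.
    by rewrite ltW//; near: z; exact: nbhs_left_lt.
  + apply: (@cvg_trans _ (h z @[z --> 0^'+])); last exact: hc.
    apply: near_eq_cvg; near=> z.
    by rewrite leNgt ifN// negbK; near: z; exact: nbhs_right_gt.
Unshelve. all: by end_near. Qed.

Lemma is_derive_extend h d c : (forall x, 0 < x -> is_derive x (1 : R) h (d x)) ->
  h x @[x --> 0^'+] --> c -> d x @[x --> 0^'+] --> (0 : R) ->
  forall x, is_derive x (1 : R) (fun z => if z <= 0 then c else h z)
    (if x <= 0 then 0 else d x).
Proof.
move=> hd hc d0 x.
have pos y : 0 < y -> is_derive y (1 : R) (fun z => if z <= 0 then c else h z) (d y).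
  move=> y0; apply: near_eq_is_derive (near_pos_eq h c y0) _; exact: hd.
have [x0|x0|->] := ltgtP x 0; [|exact: pos|].
- by apply: near_eq_is_derive (near_neg_eq h c x0) _; exact: is_derive_cstf.
- apply: (is_derive_glue (c := c) _ pos) => //; first by move=> z ->.
  apply: (@cvg_trans _ (h z @[z --> 0^'+])); last exact: hc.
  apply: near_eq_cvg; near=> z.
  by rewrite leNgt ifN// negbK; near: z; exact: nbhs_right_gt.
Unshelve. all: by end_near. Qed.

Lemma Rintegral_FTC f g x : 0 <= x -> continuous f ->
  (forall y, is_derive y (1 : R) g (f y)) ->
  Rintegral (@lebesgue_measure R) `[0, x] f = g x - g 0.
Proof.
move=> + cf df; rewrite le_eqVlt => /predU1P[<-|x0].
  by rewrite set_itv1 Rintegral_set1 subrr.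
rewrite /Rintegral (@continuous_FTC2 _ f g 0 x x0)//.
- by apply: continuous_subspaceT.
- split.
  + by move=> y _; exact: (@ex_derive _ _ _ _ _ _ _ (df y)).
  + exact/cvg_at_right_filter/(is_derive_continuous (df 0)).
  + exact/cvg_at_left_filter/(is_derive_continuous (df x)).
- by move=> y _; rewrite derive1E; exact: (@derive_val _ _ _ _ _ _ _ (df y)).
Qed.

(** Nonnegativity makes integrability a by-product of the finite value of the integral. *)
Lemma Rintegral_FTCy f g x l : continuous f ->
  (forall y, is_derive y (1 : R) g (f y)) -> (forall y, x <= y -> 0 <= f y) ->
  g y @[y --> +oo] --> l ->
  (@lebesgue_measure R).-integrable `[x, +oo[ (EFin \o f) /\
  Rintegral (@lebesgue_measure R) `[x, +oo[ f = l - g x.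
Proof.
move=> cf df f0 gl.
have E : (\int[@lebesgue_measure R]_(y in `[x, +oo[) (f y)%:E = l%:E - (g x)%:E)%E.
  apply: ge0_continuous_FTC2y => //.
  - exact: continuous_subspaceT.
  - exact/cvg_at_right_filter/(is_derive_continuous (df x)).
  - by move=> y _; rewrite derive1E; exact: (@derive_val _ _ _ _ _ _ _ (df y)).
split; last by rewrite /Rintegral E.
apply/integrableP; split.
  apply/measurable_EFinP; apply: measurable_funS (continuous_measurable_fun cf) => //.
have -> : (\int[@lebesgue_measure R]_(y in `[x, +oo[) `|(EFin \o f) y| =
    \int[@lebesgue_measure R]_(y in `[x, +oo[) (f y)%:E)%E.
  apply: eq_integral => y; rewrite inE/= in_itv/= andbT => xy.
  by rewrite ger0_norm// f0.
by rewrite E -EFinB ltry.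
Qed.

Lemma eq_Rintegral_itv (i : interval R) f g : {in i, f =1 g} ->
  Rintegral (@lebesgue_measure R) [set` i] f
  = Rintegral (@lebesgue_measure R) [set` i] g.
Proof. by move=> fg; apply: eq_Rintegral => x; rewrite inE; exact: fg. Qed.

(** An envelope theorem for controls that are merely continuous. Using the control of [q] at [z]
    bounds the increment from below, and using that of [z] at [q] bounds it from above; after
    division by the step the two differ by a quantity that vanishes by continuity. *)
Lemma envelope (S a B : R -> R) (q e : R) : 0 < q ->
  (forall y z, 0 < y -> 0 < z ->
    (1 - S y) * z + a y * B z <= (1 - S z) * z + a z * B z) ->
  {for q, continuous S} -> {for q, continuous a} -> is_derive q (1 : R) B e ->
  is_derive q (1 : R) (fun z => (1 - S z) * z + a z * B z) ((1 - S q) + a q * e).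
Proof.
move=> q0 opt cS ca /is_derive1_caratheodory[g [gE cg <-]].
pose T z := (1 - S q) + a q * g z.
pose h z := (1 - S z) * z + a z * B z.
pose E z := `|S q - S z| + `|a z - a q| * `|g z|.
apply: quotient_is_derive; rewrite -/(h q).
have cT : T z @[z --> q^'] --> (1 - S q) + a q * g q.
  by apply: cvg_nbhs_dnbhs; apply: cvgD; [exact: cvg_cst|apply: cvgMr; exact: cg].
have cE : E z @[z --> q^'] --> (0 : R).
  have -> : (0 : R) = `|S q - S q| + `|a q - a q| * `|g q|.
    by rewrite !subrr normr0 mul0r addr0.
  apply: cvg_nbhs_dnbhs; apply: cvgD.
    by apply: cvg_norm; apply: cvgB; [exact: cvg_cst|exact: cS].
  apply: cvgM; last by apply: cvg_norm; exact: cg.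
  by apply: cvg_norm; apply: cvgB; [exact: ca|exact: cvg_cst].
have sq : \forall z \near q^', - E z <= (h z - h q) / (z - q) - T z <= E z.
  near=> z.
  have z0 : 0 < z by near: z; apply: nbhs_dnbhs; exact: lt_nbhsr.
  have zq : z - q != 0 by rewrite subr_eq0; near: z; exact: nbhs_dnbhs_neq.
  have l1 := opt q z q0 z0; have l2 := opt z q z0 q0.
  have BE := gE z.
  rewrite -ler_norml -[X in `|X|](mulfK zq) normrM normrV ?unitfE//.
  rewrite ler_pdivrMr ?normr_gt0// mulrBl divfK//.
  have TE : T z * (z - q) = (1 - S q) * (z - q) + a q * (B z - B q).
    by rewrite /T BE; ring.
  have N0 : 0 <= h z - h q - T z * (z - q) by rewrite TE /h; lra.
  rewrite ger0_norm//.
  have : h z - h q - T z * (z - q) <=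
      (S q - S z) * (z - q) + (a z - a q) * g z * (z - q).
    by rewrite TE -mulrA -BE /h; lra.
  move/le_trans; apply; rewrite /E [leRHS]mulrDl lerD//.
    by rewrite -normrM ler_norm.
  by rewrite -!normrM ler_norm.
have cNE : - E z @[z --> q^'] --> (0 : R).
  by rewrite -[X in _ --> X]oppr0; exact: cvgN.
have cD : (h z - h q) / (z - q) - T z @[z --> q^'] --> (0 : R).
  exact: (squeeze_cvgr sq cNE cE).
have : ((h z - h q) / (z - q) - T z) + T z @[z --> q^'] --> 0 + ((1 - S q) + a q * g q).
  exact: cvgD.
rewrite add0r; apply: cvg_trans; apply: near_eq_cvg; near=> z.
by rewrite subrK.
Unshelve. all: by end_near. Qed.

End Extension.

(** * Verification of the balanced growth path system *)

Section Assembly.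
Context {R : realType}.
Variables (alpha : R -> R) (r theta : R).
Hypothesis H : learning_function alpha.
Hypotheses (r_gt0 : 0 < r) (theta_gt0 : 0 < theta) (theta_lt1 : theta < 1).
Hypothesis r_gt : theta * alpha 1 < r.
Variables (g : R) (F w b L : R -> R).
Hypothesis prof : profile (share alpha) (fun c => alpha (share alpha c))
  (alpha 1) r theta g F w b L.
Variables (Phi : R -> R) (k : R).
Hypothesis Phi_le0 : forall x, x <= 0 -> Phi x = 0.
Hypothesis Phi_itv : forall x, 0 < x -> 0 < Phi x < 1.
Hypothesis dPhi_gt0 : forall x : R, 0 < x ->
  is_derive x (1 : R) Phi ((1 - Phi x) * F (Phi x) / (g * x)).
Hypothesis Phi_x : Phi x / x @[x --> 0^'+] --> (0 : R).
Hypothesis Phi_tail : (1 - Phi x) / x `^ (- theta^-1) @[x --> +oo] --> k.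
Implicit Types x y z s : R.
Local Notation A1 := (alpha 1).

Let g_gt0 : 0 < g. Proof. by case/andP: (prof_growth prof). Qed.

(** Here the assumption on [r] enters: the effective discount rate [r - g] is positive. *)
Let g_lt : g < r.
Proof. by case/andP: (prof_growth prof) => _ /le_lt_trans; apply. Qed.

Let A1_gt0 : 0 < A1.
Proof. by rewrite -(learning_at0 H); apply: (alpha_lt H). Qed.

Let F_gt0 x : 0 < x -> 0 < F (Phi x).
Proof.
move=> x0; apply: lt_le_trans (prof_F_ge prof (Phi_itv x0)).
by have /andP[p0 _] := Phi_itv x0; rewrite mulr_gt0// divr_gt0.
Qed.

Let near0 (P : R -> Prop) : (forall x, 0 < x -> P x) -> \forall x \near 0^'+, P x.
Proof.
by move=> PP; near=> x; apply: PP; near: x; exact: nbhs_right_gt.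
Unshelve. all: by end_near. Qed.

Let squeeze0 (f h : R -> R) : (forall x, 0 < x -> 0 <= f x <= h x) ->
  h x @[x --> 0^'+] --> (0 : R) -> f x @[x --> 0^'+] --> (0 : R).
Proof.
move=> fh; apply: (@squeeze_cvgr _ _ _ _ (fun=> 0)); last exact: cvg_cst.
exact: near0.
Qed.

Let cvg_id0 : x @[x --> (0 : R)^'+] --> (0 : R).
Proof. exact/cvg_at_right_filter/cvg_id. Qed.

Lemma Phi_cvg0 : Phi x @[x --> 0^'+] --> (0 : R).
Proof.
have h : Phi x / x * x @[x --> 0^'+] --> (0 : R).
  by rewrite -[X in _ --> X](mulr0 0); exact: cvgM.
apply: cvg_trans h; apply: near_eq_cvg; apply: near0 => x x0.
by rewrite divfK// gt_eqF.
Qed.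

Definition density x := if x <= 0 then 0 else (1 - Phi x) * F (Phi x) / (g * x).

Let density_pos x : 0 < x -> density x = (1 - Phi x) * F (Phi x) / (g * x).
Proof. by rewrite /density leNgt => ->. Qed.

Lemma density_ge0 x : 0 <= density x.
Proof.
have [x0|x0] := leP x 0; first by rewrite /density x0.
rewrite density_pos//; have /andP[p0 p1] := Phi_itv x0; have Fx := F_gt0 x0.
by apply: divr_ge0; apply: mulr_ge0; rewrite ?subr_ge0// ltW.
Qed.

Lemma density_cvg0 : density x @[x --> 0^'+] --> (0 : R).
Proof.
apply: (@squeeze0 _ (fun x => A1 / g * (Phi x / x))).
  move=> x x0; rewrite density_ge0/= density_pos//.
  have /andP[p0 p1] := Phi_itv x0; have Fx := F_gt0 x0.
  have Fle := prof_F_le prof (Phi_itv x0).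
  have -> : A1 / g * (Phi x / x) = 1 * (A1 * Phi x) / (g * x).
    by field; rewrite !gt_eqF.
  rewrite ler_pM2r ?invr_gt0 ?mulr_gt0//.
  apply: ler_pM => //; [by rewrite subr_ge0 ltW|exact: ltW|lra].
by rewrite -[X in _ --> X](mulr0 (A1 / g)); apply: cvgMr.
Qed.

Let PhiE : Phi = (fun z => if z <= 0 then 0 else Phi z).
Proof. by apply/funext => z; case: ifPn => // z0; rewrite Phi_le0. Qed.

Lemma is_derive_Phi x : is_derive x (1 : R) Phi (density x).
Proof.
rewrite [X in is_derive _ _ X _]PhiE.
apply: (is_derive_extend dPhi_gt0 Phi_cvg0).
apply: cvg_trans density_cvg0; apply: near_eq_cvg; apply: near0 => z z0.
by rewrite density_pos.
Qed.

(* The derivative of the value function. *)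
Definition marginal x := if x <= 0 then 0 else w (Phi x).

Let marginal_pos x : 0 < x -> marginal x = w (Phi x).
Proof. by rewrite /marginal leNgt => ->. Qed.

Let Bpos x := x * b (Phi x).

Lemma Bpos_gt0 x : 0 < x -> 0 < Bpos x.
Proof. by move=> x0; rewrite mulr_gt0// (prof_b_gt0 prof)// Phi_itv. Qed.

Lemma marginal_bounds x : 0 <= marginal x <= r^-1.
Proof.
have [x0|x0] := leP x 0; first by rewrite /marginal x0 lexx invr_ge0 ltW.
rewrite marginal_pos// (prof_w_ge0 prof (Phi_itv x0))/=.
rewrite -[leRHS]mulr1 ler_pdivlMl//.
apply: (le_trans (prof_w_le prof (Phi_itv x0))).
by rewrite lerBlDr lerDl; case/andP: (share_bounds H (b (Phi x))).
Qed.

Lemma Phi_bounds x : 0 <= Phi x < 1.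
Proof.
have [x0|x0] := leP x 0; first by rewrite Phi_le0// lexx ltr01.
by have /andP[/ltW-> ->] := Phi_itv x0.
Qed.

(** The factor x removes the term b / (1 - p), and what remains is the derivative that integration
    by parts predicts for the gain integral. *)
Lemma is_derive_Bpos x : 0 < x ->
  is_derive x (1 : R) Bpos (- ((1 - Phi x) * marginal x)).
Proof.
move=> x0; have Fx := F_gt0 x0; have /andP[p0 p1] := Phi_itv x0.
have := is_derive_mulf (is_derive_idf x)
  (is_derive_compf (prof_db prof (Phi_itv x0)) (dPhi_gt0 x0)).
move/is_derive_eq; apply; rewrite marginal_pos//.
by field; rewrite !gt_eqF// subr_gt0.
Qed.

Lemma Bpos_antihomo x y : 0 < x -> x <= y -> Bpos y <= Bpos x.
Proof.
move=> x0 xy.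
have dB z : 0 < z < y + 1 -> is_derive z (1 : R) Bpos (- ((1 - Phi z) * marginal z)).
  by move=> /andP[z0 _]; exact: is_derive_Bpos.
have [|c _ E] := mean_value dB x0 xy; first by rewrite ltrDl.
rewrite -subr_le0 E mulr_le0_ge0 ?subr_ge0// oppr_le0.
have /andP[m0 _] := marginal_bounds c; have /andP[_ /ltW p1] := Phi_bounds c.
by rewrite mulr_ge0// subr_ge0.
Qed.

Lemma Bpos_bounded x : 0 < x -> Bpos x <= Bpos 1 + r^-1.
Proof.
move=> x0; have ri : 0 <= r^-1 by rewrite invr_ge0 ltW.
have [x1|x1] := leP 1 x.
  by apply: (le_trans (Bpos_antihomo ltr01 x1)); rewrite lerDl.
have dB z : 0 < z < 2 -> is_derive z (1 : R) Bpos (- ((1 - Phi z) * marginal z)).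
  by move=> /andP[z0 _]; exact: is_derive_Bpos.
have [|c _ E] := mean_value dB x0 (ltW x1); first by lra.
have /andP[m0 m1] := marginal_bounds c; have /andP[p0 /ltW p1] := Phi_bounds c.
have : (1 - Phi c) * marginal c * (1 - x) <= 1 * r^-1 * 1.
  apply: ler_pM; rewrite ?mulr_ge0 ?subr_ge0 ?(ltW x1)//; last by lra.
  by apply: ler_pM => //; rewrite ?subr_ge0//; lra.
rewrite mul1r mulr1; move: E; rewrite mulNr; lra.
Qed.

(** [Bpos] is nonincreasing, so its supremum is its limit at 0; it is finite because the slope never
    exceeds 1 / r in absolute value. *)
Definition gain0 : R := sup (Bpos @` `]0, +oo[).

Lemma Bpos_cvg : Bpos x @[x --> 0^'+] --> gain0.
Proof.
apply: (@nonincreasing_at_right_cvgr _ _ _ (BInfty _ false)) => //.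
- by move=> x y; rewrite !in_itv/= !andbT => x0 y0; exact: Bpos_antihomo.
- exists (Bpos 1 + r^-1) => _ /= [x + <-].
  by rewrite in_itv/= andbT; exact: Bpos_bounded.
Qed.

Lemma Bpos_le_gain0 x : 0 < x -> Bpos x <= gain0.
Proof.
move=> x0; apply: ub_le_sup.
- exists (Bpos 1 + r^-1) => _ /= [z + <-].
  by rewrite in_itv/= andbT; exact: Bpos_bounded.
- by exists x => //=; rewrite in_itv/= andbT.
Qed.

Lemma gain0_gt0 : 0 < gain0.
Proof. exact: lt_le_trans (Bpos_gt0 ltr01) (Bpos_le_gain0 ltr01). Qed.

Definition gainfun x := if x <= 0 then gain0 else Bpos x.

Let gainfun_pos x : 0 < x -> gainfun x = Bpos x.
Proof. by rewrite /gainfun leNgt => ->. Qed.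

Lemma gainfun_gt0 x : 0 < gainfun x.
Proof.
have [x0|x0] := leP x 0; first by rewrite /gainfun x0 gain0_gt0.
by rewrite gainfun_pos// Bpos_gt0.
Qed.

(** The value 1 at x = 0 is both the one prescribed by the selection rule for a positive gain and
    the limit of the share as the ratio of gain to size tends to infinity. *)
Definition policy x := if x <= 0 then 1 else share alpha (b (Phi x)).

Let policy_pos x : 0 < x -> policy x = share alpha (b (Phi x)).
Proof. by rewrite /policy leNgt => ->. Qed.

Let policyE x : 0 < x -> policy x = share alpha (gainfun x / x).
Proof.
move=> x0; rewrite policy_pos// gainfun_pos// /Bpos mulrAC mulfV ?mul1r//.
by rewrite gt_eqF.
Qed.

Lemma policy_bounds x : 0 <= policy x <= 1.
Proof.
have [x0|x0] := leP x 0; first by rewrite /policy x0 ler01 lexx.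
by rewrite policy_pos// share_bounds.
Qed.

Lemma policy_cvg : policy x @[x --> 0^'+] --> (1 : R).
Proof.
apply/cvgrPdist_le => e e0; have [M M0 hM] := share_cvg1 H e0.
near=> x.
have x0 : 0 < x by near: x; exact: nbhs_right_gt.
have x1 : x <= 1 by near: x; exact: nbhs_right_le.
have xM : x <= Bpos 1 / M.
  by near: x; apply: nbhs_right_le; rewrite divr_gt0// Bpos_gt0.
have /andP[p0 p1] := policy_bounds x.
rewrite ger0_norm ?subr_ge0// lerBlDr -lerBlDl policyE// hM//.
rewrite ler_pdivlMr// gainfun_pos//; apply: le_trans (Bpos_antihomo x0 x1).
by rewrite mulrC -ler_pdivlMr.
Unshelve. all: by end_near. Qed.

(** By concavity, the loss [alpha 1 - alpha s] for s > 1/2 is at most the slope at 1/2 times 1 -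
    s. *)
Lemma alpha_policy_cvg : alpha (policy x) @[x --> 0^'+] --> A1.
Proof.
have h01 : 0 < (2^-1 : R) < 1 by rewrite invr_gt0 ltr0n invf_lt1// ltr1n.
have [h0 h1] := andP h01.
have K0 := lderiv_gt0 H h01.
apply: (@squeeze_cvgr _ _ _ _
  (fun x => A1 - lderiv alpha 2^-1 * (1 - policy x)) (fun=> A1)).
- near=> x; have /andP[p0 p1] := policy_bounds x.
  have hp : 2^-1 < policy x.
    by near: x; move/cvgr_gt: policy_cvg; exact.
  have pp : 0 < policy x <= 1 by rewrite p1 andbT (lt_trans h0).
  apply/andP; split; last first.
    apply: (learning_mono H); rewrite ?in_itv/= ?p0 ?p1 ?ler01 ?lexx//.
  have t := @alpha_tangent _ _ H (policy x) 1 pp; rewrite ler01 lexx in t.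
  have {}t := t isT; rewrite lerBlDr; apply: (le_trans t).
  rewrite lerD2l ler_wpM2r ?subr_ge0//; by apply: (lderiv_le H) => //; exact: ltW.
- have h : A1 - lderiv alpha 2^-1 * (1 - policy x) @[x --> 0^'+] -->
      A1 - lderiv alpha 2^-1 * (1 - 1).
    apply: cvgB; first exact: cvg_cst.
    by apply: cvgMr; apply: cvgB; [exact: cvg_cst|exact: policy_cvg].
  by rewrite subrr mulr0 subr0 in h.
- exact: cvg_cst.
Unshelve. all: by end_near. Qed.

Lemma marginal_cvg0 : marginal x @[x --> 0^'+] --> (0 : R).
Proof.
apply: (@squeeze0 _ (fun x => r^-1 * (1 - policy x))).
  move=> x x0; have /andP[-> _] := marginal_bounds x.
  rewrite /= marginal_pos// policy_pos// ler_pdivlMl//.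
  exact: (prof_w_le prof (Phi_itv x0)).
have h : r^-1 * (1 - policy x) @[x --> 0^'+] --> r^-1 * (1 - 1).
  by apply: cvgMr; apply: cvgB; [exact: cvg_cst|exact: policy_cvg].
by rewrite subrr mulr0 in h.
Qed.

Let continuous_bPhi x : 0 < x -> {for x, continuous (fun z => b (Phi z))}.
Proof.
move=> x0; exact: (is_derive_continuous
  (is_derive_compf (prof_db prof (Phi_itv x0)) (dPhi_gt0 x0))).
Qed.

Let continuous_share_bPhi x : 0 < x ->
  {for x, continuous (fun z => share alpha (b (Phi z)))}.
Proof.
by move=> x0; apply: (continuous_comp (continuous_bPhi x0)); exact: (continuous_share H).
Qed.

Let continuous_alpha_bPhi x : 0 < x ->
  {for x, continuous (fun z => alpha (share alpha (b (Phi z))))}.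
Proof.
move=> x0.
apply: (@continuous_comp _ _ _ (fun z => b (Phi z)) (alpha \o share alpha)).
  exact: continuous_bPhi.
exact: (continuous_alpha_share H).
Qed.

Lemma continuous_density : continuous density.
Proof.
apply: continuous_extend => [x x0|].
  have Fx := F_gt0 x0.
  have cPhi : {for x, continuous Phi} := is_derive_continuous (dPhi_gt0 x0).
  apply: cvgM; last first.
    apply: cvgV; first by rewrite gt_eqF// mulr_gt0.
    by apply: cvgMr; exact: cvg_id.
  apply: cvgM; first by apply: cvgB; [exact: cvg_cst|exact: cPhi].
  exact: (is_derive_continuous
    (is_derive_compf (prof_dF prof (Phi_itv x0)) (dPhi_gt0 x0))).
apply: cvg_trans density_cvg0; apply: near_eq_cvg; apply: near0 => z z0.
by rewrite density_pos.
Qed.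

Lemma continuous_alpha_policy : continuous (fun x => alpha (policy x)).
Proof.
have -> : (fun x => alpha (policy x)) =
    (fun x => if x <= 0 then A1 else alpha (share alpha (b (Phi x)))).
  by apply/funext => x; rewrite /policy; case: ifP.
apply: continuous_extend => [x x0|]; first exact: continuous_alpha_bPhi.
apply: cvg_trans alpha_policy_cvg; apply: near_eq_cvg; apply: near0 => z z0.
by rewrite policy_pos.
Qed.

Definition invested x := if x <= 0 then 0 else F (Phi x).

Let invested_pos x : 0 < x -> invested x = F (Phi x).
Proof. by rewrite /invested leNgt => ->. Qed.

Let alpha_policy_bounds x : 0 <= alpha (policy x) <= A1.
Proof.
have pb := policy_bounds x; rewrite (learning_ge0 H) ?in_itv//=.
apply: (learning_mono H); rewrite ?in_itv//= ?ler01 ?lexx//.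
by case/andP: pb.
Qed.

Lemma is_derive_invested x :
  is_derive x (1 : R) invested (alpha (policy x) * density x).
Proof.
pose dF z := alpha (policy z) * density z.
have dF0 : dF z @[z --> 0^'+] --> (0 : R).
  apply: (@squeeze0 _ (fun z => A1 * density z)) => [z z0|].
    have /andP[a0 a1] := alpha_policy_bounds z.
    by rewrite mulr_ge0 ?density_ge0//= ler_wpM2r ?density_ge0.
  by rewrite -[X in _ --> X](mulr0 A1); apply: cvgMr; exact: density_cvg0.
have F0 : F (Phi z) @[z --> 0^'+] --> (0 : R).
  apply: (@squeeze0 _ (fun z => A1 * Phi z)) => [z z0|].
    by rewrite (ltW (F_gt0 z0)) (prof_F_le prof (Phi_itv z0)).
  by rewrite -[X in _ --> X](mulr0 A1); apply: cvgMr; exact: Phi_cvg0.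
have := @is_derive_extend _ (fun z => F (Phi z)) dF 0 _ F0 dF0 x.
move=> D; apply: is_derive_eq; first apply: D.
  move=> z z0; have := is_derive_compf (prof_dF prof (Phi_itv z0)) (dPhi_gt0 z0).
  by move/is_derive_eq; apply; rewrite /dF policy_pos// density_pos.
by have [x0|x0] := leP x 0; rewrite // /density x0 mulr0.
Qed.

Lemma is_derive_gainfun x :
  is_derive x (1 : R) gainfun (- ((1 - Phi x) * marginal x)).
Proof.
have d0 : - ((1 - Phi z) * marginal z) @[z --> 0^'+] --> (0 : R).
  rewrite -[X in _ --> X]oppr0 -[X in _ --> - X](mulr0 (1 - 0)).
  apply: cvgN; apply: cvgM; last exact: marginal_cvg0.
  by apply: cvgB; [exact: cvg_cst|exact: Phi_cvg0].
have := is_derive_extend is_derive_Bpos Bpos_cvg d0 x.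
move/is_derive_eq; apply.
by have [x0|x0] := leP x 0; rewrite // /marginal x0 mulr0 oppr0.
Qed.

(** The Hamilton-Jacobi-Bellman equation solved for v, with [w (Phi x)] written for v'. The equation
    then holds by construction, and what is left to prove is that v' is indeed [w (Phi x)]. *)
Let vpos x := ((1 - share alpha (b (Phi x))) * x
  + alpha (share alpha (b (Phi x))) * Bpos x - g * x * w (Phi x)) * (r - g)^-1.

Let rg_gt0 : 0 < r - g. Proof. by rewrite subr_gt0. Qed.

(** The envelope theorem differentiates the maximum with the control frozen; inserting the equation
    for [w], everything cancels except [(r - g) * w]. *)
Lemma is_derive_vpos x : 0 < x -> is_derive x (1 : R) vpos (marginal x).
Proof.
move=> x0; have Fx := F_gt0 x0; have /andP[p0 p1] := Phi_itv x0.
have opt y z : 0 < y -> 0 < z ->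
  (1 - share alpha (b (Phi y))) * z + alpha (share alpha (b (Phi y))) * Bpos z
  <= (1 - share alpha (b (Phi z))) * z + alpha (share alpha (b (Phi z))) * Bpos z.
  move=> y0 z0; have := payoff_share_max H z0 (share_bounds H (b (Phi y))) (Bpos_gt0 z0).
  by rewrite -(gainfun_pos z0) -(policyE z0) policy_pos// gainfun_pos.
have dw := is_derive_compf (prof_dw prof (Phi_itv x0)) (dPhi_gt0 x0).
have := is_derive_mulf
  (is_derive_subf
    (envelope x0 opt (continuous_share_bPhi x0) (continuous_alpha_bPhi x0)
      (is_derive_Bpos x0))
    (is_derive_mulf (is_derive_mulf (is_derive_cstf x g) (is_derive_idf x)) dw))
  (is_derive_cstf x (r - g)^-1).
move/is_derive_eq; apply; rewrite marginal_pos//.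
by field; rewrite !gt_eqF// subr_gt0.
Qed.

Definition value x := if x <= 0 then A1 * gain0 * (r - g)^-1 else vpos x.

Lemma value_hjb x : 0 <= x -> (r - g) * value x + g * x * marginal x =
  payoff alpha x (gainfun x) (policy x).
Proof.
rewrite le_eqVlt => /predU1P[<-|x0]; last first.
  rewrite /payoff policy_pos// gainfun_pos// marginal_pos// /value leNgt x0/= /vpos.
  by field; rewrite gt_eqF.
rewrite /payoff /policy /gainfun /marginal /value lexx.
by field; rewrite gt_eqF.
Qed.

Lemma is_derive_value x : is_derive x (1 : R) value (marginal x).
Proof.
have v0 : vpos z @[z --> 0^'+] --> A1 * gain0 * (r - g)^-1.
  have h : ((1 - policy z) * z + alpha (policy z) * Bpos z - g * z * marginal z)
      * (r - g)^-1 @[z --> 0^'+]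
      --> ((1 - 1) * 0 + A1 * gain0 - g * 0 * 0) * (r - g)^-1.
    apply: cvgM; last exact: cvg_cst.
    apply: cvgB; last first.
      apply: cvgM; last exact: marginal_cvg0.
      by apply: cvgMr; exact: cvg_id0.
    apply: cvgD; last by apply: cvgM; [exact: alpha_policy_cvg|exact: Bpos_cvg].
    apply: cvgM; last exact: cvg_id0.
    by apply: cvgB; [exact: cvg_cst|exact: policy_cvg].
  rewrite !mulr0 add0r subr0 in h; apply: cvg_trans h; apply: near_eq_cvg.
  by apply: near0 => z z0; rewrite policy_pos// marginal_pos.
have := is_derive_extend is_derive_vpos v0 marginal_cvg0 x.
move/is_derive_eq; apply.
by have [x0|x0] := leP x 0; rewrite // /marginal x0.
Qed.

Lemma value_increment x y : x <= y -> 0 <= value y - value x <= r^-1 * (y - x).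
Proof.
move=> xy; have dv z : x - 1 < z < y + 1 -> is_derive z (1 : R) value (marginal z).
  by move=> _; exact: is_derive_value.
have [||c _ ->] := mean_value dv _ xy; [by rewrite ltrBlDr ltrDl|by rewrite ltrDl|].
have /andP[m0 m1] := marginal_bounds c; have yx : 0 <= y - x by rewrite subr_ge0.
by rewrite mulr_ge0//= ler_wpM2r.
Qed.

Let near_pinfty (P : R -> Prop) : (forall x, 0 < x -> P x) -> \forall x \near +oo, P x.
Proof.
move=> PP; near=> x; apply: PP; near: x.
exact: nbhs_pinfty_gt.
Unshelve. all: by end_near. Qed.

Lemma Phi_cvg1 : Phi x @[x --> +oo] --> (1 : R).
Proof.
have h : 1 - (1 - Phi x) / x `^ (- theta^-1) * x `^ (- theta^-1) @[x --> +oo]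
    --> 1 - k * 0.
  apply: cvgB; first exact: cvg_cst.
  by apply: cvgM; [exact: Phi_tail|apply: powRN_cvg_pinfty; rewrite invr_gt0].
rewrite mulr0 subr0 in h; apply: cvg_trans h; apply: near_eq_cvg.
apply: near_pinfty => x x0; rewrite divfK; first by ring.
by rewrite gt_eqF// powR_gt0.
Qed.

(** The Pareto tail leaves the power 1 - 1/theta, which is negative because theta < 1. *)
Lemma tail_first_moment : x * (1 - Phi x) @[x --> +oo] --> (0 : R).
Proof.
have h : (1 - Phi x) / x `^ (- theta^-1) * x `^ (- (theta^-1 - 1)) @[x --> +oo]
    --> k * 0.
  apply: cvgM; [exact: Phi_tail|apply: powRN_cvg_pinfty].
  by rewrite subr_gt0 invf_gt1.
rewrite mulr0 in h; apply: cvg_trans h; apply: near_eq_cvg.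
apply: near_pinfty => x x0.
rewrite (_ : - (theta^-1 - 1) = - theta^-1 + 1); last by ring.
rewrite powRD; last by apply/implyP => _; rewrite gt_eqF.
rewrite powRr1 ?(ltW x0)// mulrA divfK; first by rewrite mulrC.
by rewrite gt_eqF// powR_gt0.
Qed.

(** Fixes the constant of integration: with the right derivative and limit 0, [gainfun] has to be
    the gain integral. The limit comes from the upper bound on [b]. *)
Lemma gainfun_cvg_pinfty : gainfun x @[x --> +oo] --> (0 : R).
Proof.
pose C := theta / ((1 - theta) * r).
have h : C * (x * (1 - Phi x) * (Phi x)^-1) @[x --> +oo] --> C * (0 * 1^-1).
  apply: cvgMr; apply: cvgM; first exact: tail_first_moment.
  by apply: cvgV; [exact: oner_neq0|exact: Phi_cvg1].
rewrite mul0r mulr0 in h.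
have sq : \forall x \near +oo, 0 <= gainfun x <= C * (x * (1 - Phi x) * (Phi x)^-1).
  apply: near_pinfty => x x0; rewrite (ltW (gainfun_gt0 x))/= gainfun_pos//.
  rewrite -mulrA mulrCA ler_pM2l//.
  exact: (prof_b_le prof (Phi_itv x0)).
exact: (squeeze_cvgr sq (cvg_cst _) h).
Qed.

Lemma invested_cvg_pinfty : invested x @[x --> +oo] --> g / theta.
Proof.
have h : g / theta - A1 * (1 - Phi x) @[x --> +oo] --> g / theta - A1 * (1 - 1).
  apply: cvgB; first exact: cvg_cst.
  by apply: cvgMr; apply: cvgB; [exact: cvg_cst|exact: Phi_cvg1].
rewrite subrr mulr0 subr0 in h.
have sq : \forall x \near +oo,
    g / theta - A1 * (1 - Phi x) <= invested x <= g / theta.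
  apply: near_pinfty => x x0; rewrite invested_pos//.
  by have := prof_F_end prof (Phi_itv x0); lra.
exact: (squeeze_cvgr sq h (cvg_cst _)).
Qed.

Let deriv_posPhi x : 0 <= x -> deriv_pos Phi x = density x.
Proof. by move=> x0; case: (deriv_pos_is_derive x0 (is_derive_Phi x)). Qed.

Let deriv_pos_value x : 0 <= x -> deriv_pos value x = marginal x.
Proof. by move=> x0; case: (deriv_pos_is_derive x0 (is_derive_value x)). Qed.

Lemma gain_gainfun x : 0 <= x ->
  (@lebesgue_measure R).-integrable `[x, +oo[ (EFin \o gain_integrand Phi value x)
  /\ gain Phi value x = gainfun x.
Proof.
move=> x0.
pose f y := (value y - value x) * density y.
(* The antiderivative found by integration by parts, with [- gainfun] as antiderivative of
   [(1 - Phi) * marginal]; at [x] only [- gainfun x] remains. *)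
pose G y := - ((value y - value x) * (1 - Phi y)) - gainfun y.
have fE : {in `[x, +oo[, gain_integrand Phi value x =1 f}.
  move=> y; rewrite in_itv/= andbT => xy.
  by rewrite /gain_integrand deriv_posPhi// (le_trans x0).
have cf : continuous f.
  move=> y; apply: cvgM; last exact: continuous_density.
  apply: cvgB; last exact: cvg_cst.
  exact: (is_derive_continuous (is_derive_value y)).
have dG (y : R) : is_derive y (1 : R) G (f y).
  have dv := is_derive_subf (is_derive_value y) (is_derive_cstf y (value x)).
  have dp := is_derive_subf (is_derive_cstf y 1) (is_derive_Phi y).
  have := is_derive_subf (is_derive_subf (is_derive_cstf y 0) (is_derive_mulf dv dp))
    (is_derive_gainfun y).
  have -> : (fun z => 0 - (value z - value x) * (1 - Phi z) - gainfun z) = G.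
    by apply/funext => z; rewrite sub0r.
  by move/is_derive_eq; apply; rewrite /f; ring.
have f0 y : x <= y -> 0 <= f y.
  move=> xy; rewrite mulr_ge0 ?density_ge0//.
  by case/andP: (value_increment xy).
(* The value function grows at most with slope 1 / r, so the boundary term is dominated by a
   multiple of [(y - x) * (1 - Phi y)]. *)
have G0 : G y @[y --> +oo] --> (0 : R).
  rewrite -[X in _ --> X]subr0 -[X in _ --> X - _]oppr0.
  apply: cvgB; last exact: gainfun_cvg_pinfty.
  apply: cvgN.
  have h : r^-1 * (y * (1 - Phi y) - x * (1 - Phi y)) @[y --> +oo]
      --> r^-1 * (0 - x * (1 - 1)).
    apply: cvgMr; apply: cvgB; first exact: tail_first_moment.
    by apply: cvgMr; apply: cvgB; [exact: cvg_cst|exact: Phi_cvg1].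
  rewrite subrr mulr0 subrr mulr0 in h.
  have sq : \forall y \near +oo, 0 <= (value y - value x) * (1 - Phi y) <=
      r^-1 * (y * (1 - Phi y) - x * (1 - Phi y)).
    near=> y; have xy : x <= y by near: y; apply: nbhs_pinfty_ge; exact: num_real.
    have /andP[v0 v1] := value_increment xy; have /andP[_ /ltW p1] := Phi_bounds y.
    have p1' : 0 <= 1 - Phi y by rewrite subr_ge0.
    have -> : r^-1 * (y * (1 - Phi y) - x * (1 - Phi y))
        = r^-1 * (y - x) * (1 - Phi y) by ring.
    by apply/andP; split; [exact: mulr_ge0|exact: ler_wpM2r].
  exact: (squeeze_cvgr sq (cvg_cst _) h).
have [If IG] := Rintegral_FTCy cf dG f0 G0.
split.
  apply: (eq_integrable _ _ _ _ If) => // y.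
  by rewrite inE/= => xy; rewrite /= fE.
rewrite /gain (eq_Rintegral_itv fE).
by rewrite IG /G subrr mul0r; ring.
Unshelve. all: by end_near. Qed.

Lemma search_FTC : continuous (fun x => alpha (policy x) * density x).
Proof.
by move=> x; apply: cvgM; [exact: continuous_alpha_policy|exact: continuous_density].
Qed.

Let search_ge0 x : 0 <= alpha (policy x) * density x.
Proof. by rewrite mulr_ge0 ?density_ge0//; case/andP: (alpha_policy_bounds x). Qed.

Let searchE : {in `[0, +oo[, search_integrand alpha Phi policy =1
  (fun x => alpha (policy x) * density x)}.
Proof.
by move=> y; rewrite in_itv/= andbT => y0; rewrite /search_integrand deriv_posPhi.
Qed.

Lemma payoff_policy_max x : 0 <= x -> forall s, `[0, 1]%classic s ->
  payoff alpha x (gainfun x) s <= payoff alpha x (gainfun x) (policy x).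
Proof.
move=> x0 s /=; rewrite in_itv/= => s01.
move: x0; rewrite le_eqVlt => /predU1P[<-|x0]; last first.
  by rewrite (policyE x0); apply: (payoff_share_max H) => //; exact: gainfun_gt0.
rewrite /payoff !mulr0 !add0r ler_pM2r ?gainfun_gt0//.
have [s0 s1] := andP s01.
by rewrite /policy lexx; apply: (learning_mono H); rewrite ?in_itv/= ?ler01 ?lexx.
Qed.

Lemma bgp_solution_of_profile : bgp_solution r theta alpha Phi value policy g.
Proof.
have [Is Es] := @Rintegral_FTCy _ _ _ 0 _ search_FTC is_derive_invested
  (fun y _ => search_ge0 y) invested_cvg_pinfty.
have Is0 x : 0 <= x -> Rintegral (@lebesgue_measure R) `[0, x]
    (search_integrand alpha Phi policy) = invested x.
  move=> x0; have sE : {in `[0, x], search_integrand alpha Phi policy =1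
      (fun x => alpha (policy x) * density x)}.
    move=> y; rewrite in_itv/= => /andP[y0 _].
    by rewrite searchE// in_itv/= y0.
  rewrite (eq_Rintegral_itv sE) (Rintegral_FTC x0 search_FTC is_derive_invested).
  by rewrite {2}/invested lexx subr0.
split.
- have [Id Ed] := @Rintegral_FTCy _ _ _ 0 _ continuous_density is_derive_Phi
    (fun y _ => density_ge0 y) Phi_cvg1.
  split.
  + by move=> x x0; have /andP[-> /ltW ->] := Phi_bounds x.
  + exact: Phi_le0.
  + by move=> x x0; case: (deriv_pos_is_derive x0 (is_derive_Phi x)).
  + by move=> x x0; rewrite deriv_posPhi// density_ge0.
  + apply: (eq_integrable _ _ _ _ Id) => // y.
    by rewrite inE/= in_itv/= andbT => y0; rewrite /= deriv_posPhi.
  + move=> x x0; have dE : {in `[0, x], deriv_pos Phi =1 density}.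
      by move=> y; rewrite in_itv/= => /andP[y0 _]; rewrite deriv_posPhi.
    rewrite (eq_Rintegral_itv dE) (Rintegral_FTC x0 continuous_density is_derive_Phi).
    by rewrite (Phi_le0 (lexx 0)) subr0.
  + exact: Phi_cvg1.
- by move=> x x0; case: (deriv_pos_is_derive x0 (is_derive_value x)).
- by move=> x x0; case: (gain_gainfun x0).
- apply: (eq_integrable _ _ _ _ Is) => // y.
  by rewrite inE/= => y0; rewrite /= searchE.
- move=> x x0; rewrite deriv_posPhi// Is0//.
  move: x0; rewrite le_eqVlt => /predU1P[<-|x0].
    by rewrite mulr0 mul0r /invested lexx mulr0.
  rewrite density_pos// invested_pos//.
  by field; rewrite !gt_eqF.
- move=> x x0; rewrite deriv_pos_value// value_hjb//.
  have [_ ->] := gain_gainfun x0; split; last exact: payoff_policy_max.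
  by exists (policy x) => //=; rewrite in_itv/= policy_bounds.
- move=> x x0; have [_ ->] := gain_gainfun x0.
  have pb : `[0, 1]%classic (policy x) by rewrite /= in_itv/= policy_bounds.
  have h := payoff_policy_max x0; split; first by split.
  move: x0; rewrite le_eqVlt => /predU1P[<-|x0]; last first.
    by rewrite (policyE x0); exact: (maximiser_rule_share H).
  (* At x = 0 the gain is positive, so only the clause prescribing the share 1 is not vacuous. *)
  rewrite /policy lexx; split => //; last by rewrite ltxx.
  by rewrite leNgt gainfun_gt0.
- rewrite (eq_Rintegral_itv searchE) Es {1}/invested lexx subr0 mulrC divfK//.
  by rewrite gt_eqF.
Qed.

End Assembly.

Theorem theorem3p12 (R : realType) (r theta : R) (alpha : R -> R) (ktilde : R)
  (r_gt0 : 0 < r) (theta_gt0 : 0 < theta) (theta_lt1 : theta < 1)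
  (alpha_learning : learning_function alpha)
  (r_gt : theta * alpha 1 < r)
  (ktilde_gt0 : 0 < ktilde) :
  exists (Phi v S : R -> R) (gamma : R),
    [/\ bgp_solution r theta alpha Phi v S gamma,
        ~ trivial_solution r Phi v S gamma
      & pareto_tail theta Phi (gamma / theta * ktilde)].
Proof.
have A0 : 0 < alpha 1.
  by rewrite -(learning_at0 alpha_learning); apply: (alpha_lt alpha_learning).
have [g [F [w [b [L prof]]]]] : exists g F w b L,
    profile (share alpha) (fun c => alpha (share alpha c)) (alpha 1) r theta
      g F w b L.
  apply: exists_profile => //.
  - by move=> c; case/andP: (share_bounds alpha_learning c).
  - by move=> c; case/andP: (share_bounds alpha_learning c).
  - exact: share_homo.
  - exact: continuous_share.
  - exact: share0.
  - exact: exists_share_le_half.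
  - exact: alpha_share_ge0.
  - exact: alpha_share_le.
  - exact: alpha_share_homo.
  - exact: continuous_alpha_share.
  - by move=> c c0; rewrite share0// (learning_at0 alpha_learning).
  - exact: alpha_share_gt0.
have g0 : 0 < g by case/andP: (prof_growth prof).
(* The Pareto constant involves the growth rate, so it is known only once the profile is; the scale
   of x, still free, absorbs it. *)
have k0 : 0 < g / theta * ktilde by rewrite mulr_gt0// divr_gt0.
have [Phi [P0 P01 dP Px tail]] :=
  exists_size_distribution A0 theta_gt0 theta_lt1 prof k0.
do 3!eexists; exists g; split.
- exact: (bgp_solution_of_profile alpha_learning r_gt0 theta_gt0 theta_lt1 r_gt
    prof P0 P01 dP Px tail).
- by case=> g00; rewrite g00 ltxx in g0.
- exact: tail.
Qed.
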